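(* Let $G$ be a locally compact group. The following statements hold: (1) If every open, compactly generated subgroup of $G$ has the ISP, then $G$ has the ISP. (2) If every open, compactly generated subgroup of $G$ has the IIP, then $G$ has the IIP.
   Context: All ideals are two-sided. For a locally compact group $G$ (with a fixed left Haar measure), $L^1(G)$ is regarded as a dense $*$-subalgebra of the reduced group $C^*$-algebra $C^*_{\mathrm{red}}(G)$. - $G$ has the ideal separation property (ISP) if for any distinct closed ideals $I,J \subseteq C^*_{\mathrm{red}}(G)$ we have $I \cap L^1(G) \neq J \cap L^1(G)$. - $G$ has the ideal intersection property (IIP) if for every non-zero closed ideal $I \subseteq C^*_{\mathrm{red}}(G)$ we have $I \cap L^1(G) \neq \{0\}$. *)

(* Defs.v *)
From HB Require Import structures.
From mathcomp Require Import all_boot all_order all_algebra.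
From mathcomp Require Import generic_quotient ring_quotient.
From mathcomp Require Import all_classical all_reals all_analysis.
From mathcomp Require Import complex.
Set Implicit Arguments.
Unset Strict Implicit.
Unset Printing Implicit Defensive.
Import Order.TTheory GRing.Theory Num.Theory.
Import numFieldNormedType.Exports.
Local Open Scope classical_set_scope.
Local Open Scope ring_scope.
Local Open Scope complex_scope.

HB.mixin Record isTopologicalGroup G of Group G & Topological G := {
  mulg_continuous : continuous (fun x : G * G => (x.1 * x.2)%g);
  invg_continuous : continuous (fun x : G => x^-1%g)
}.

#[short(type="topologicalGroupType")]
HB.structure Definition TopologicalGroup :=
  {G of Group G & Topological G & isTopologicalGroup G}.

Section Subgroup.
Variables (G : topologicalGroupType) (H : groupClosed G).

Definition subgroup_type : Type := {x : G | x \in H}.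

HB.instance Definition _ := SubChoice.copy subgroup_type {x : G | x \in H}.

Lemma subgroup_group_closed : group_closed (H : {pred G}).
Proof.
split; first exact: gpred1.
by move=> x y xH yH; apply: gpredM => //; apply: gpredVr.
Qed.

HB.instance Definition _ :=
  SubChoice_isSubGroup.Build G _ subgroup_type subgroup_group_closed.

HB.instance Definition _ := Topological.copy subgroup_type
  (initial_topology (val : subgroup_type -> G)).

Lemma cvg_subgroup (F : set_system subgroup_type) (x : subgroup_type) :
  Filter F -> (val : subgroup_type -> G) @ F --> val x -> F --> x.
Proof.
move=> FF Fx A; rewrite nbhsE => -[B [[C oC <-] Cx] BA].
by apply: filterS BA _; apply: Fx; exact: open_nbhs_nbhs.
Qed.

Lemma val_subgroup_continuous : continuous (val : subgroup_type -> G).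
Proof. exact: initial_continuous. Qed.

Lemma val_subgroupV (x : subgroup_type) : val x^-1%g = (val x)^-1%g.
Proof. by apply: (mulIg (val x)); rewrite -valM !mulVg val1. Qed.

Lemma subgroup_mulg_continuous :
  continuous (fun x : subgroup_type * subgroup_type => (x.1 * x.2)%g).
Proof.
move=> [x1 x2]; apply: cvg_subgroup.
suff : (fun y : subgroup_type * subgroup_type => val (y.1 * y.2)%g) @ (x1, x2)
  --> val (x1 * x2)%g by [].
under [X in X @ _]eq_fun do rewrite valM.
rewrite valM.
apply: (cvg_comp
  (fun y : subgroup_type * subgroup_type => (val y.1, val y.2)) _ _
  (@mulg_continuous G (val x1, val x2))).
apply: cvg_pair.
- exact: (cvg_comp fst (val : subgroup_type -> G) cvg_fst
    (@val_subgroup_continuous x1)).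
- exact: (cvg_comp snd (val : subgroup_type -> G) cvg_snd
    (@val_subgroup_continuous x2)).
Qed.

Lemma subgroup_invg_continuous :
  continuous (fun x : subgroup_type => x^-1%g).
Proof.
move=> x; apply: cvg_subgroup.
  exact: (@fmap_filter _ _ _ _ (nbhs_filter (x : subgroup_type))).
suff : (fun y : subgroup_type => val (y^-1)%g) @ x --> val (x^-1)%g by [].
under [X in X @ _]eq_fun do rewrite val_subgroupV.
rewrite val_subgroupV.
exact: (cvg_comp (val : subgroup_type -> G) (fun y : G => y^-1%g)
  (@val_subgroup_continuous x) (@invg_continuous G (val x))).
Qed.

HB.instance Definition _ := isTopologicalGroup.Build subgroup_type
  subgroup_mulg_continuous subgroup_invg_continuous.

End Subgroup.

(* The abstract subgroup generated by K is the least subgroup containing K;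
   no topological closure is taken. *)
Definition compactly_generated (G : topologicalGroupType) (H : groupClosed G) :=
  exists2 K : set G, compact K &
    [set` H] = smallest (fun A : set G => group_closed (mem A)) K.

Definition borel (G : topologicalGroupType) : Type := G.

Section Borel.
Variable G : topologicalGroupType.

HB.instance Definition _ := TopologicalGroup.on (borel G).
HB.instance Definition _ := isPointed.Build (borel G) 1%g.
HB.instance Definition _ := Measurable.copy (borel G)
  (g_sigma_algebraType (open : set (set (borel G)))).

End Borel.

Section Haar.
Variables (R : realType) (G : topologicalGroupType).

Record left_haar (mu : {measure set (borel G) -> \bar R}) : Prop := {
  haar_neq0 : mu setT != 0%E;
  haar_compact : forall K : set (borel G), compact K -> (mu K < +oo)%E;
  haar_outer_regular : forall A : set (borel G), measurable A ->
    mu A = ereal_inf [set mu U | U in [set U | open U /\ A `<=` U]];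
  haar_inner_regular : forall U : set (borel G), open U ->
    mu U = ereal_sup [set mu K | K in [set K | compact K /\ K `<=` U]];
  haar_invariant : forall (g : borel G) (A : set (borel G)), measurable A ->
    mu [set (g * x)%g | x in A] = mu A
}.

End Haar.

Section ComplexLp.
Context d (T : measurableType d) (R : realType).
Variables (mu : {measure set T -> \bar R}) (p : \bar R) (p1 : (1 <= p)%E).

Definition cLfun : {pred T -> R[i]^o} := [pred f : T -> R[i]^o |
  ((fun x => complex.Re (f x)) \in Lfun mu p) &&
  ((fun x => complex.Im (f x)) \in Lfun mu p)].

Lemma cLfun_submod_closed : submod_closed cLfun.
Proof.
have [L0 LD] := Lfun_submod_closed mu p1.
split; first by rewrite !inE; apply/andP; split; exact: L0.
move=> a f g /andP[rf jf] /andP[rg jg].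
have LDD (b c : R) (u v w : T -> R) : u \in Lfun mu p -> v \in Lfun mu p ->
    w \in Lfun mu p -> (fun x => b * u x + (c * v x + w x)) \in Lfun mu p.
  by move=> Lu Lv Lw; apply: (LD b u _ Lu); exact: (LD c v w Lv Lw).
have E x : (a *: f + g) x = a * f x + g x by [].
apply/andP; split.
- rewrite (_ : (fun x => _) = (fun x => complex.Re a * complex.Re (f x) +
    (- complex.Im a * complex.Im (f x) + complex.Re (g x)))); first exact: LDD.
  apply/funext => x; rewrite E addrA mulNr.
  by case: a (f x) (g x) {E} => [? ?] [? ?] [? ?].
- rewrite (_ : (fun x => _) = (fun x => complex.Re a * complex.Im (f x) +
    (complex.Im a * complex.Re (f x) + complex.Im (g x)))); first exact: LDD.
  apply/funext => x; rewrite E addrA.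
  by case: a (f x) (g x) {E} => [? ?] [? ?] [? ?].
Qed.

End ComplexLp.

Definition cintegral d (T : measurableType d) (R : realType)
    (mu : {measure set T -> \bar R}) (f : T -> R[i]) : R[i] :=
  (\int[mu]_x complex.Re (f x)) +i* (\int[mu]_x complex.Im (f x)).

Section L2.
Context d (T : measurableType d) (R : realType).
Variable mu : {measure set T -> \bar R}.

Definition cL2fun : {pred T -> R[i]^o} := cLfun mu 2%:E.

HB.instance Definition _ :=
  GRing.isSubmodClosed.Build _ _ cL2fun (cLfun_submod_closed mu (lee1n 2)).

Record L2fun := MkL2fun { L2fun_val : T -> R[i]^o; _ : L2fun_val \in cL2fun }.

HB.instance Definition _ := [isSub for L2fun_val].
HB.instance Definition _ := [Choice of L2fun by <:].
HB.instance Definition _ := [SubChoice_isSubLmodule of L2fun by <:].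

Definition L2null : {pred L2fun} :=
  [pred f : L2fun | `[< {ae mu, forall x, val f x = 0} >]].

Lemma L2null_submod_closed : submod_closed L2null.
Proof.
split; first by rewrite inE; apply: aeW => x; rewrite raddf0.
move=> a f g; rewrite !inE => f0 g0.
by near=> x; rewrite linearP/= -[LHS]/(a * val f x + val g x)
  (near f0 x)// (near g0 x)// mulr0 addr0.
Unshelve. all: end_near. Qed.

HB.instance Definition _ :=
  GRing.isSubmodClosed.Build _ _ L2null L2null_submod_closed.

Local Open Scope quotient_scope.

Definition L2 : Type := Quotient.quot L2null.
HB.instance Definition _ := EqQuotient.on L2.
HB.instance Definition _ := ZmodQuotient.on L2.
HB.instance Definition _ := Choice.on L2.

Definition L2scale (a : R[i]) (u : L2) : L2 := \pi_L2 (a *: repr u).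

Lemma pi_L2scale a : {morph \pi_L2 : f / a *: f >-> L2scale a f}.
Proof.
move=> f; apply/eqP; rewrite -Quotient.idealrBE -scalerBr rpredZ//.
by rewrite Quotient.idealrBE reprK; exact: eqxx.
Qed.

Lemma L2scalerA a b u : L2scale a (L2scale b u) = L2scale (a * b) u.
Proof.
elim/quotW: u => f.
by rewrite -(pi_L2scale b) -(pi_L2scale a) -(pi_L2scale (a * b)) scalerA.
Qed.

Lemma L2scale1r : left_id 1 L2scale.
Proof. by elim/quotW => f; rewrite -!pi_L2scale scale1r. Qed.

Lemma L2scalerDr : right_distributive L2scale +%R.
Proof.
move=> a; elim/quotW => f; elim/quotW => g.
by rewrite -raddfD -!pi_L2scale scalerDr raddfD.
Qed.

Lemma L2scalerDl u : {morph L2scale^~ u : a b / a + b}.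
Proof.
by move=> a b; elim/quotW: u => f; rewrite -!pi_L2scale scalerDl raddfD.
Qed.

HB.instance Definition _ := GRing.Zmodule_isLmodule.Build R[i] L2
  L2scalerA L2scale1r L2scalerDr L2scalerDl.

(* A representative of a class; integrals against it do not depend on the
   choice. *)
Definition L2repr (u : L2) : T -> R[i] := val (repr u).

Definition L2dot (u v : L2) : R[i] :=
  cintegral mu (fun x => L2repr u x * (L2repr v x)^*).

Definition L2norm (u : L2) : R := Num.sqrt (complex.Re (L2dot u u)).

Definition bounded_operator (S : L2 -> L2) :=
  linear S /\ exists M : R, forall u, L2norm (S u) <= M * L2norm u.

Definition opnorm (S : L2 -> L2) : R :=
  sup [set L2norm (S u) | u in [set u | L2norm u <= 1]].

(* Closure for the operator norm, taken inside the bounded operators so that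
   opnorm is only applied where the supremum is finite. *)
Definition opclosure (X : set (L2 -> L2)) : set (L2 -> L2) :=
  [set S | bounded_operator S /\
    forall e : R, 0 < e -> exists2 S', X S' & opnorm (S - S') < e].

End L2.

Section Reduced.
Variables (R : realType) (G : topologicalGroupType).
Variable mu : {measure set (borel G) -> \bar R}.

(* <lambda_y u, v>, where (lambda_y u)(x) = u (y^-1 x) *)
Definition regular_coef (y : G) (u v : L2 mu) : R[i] :=
  cintegral mu (fun x : borel G => L2repr u (y^-1 * x)%g * (L2repr v x)^*).

(* S = lambda(f) = \int f(y) lambda_y dy as a weak integral: this is left
   convolution by f, without a product sigma-algebra on G * G, which can be
   smaller than the Borel sets when G is not second countable. *)
Definition integrated_form (f : borel G -> R[i]) (S : L2 mu -> L2 mu) :=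
  bounded_operator S /\
  forall u v, L2dot (S u) v = cintegral mu (fun y => f y * regular_coef y u v).

(* L^1(G), identified with its image under the left regular representation *)
Definition L1_operators : set (L2 mu -> L2 mu) :=
  [set S | exists2 f, f \in cLfun mu 1 & integrated_form f S].

Definition reduced_algebra : set (L2 mu -> L2 mu) := opclosure L1_operators.

Record closed_ideal (I : set (L2 mu -> L2 mu)) : Prop := {
  ideal_sub : I `<=` reduced_algebra;
  ideal_zero : I 0;
  ideal_linear : forall (a : R[i]) S S', I S -> I S' -> I (a *: S + S');
  ideal_left : forall S S', reduced_algebra S -> I S' -> I (S \o S');
  ideal_right : forall S S', I S -> reduced_algebra S' -> I (S \o S');
  ideal_closed : opclosure I `<=` I
}.

End Reduced.
Arguments L1_operators {R G} mu.
Arguments reduced_algebra {R G} mu.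
Arguments closed_ideal {R G} mu I.

(* Left Haar measures agree up to a positive factor, and rescaling mu changes
   neither the closed ideals nor L1_operators: quantifying over mu amounts to
   fixing one. *)
Definition ISP (R : realType) (G : topologicalGroupType) :=
  forall mu : {measure set (borel G) -> \bar R}, left_haar mu ->
  forall I J, closed_ideal mu I -> closed_ideal mu J -> I <> J ->
    I `&` L1_operators mu <> J `&` L1_operators mu.

Definition IIP (R : realType) (G : topologicalGroupType) :=
  forall mu : {measure set (borel G) -> \bar R}, left_haar mu ->
  forall I, closed_ideal mu I -> I <> [set 0] ->
    I `&` L1_operators mu <> [set 0].

(* Main.v *)
Require Import Defs.
From HB Require Import structures.
From mathcomp Require Import all_boot all_order all_algebra.
From mathcomp Require Import generic_quotient ring_quotient.
From mathcomp Require Import all_classical all_reals all_analysis.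
From mathcomp Require Import measurable_realfun.
From mathcomp Require Import complex ring lra.
Set Implicit Arguments.
Unset Strict Implicit.
Unset Printing Implicit Defensive.
Import Order.TTheory GRing.Theory Num.Theory.
Import numFieldNormedType.Exports.
Local Open Scope classical_set_scope.
Local Open Scope ring_scope.
Local Open Scope complex_scope.
Local Notation "z ^*" := (Num.conj z) : complex_scope.
Local Notation Re := complex.Re.
Local Notation Im := complex.Im.
Local Notation cabs := (@Normc.normc _).

(** Write [A(G)] for the reduced algebra of [G]. The idea is that a closed ideal [I] of
    [A(G)] is determined by its traces on the algebras [A(H)], for [H] an open compactly
    generated subgroup of [G], and that the trace of [I] on [L1(H)] is determined by that
    of [I] on [L1(G)].

    Comparison of [H] and [G]. By uniqueness of Haar measure ([haar_unique]) the space
    [L2(G)] is the orthogonal sum of the [L2(H c)], over the right cosets of [H], and each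
    of them is up to a scalar a copy of [L2(H)] on which [H] acts by left translation.
    Hence the extension of functions by zero, from [L1(H)] to [L1(G)], is isometric for
    the operator norms and extends to an embedding of [A(H)] into [A(G)]. It is described
    by the relation [linked] between operators on [L2(H)] and on [L2(G)]
    ([linked_bound], [reduced_algebra_linked]). The elements of [A(H)] linked to elements
    of [I] form a closed ideal [restr_ideal I] of [A(H)], whose elements in [L1(H)] are
    those linked to elements of [I] in [L1(G)] ([linked_L1]). Under the ISP for [H],
    the ideal [restr_ideal I] depends only on the intersection of [I] with [L1(G)]; under
    the IIP for [H], it vanishes if this intersection does.

    From [H] back to [G]. The union of the [A(H)] is dense in [A(G)], because a function
    in [L1(G)] is nearly supported in a compact set, which lies in some [H]. It remains
    to show that the elements of [I] coming from the subgroups are dense in [I]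
    ([ideal_local]). This is the fact that ideals of an inductive limit of C*-algebras
    are inductive limits. Let [a] be in [I] and [B], coming from [b] in [A(H)], be
    within [eta] of [a]. The class of [X = B^* B] modulo [I] has norm at most [eta], so
    the cut-off [Z = max (X - 2 eta) 0] lies in [I], and it comes from [A(H)]. For a
    truncated geometric series [r(X)] that approximates the inverse of [X], the element
    [B Z r(X)] of [I] is close to [B X r(X)], which is close to [B]
    ([ideal_local_subgroup]). The membership of [Z] in [I] is proved without quotient
    algebras: [Z] is nearly [h(X) X^k] with [|h| <= (2 eta)^-k] ([cutoff_operator])
    whereas [X^k] is within [eta^k] of [I] ([ideal_power]). The functional calculus with
    polynomials rests on the bound of [p(X)] by the maximum of [|p|] on [0, 1] for [0 <=
    X <= 1] ([opoly_bound]), which has an algebraic proof by induction on the degree of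
    [p] ([moment_ge0]).

    That [A(G)] is a *-algebra is not part of its definition. Products and adjoints of the
    operators [lambda(f)] are averages of translates of some [lambda(g)], and such averages
    are norm limits of finite linear combinations of translates ([average_in_reduced]). *)

(** * Complex numbers and complex integrals *)

Section ComplexNumbers.
Variable R : rcfType.
Implicit Types z w : R[i].

Lemma cReD z w : Re (z + w) = Re z + Re w.
Proof. by case: z w => [? ?] [? ?]. Qed.

Lemma cImD z w : Im (z + w) = Im z + Im w.
Proof. by case: z w => [? ?] [? ?]. Qed.

Lemma cReN z : Re (- z) = - Re z. Proof. by case: z. Qed.

Lemma cImN z : Im (- z) = - Im z. Proof. by case: z. Qed.

Lemma cReM z w : Re (z * w) = Re z * Re w - Im z * Im w.
Proof. by case: z w => [? ?] [? ?]. Qed.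

Lemma cImM z w : Im (z * w) = Re z * Im w + Im z * Re w.
Proof. by case: z w => [? ?] [? ?]. Qed.

Lemma cReJ z : Re z^* = Re z. Proof. by case: z. Qed.

Lemma cImJ z : Im z^* = - Im z. Proof. by case: z. Qed.

Lemma cconjK z : (z^*)^* = z. Proof. exact: conjcK. Qed.

Lemma cconj0 : (0 : R[i])^* = 0. Proof. exact: conjc0. Qed.

Lemma cconjR (x : R) : (x%:C)^* = x%:C. Proof. exact: conjc_real. Qed.

Lemma cconjD z w : (z + w)^* = z^* + w^*. Proof. exact: rmorphD. Qed.

Lemma cconjN z : (- z)^* = - z^*. Proof. exact: rmorphN. Qed.

Lemma cconjM z w : (z * w)^* = z^* * w^*. Proof. exact: rmorphM. Qed.

Lemma eq_ReIm z w : Re z = Re w -> Im z = Im w -> z = w.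
Proof. by case: z w => [? ?] [? ?] /= -> ->. Qed.

Lemma sqr_cabs z : cabs z ^+ 2 = Re z ^+ 2 + Im z ^+ 2.
Proof. by case: z => a b /=; rewrite sqr_sqrtr// addr_ge0 ?sqr_ge0. Qed.

Lemma cabs_ge0 z : 0 <= cabs z. Proof. by case: z => a b; exact: sqrtr_ge0. Qed.

Lemma cabs0 : cabs (0 : R[i]) = 0. Proof. exact: Normc.normc0. Qed.

Lemma cabsM z w : cabs (z * w) = cabs z * cabs w.
Proof. exact: Normc.normcM. Qed.

Lemma cabsD z w : cabs (z + w) <= cabs z + cabs w.
Proof. exact: le_normcD. Qed.

Lemma cabsN z : cabs (- z) = cabs z. Proof. exact: normcN. Qed.

Lemma cabsJ z : cabs z^* = cabs z.
Proof. by case: z => a b /=; rewrite sqrrN. Qed.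

Lemma cabsR (x : R) : cabs x%:C = `|x|.
Proof. by rewrite /= expr0n addr0 sqrtr_sqr. Qed.

Lemma ler_Re_cabs z : `|Re z| <= cabs z.
Proof.
case: z => a b /=; rewrite -sqrtr_sqr ler_wsqrtr// lerDl sqr_ge0//.
Qed.

Lemma ler_Im_cabs z : `|Im z| <= cabs z.
Proof.
case: z => a b /=; rewrite -(sqrtr_sqr b) ler_wsqrtr// lerDr sqr_ge0//.
Qed.

Lemma ler_cabs_ReIm z : cabs z <= `|Re z| + `|Im z|.
Proof.
rewrite -(@ler_pXn2r _ 2) ?nnegrE ?cabs_ge0 ?addr_ge0// sqr_cabs.
rewrite sqrrD !real_normK ?num_real// -addrA lerD2l lerDr.
by rewrite mulrn_wge0// mulr_ge0.
Qed.

Lemma mulcJ z : z * z^* = (cabs z ^+ 2)%:C.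
Proof.
rewrite sqr_cabs; apply: eq_ReIm; rewrite ?cReM ?cImM cReJ cImJ/=; ring.
Qed.

Lemma Re_mulJ z : Re (z * z^*) = cabs z ^+ 2.
Proof. by rewrite mulcJ. Qed.

End ComplexNumbers.

Section ComplexIntegral.
Context d (T : measurableType d) (R : realType).
Variable mu : {measure set T -> \bar R}.
Implicit Types (f g : T -> R[i]) (a : R[i]) (h : T -> R).

Definition cmeasurable f :=
  measurable_fun setT (fun x => Re (f x)) /\
  measurable_fun setT (fun x => Im (f x)).

Definition rintegrable h := mu.-integrable setT (EFin \o h).

Lemma cLfun1P f : f \in cLfun mu 1 <->
  rintegrable (fun x => Re (f x)) /\ rintegrable (fun x => Im (f x)).
Proof.
split=> [/andP[]|[rf jf]]; first by rewrite !Lfun1_integrable.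
by apply/andP; split; exact/Lfun1_integrable.
Qed.

Lemma rintegrable_measurable h : rintegrable h -> measurable_fun setT h.
Proof. by move=> /measurable_int/measurable_EFinP. Qed.

Lemma cLfun1_measurable f : f \in cLfun mu 1 -> cmeasurable f.
Proof. by move=> /cLfun1P[rf jf]; split; exact: rintegrable_measurable. Qed.

Lemma cmeasurableJ f : cmeasurable f -> cmeasurable (fun x => (f x)^*).
Proof.
move=> [rf jf]; split; first by under eq_fun do rewrite cReJ.
under eq_fun do rewrite cImJ.
exact: measurable_funN.
Qed.

Lemma cmeasurableM f g : cmeasurable f -> cmeasurable g ->
  cmeasurable (fun x => f x * g x).
Proof.
move=> [rf jf] [rg jg]; split; under eq_fun do rewrite (cReM,cImM).
  by apply: measurable_funB; exact: measurable_funM.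
by apply: measurable_funD; exact: measurable_funM.
Qed.

Lemma cmeasurableB f g : cmeasurable f -> cmeasurable g ->
  cmeasurable (fun x => f x - g x).
Proof.
move=> [rf jf] [rg jg]; split.
  by under eq_fun do rewrite cReD cReN; exact: measurable_funB.
by under eq_fun do rewrite cImD cImN; exact: measurable_funB.
Qed.

Lemma measurable_cabs f : cmeasurable f -> measurable_fun setT (fun x => cabs (f x)).
Proof.
move=> [rf jf].
rewrite (_ : (fun _ => _) =
    (@Num.sqrt R) \o (fun x => Re (f x) ^+ 2 + Im (f x) ^+ 2)); last first.
  by apply/funext => x /=; rewrite -sqr_cabs sqrtr_sqr ger0_norm ?cabs_ge0.
apply: measurableT_comp; first by apply: continuous_measurable_fun; exact: sqrt_continuous.
by apply: measurable_funD; exact: measurable_funX.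
Qed.

Lemma le_rintegrable h h' : measurable_fun setT h -> (forall x, `|h x| <= h' x) ->
  rintegrable h' -> rintegrable h.
Proof.
move=> mh hh' ih'; apply: le_integrable ih' => //; first exact/measurable_EFinP.
by move=> x _ /=; rewrite lee_fin (le_trans (hh' x))// ler_norm.
Qed.

Lemma rintegrableD h h' : rintegrable h -> rintegrable h' ->
  rintegrable (fun x => h x + h' x).
Proof. by move=> ih ih'; exact: (integrableD _ ih ih'). Qed.

Lemma rintegrableB h h' : rintegrable h -> rintegrable h' ->
  rintegrable (fun x => h x - h' x).
Proof. by move=> ih ih'; exact: (integrableB _ ih ih'). Qed.

Lemma rintegrableZ (k : R) h : rintegrable h -> rintegrable (fun x => k * h x).
Proof. by move=> ih; exact: (integrableZl _ k ih). Qed.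

Lemma cLfun1_cabs f :
  f \in cLfun mu 1 <-> cmeasurable f /\ rintegrable (fun x => cabs (f x)).
Proof.
split=> [f1|[[rf jf] fi]].
  split; first exact: cLfun1_measurable.
  have [rf jf] := (cLfun1P f).1 f1.
  apply: (@le_rintegrable _ (fun x => `|Re (f x)| + `|Im (f x)|)).
  - exact: (measurable_cabs (cLfun1_measurable f1)).
  - by move=> x; rewrite ger0_norm ?cabs_ge0 ?ler_cabs_ReIm.
  - by apply: rintegrableD; exact: integrable_norm.
apply/cLfun1P; split; apply: le_rintegrable fi => // x.
- exact: ler_Re_cabs.
- exact: ler_Im_cabs.
Qed.

Lemma le_cLfun1 f h : cmeasurable f -> (forall x, cabs (f x) <= h x) ->
  rintegrable h -> f \in cLfun mu 1.
Proof.
move=> mf fh ih; apply/cLfun1_cabs; split => //.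
apply: le_rintegrable ih; first exact: measurable_cabs.
by move=> x; rewrite ger0_norm ?cabs_ge0.
Qed.

Lemma cLfun1D f g : f \in cLfun mu 1 -> g \in cLfun mu 1 ->
  (fun x => f x + g x) \in cLfun mu 1.
Proof.
move=> /cLfun1P[rf jf] /cLfun1P[rg jg]; apply/cLfun1P.
by split; under eq_fun do rewrite (cReD,cImD); exact: rintegrableD.
Qed.

Lemma cLfun1Z a f : f \in cLfun mu 1 -> (fun x => a * f x) \in cLfun mu 1.
Proof.
move=> /cLfun1P[rf jf]; apply/cLfun1P; split; under eq_fun do rewrite (cReM,cImM).
  by apply: rintegrableB; exact: rintegrableZ.
by apply: rintegrableD; exact: rintegrableZ.
Qed.

Lemma cLfun1N f : f \in cLfun mu 1 -> (fun x => - f x) \in cLfun mu 1.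
Proof. by move=> /(cLfun1Z (-1)); under eq_fun do rewrite mulN1r. Qed.

Lemma cLfun1B f g : f \in cLfun mu 1 -> g \in cLfun mu 1 ->
  (fun x => f x - g x) \in cLfun mu 1.
Proof. by move=> f1 g1; apply: cLfun1D => //; exact: cLfun1N. Qed.

Lemma cLfun1J f : f \in cLfun mu 1 -> (fun x => (f x)^*) \in cLfun mu 1.
Proof.
move=> /cLfun1P[rf jf]; apply/cLfun1P.
split; first by under eq_fun do rewrite cReJ.
under eq_fun do rewrite cImJ.
have -> : (fun x => - Im (f x)) = (fun x => -1 * Im (f x)).
  by apply/funext => x; rewrite mulN1r.
exact: rintegrableZ.
Qed.

Lemma cintegralD f g : f \in cLfun mu 1 -> g \in cLfun mu 1 ->
  cintegral mu (fun x => f x + g x) = cintegral mu f + cintegral mu g.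
Proof.
move=> /cLfun1P[rf jf] /cLfun1P[rg jg]; apply: eq_ReIm; rewrite (cReD,cImD)/=.
  by under eq_Rintegral do rewrite cReD; rewrite RintegralD.
by under eq_Rintegral do rewrite cImD; rewrite RintegralD.
Qed.

Lemma cintegralZ a f : f \in cLfun mu 1 ->
  cintegral mu (fun x => a * f x) = a * cintegral mu f.
Proof.
move=> /cLfun1P[rf jf]; apply: eq_ReIm; rewrite (cReM,cImM)/=.
  under eq_Rintegral do rewrite cReM.
  by rewrite RintegralB ?RintegralZl//; exact: rintegrableZ.
under eq_Rintegral do rewrite cImM.
by rewrite RintegralD ?RintegralZl//; exact: rintegrableZ.
Qed.

Lemma cintegralN f : f \in cLfun mu 1 ->
  cintegral mu (fun x => - f x) = - cintegral mu f.
Proof.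
by move=> f1; under eq_fun do rewrite -mulN1r; rewrite cintegralZ// mulN1r.
Qed.

Lemma cintegralB f g : f \in cLfun mu 1 -> g \in cLfun mu 1 ->
  cintegral mu (fun x => f x - g x) = cintegral mu f - cintegral mu g.
Proof.
by move=> f1 g1; rewrite cintegralD ?cintegralN//; exact: cLfun1N.
Qed.

Lemma cintegralJ f : f \in cLfun mu 1 ->
  cintegral mu (fun x => (f x)^*) = (cintegral mu f)^*.
Proof.
move=> /cLfun1P[rf jf]; apply: eq_ReIm; rewrite (cReJ,cImJ)/=.
  by under eq_Rintegral do rewrite cReJ.
by under eq_Rintegral do rewrite cImJ -mulN1r; rewrite RintegralZl// mulN1r.
Qed.

Lemma cabs_cintegral f : f \in cLfun mu 1 ->
  cabs (cintegral mu f) <= \int[mu]_x cabs (f x).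
Proof.
move=> f1; have [mf cf] := (cLfun1_cabs f).1 f1.
set z := cintegral mu f.
have [->|z0] := eqVneq (cabs z) 0; first exact: (Rintegral_ge0 _ (fun _ _ => cabs_ge0 _)).
have zp : 0 < cabs z by rewrite lt_def z0 cabs_ge0.
rewrite -(ler_pM2l zp) -expr2 -Re_mulJ mulrC -cintegralZ// -RintegralZl//.
have zf1 := cLfun1Z z^* f1.
apply: le_Rintegral => //; first by have /cLfun1P[] := zf1.
  exact: rintegrableZ.
move=> x _; apply: le_trans (ler_norm _) _.
by rewrite (le_trans (ler_Re_cabs _))// cabsM cabsJ.
Qed.

Lemma ae_eq_Rintegral h h' : measurable_fun setT h -> measurable_fun setT h' ->
  {ae mu, forall x, h x = h' x} -> \int[mu]_x h x = \int[mu]_x h' x.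
Proof.
move=> mh mh' hh'; congr fine; apply: ae_eq_integral => //; try exact/measurable_EFinP.
by apply: filterS hh' => x + _ => ->.
Qed.

Lemma ae_eq_cintegral f g : cmeasurable f -> cmeasurable g ->
  {ae mu, forall x, f x = g x} -> cintegral mu f = cintegral mu g.
Proof.
move=> [rf jf] [rg jg] fg; apply: eq_ReIm => /=; apply: ae_eq_Rintegral => //;
  by apply: filterS fg => x ->.
Qed.

End ComplexIntegral.

(** * The Hilbert space L2 *)

Section SquareIntegrable.
Context d (T : measurableType d) (R : realType).
Variable mu : {measure set T -> \bar R}.
Implicit Types (f g : T -> R[i]) (h : T -> R).

Lemma Lfun2P h : h \in Lfun mu 2%:E <->
  measurable_fun setT h /\ rintegrable mu (fun x => h x ^+ 2).
Proof.
split=> [h2|[mh ih]].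
  split; last exact: Lfun2_integrable_sqr.
  by have /andP[/[!inE]] := h2.
rewrite inE; apply/andP; split; rewrite inE//=.
rewrite /finite_norm unlock poweR_lty//.
have /integrableP[_] := ih; apply: le_lt_trans.
apply: ge0_le_integral => //=.
- apply/measurable_EFinP => /=.
  apply: (measurableT_comp (measurable_powR _)) => //.
  exact: measurableT_comp.
- apply/measurable_EFinP; apply: measurableT_comp => //.
  exact: measurable_funX.
- by move=> x _; rewrite lee_fin powR_mulrn// normrX.
Qed.

Lemma cL2P f : f \in cL2fun mu <->
  cmeasurable f /\ rintegrable mu (fun x => cabs (f x) ^+ 2).
Proof.
split=> [/andP[/Lfun2P[rf irf] /Lfun2P[jf ijf]]|[[rf jf] fi]].
  split; first by split.
  by under eq_fun do rewrite sqr_cabs; exact: rintegrableD.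
apply/andP; split; apply/Lfun2P; split => //.
  apply: le_rintegrable fi; first exact: measurable_funX.
  by move=> x; rewrite normrX sqr_cabs real_normK ?num_real// lerDl sqr_ge0.
apply: le_rintegrable fi; first exact: measurable_funX.
by move=> x; rewrite normrX sqr_cabs real_normK ?num_real// lerDr sqr_ge0.
Qed.

Lemma cL2_lin a f g : f \in cL2fun mu -> g \in cL2fun mu ->
  (fun x => a * f x + g x) \in cL2fun mu.
Proof. by have [_ +] := cLfun_submod_closed mu (lee1n 2); apply. Qed.

Lemma cL2D f g : f \in cL2fun mu -> g \in cL2fun mu ->
  (fun x => f x + g x) \in cL2fun mu.
Proof.
by move=> f2 g2; have := cL2_lin 1 f2 g2; under eq_fun do rewrite mul1r.
Qed.

Lemma cL20 : (fun=> 0) \in cL2fun mu.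
Proof. by have [+ _] := cLfun_submod_closed mu (lee1n 2). Qed.

Lemma cL2Z a f : f \in cL2fun mu -> (fun x => a * f x) \in cL2fun mu.
Proof. by move=> f2; have := cL2_lin a f2 cL20; under eq_fun do rewrite addr0. Qed.

Lemma cL2B f g : f \in cL2fun mu -> g \in cL2fun mu ->
  (fun x => f x - g x) \in cL2fun mu.
Proof.
move=> f2 g2; have := cL2_lin (-1) g2 f2.
by under eq_fun do rewrite mulN1r addrC.
Qed.

Lemma cL2_mulJ f g : f \in cL2fun mu -> g \in cL2fun mu ->
  (fun x => f x * (g x)^*) \in cLfun mu 1.
Proof.
move=> /cL2P[mf f2] /cL2P[mg g2].
apply: (@le_cLfun1 _ _ _ _ _ (fun x => cabs (f x) ^+ 2 + cabs (g x) ^+ 2)).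
- by apply: cmeasurableM => //; exact: cmeasurableJ.
- move=> x; rewrite cabsM cabsJ.
  have := sqr_ge0 (cabs (f x) - cabs (g x)).
  have := cabs_ge0 (f x); have := cabs_ge0 (g x); nra.
- exact: rintegrableD.
Qed.

Lemma le_cL2 f h : cmeasurable f -> (forall x, cabs (f x) ^+ 2 <= h x) ->
  rintegrable mu h -> f \in cL2fun mu.
Proof.
move=> mf fh ih; apply/cL2P; split => //; apply: le_rintegrable ih.
  by apply: measurable_funX; exact: measurable_cabs.
by move=> x; rewrite ger0_norm ?sqr_ge0.
Qed.

Local Open Scope quotient_scope.

(** The class of a square-integrable function; the junk value 0 elsewhere keeps
    the map total. *)
Definition toL2 f : L2 mu := \pi_(L2 mu) (insubd (0 : L2fun mu) f).

Lemma L2repr_cL2 (u : L2 mu) : L2repr u \in cL2fun mu.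
Proof. by rewrite /L2repr; exact: valP. Qed.

Lemma L2repr_measurable (u : L2 mu) : cmeasurable (L2repr u).
Proof. by have [] := (cL2P _).1 (L2repr_cL2 u). Qed.

Lemma pi_L2_eq (p q : L2fun mu) :
  \pi_(L2 mu) p = \pi_(L2 mu) q <-> {ae mu, forall x, val p x = val q x}.
Proof.
split=> [/eqP|pq].
  rewrite -Quotient.idealrBE inE => /= pq.
  apply: filterS pq => x.
  by rewrite -[LHS]/(val p x - val q x) => /eqP; rewrite subr_eq0 => /eqP.
apply/eqP; rewrite -Quotient.idealrBE inE; apply: filterS pq => x pq.
by rewrite -[LHS]/(val p x - val q x) pq subrr.
Qed.

Lemma L2repr_toL2 f : f \in cL2fun mu -> {ae mu, forall x, L2repr (toL2 f) x = f x}.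
Proof.
move=> f2; have : \pi_(L2 mu) (repr (toL2 f)) = toL2 f by rewrite reprK.
by move/pi_L2_eq; rewrite /L2repr insubdK.
Qed.

Lemma eq_L2P (u v : L2 mu) : u = v <-> {ae mu, forall x, L2repr u x = L2repr v x}.
Proof. by rewrite -pi_L2_eq !reprK. Qed.

Lemma toL2K (u : L2 mu) : toL2 (L2repr u) = u.
Proof. by apply/eq_L2P; exact: (L2repr_toL2 (L2repr_cL2 u)). Qed.

Lemma eq_toL2 f g : f \in cL2fun mu -> g \in cL2fun mu ->
  {ae mu, forall x, f x = g x} -> toL2 f = toL2 g.
Proof. by move=> f2 g2 fg; apply/pi_L2_eq; rewrite !insubdK. Qed.

Lemma L2repr_lin a (u v : L2 mu) :
  {ae mu, forall x, L2repr (a *: u + v) x = a * L2repr u x + L2repr v x}.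
Proof.
have E : a *: u + v = \pi_(L2 mu) (a *: repr u + repr v).
  by rewrite raddfD/= reprK.
have : \pi_(L2 mu) (repr (a *: u + v)) = \pi_(L2 mu) (a *: repr u + repr v).
  by rewrite reprK.
by move/pi_L2_eq.
Qed.

Lemma L2repr0 : {ae mu, forall x, L2repr (0 : L2 mu) x = 0}.
Proof.
have := L2repr_lin 0 (0 : L2 mu) 0; rewrite scaler0 addr0 => H.
have := L2repr_lin (-1) (0 : L2 mu) 0; rewrite scaler0 addr0 => H'.
by apply: filterS2 H H' => x -> ; rewrite mul0r add0r mulN1r addNr.
Qed.

Lemma toL2_lin a f g : f \in cL2fun mu -> g \in cL2fun mu ->
  toL2 (fun x => a * f x + g x) = a *: toL2 f + toL2 g.
Proof.
move=> f2 g2; apply/eq_L2P.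
have fg2 : (fun x => a * f x + g x) \in cL2fun mu by apply: cL2D => //; exact: cL2Z.
have H := L2repr_toL2 fg2.
have H' := L2repr_lin a (toL2 f) (toL2 g).
have Hf := L2repr_toL2 f2; have Hg := L2repr_toL2 g2.
by near=> x; rewrite (near H x)// (near H' x)// (near Hf x)// (near Hg x).
Unshelve. all: end_near. Qed.

End SquareIntegrable.

Section InnerProduct.
Context d (T : measurableType d) (R : realType).
Variable mu : {measure set T -> \bar R}.
Implicit Types (f g : T -> R[i]) (u v w : L2 mu) (a : R[i]).

Lemma L2dot_toL2 f g : f \in cL2fun mu -> g \in cL2fun mu ->
  L2dot (toL2 mu f) (toL2 mu g) = cintegral mu (fun x => f x * (g x)^*).
Proof.
move=> f2 g2; apply: ae_eq_cintegral.
- by apply: cmeasurableM; [|apply: cmeasurableJ]; exact: L2repr_measurable.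
- have [[mf _] [mg _]] := ((cL2P _ _).1 f2, (cL2P _ _).1 g2).
  by apply: cmeasurableM; [|apply: cmeasurableJ].
- by apply: filterS2 (L2repr_toL2 f2) (L2repr_toL2 g2) => x -> ->.
Qed.

Lemma L2dotC u v : L2dot v u = (L2dot u v)^*.
Proof.
rewrite /L2dot -cintegralJ; last by apply: cL2_mulJ; exact: L2repr_cL2.
by congr cintegral; apply/funext => x; rewrite cconjM cconjK mulrC.
Qed.

Lemma L2dot_linl a u v w : L2dot (a *: u + v) w = a * L2dot u w + L2dot v w.
Proof.
have [U V W] := And3 (L2repr_cL2 u) (L2repr_cL2 v) (L2repr_cL2 w).
rewrite /L2dot -cintegralZ ?cL2_mulJ// -cintegralD ?cL2_mulJ//; last first.
  by apply: cLfun1Z; exact: cL2_mulJ.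
apply: ae_eq_cintegral.
- by apply: cmeasurableM; [|apply: cmeasurableJ]; exact: L2repr_measurable.
- apply: (@cLfun1_measurable _ _ _ mu); apply: cLfun1D; last exact: cL2_mulJ.
  by apply: cLfun1Z; exact: cL2_mulJ.
- by apply: filterS (L2repr_lin a u v) => x ->; rewrite mulrDl mulrA.
Qed.

Lemma L2dotDl u v w : L2dot (u + v) w = L2dot u w + L2dot v w.
Proof. by have := L2dot_linl 1 u v w; rewrite scale1r mul1r. Qed.

Lemma L2dot0l w : L2dot 0 w = 0.
Proof. by apply: (addrI (L2dot 0 w)); rewrite -L2dotDl !addr0. Qed.

Lemma L2dotZl a u w : L2dot (a *: u) w = a * L2dot u w.
Proof. by have := L2dot_linl a u 0 w; rewrite L2dot0l !addr0. Qed.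

Lemma L2dotNl u w : L2dot (- u) w = - L2dot u w.
Proof. by rewrite -scaleN1r L2dotZl mulN1r. Qed.

Lemma L2dotBl u v w : L2dot (u - v) w = L2dot u w - L2dot v w.
Proof. by rewrite L2dotDl L2dotNl. Qed.

Lemma L2dotDr u v w : L2dot w (u + v) = L2dot w u + L2dot w v.
Proof. by rewrite L2dotC L2dotDl cconjD -!L2dotC. Qed.

Lemma L2dotZr a u w : L2dot w (a *: u) = a^* * L2dot w u.
Proof. by rewrite L2dotC L2dotZl cconjM -L2dotC. Qed.

Lemma L2dotNr u w : L2dot w (- u) = - L2dot w u.
Proof. by rewrite L2dotC L2dotNl cconjN -L2dotC. Qed.

Lemma L2dotBr u v w : L2dot w (u - v) = L2dot w u - L2dot w v.
Proof. by rewrite L2dotDr L2dotNr. Qed.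

Lemma L2dot0r w : L2dot w 0 = 0.
Proof. by rewrite L2dotC L2dot0l cconj0. Qed.

Lemma Re_L2dotE u : Re (L2dot u u) = \int[mu]_x (cabs (L2repr u x) ^+ 2).
Proof.
rewrite /L2dot /=; congr fine; apply: eq_integral => x _.
by congr EFin; rewrite Re_mulJ.
Qed.

Lemma L2norm_ge0 u : 0 <= L2norm u. Proof. exact: sqrtr_ge0. Qed.

Lemma sqr_L2norm u : L2norm u ^+ 2 = Re (L2dot u u).
Proof.
by rewrite sqr_sqrtr// Re_L2dotE; apply: Rintegral_ge0 => x _; exact: sqr_ge0.
Qed.

Lemma sqr_L2normE u : L2norm u ^+ 2 = \int[mu]_x (cabs (L2repr u x) ^+ 2).
Proof. by rewrite sqr_L2norm Re_L2dotE. Qed.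

Lemma L2norm0 : L2norm (0 : L2 mu) = 0.
Proof. by rewrite /L2norm L2dot0l sqrtr0. Qed.

Lemma L2norm_eq0 u : L2norm u = 0 -> u = 0.
Proof.
move=> u0; apply/eq_L2P.
have /cL2P[mu_ iu] := L2repr_cL2 u.
have : (\int[mu]_x `|(cabs (L2repr u x) ^+ 2)%:E|)%E = 0%E.
  under eq_integral => x _ do rewrite gee0_abs ?lee_fin ?sqr_ge0//.
  apply/eqP; rewrite -fine_eq0; last exact: integrable_fin_num.
  by have := sqr_L2normE u; rewrite u0 expr0n /Rintegral => <-.
move/ae_eq_integral_abs => /(_ measurableT) H.
have {}H : ae_eq mu setT (fun x => (cabs (L2repr u x) ^+ 2)%:E) (cst 0%E).
  by apply: H; exact: (measurable_int _ iu).
apply: filterS2 H (L2repr0 mu) => x /(_ I) [] /eqP; rewrite sqrf_eq0 => /eqP.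
by move=> /Normc.eq0_normc -> ->.
Qed.

Lemma L2normZ a u : L2norm (a *: u) = cabs a * L2norm u.
Proof.
apply/eqP; rewrite -(@eqrXn2 _ 2) ?L2norm_ge0 ?mulr_ge0 ?cabs_ge0 ?L2norm_ge0//.
rewrite exprMn !sqr_L2norm L2dotZl L2dotZr mulrA mulcJ.
by rewrite cReM mul0r subr0.
Qed.

Lemma L2normN u : L2norm (- u) = L2norm u.
Proof. by rewrite -scaleN1r L2normZ cabsN Normc.normc1 mul1r. Qed.

Lemma L2normBC u v : L2norm (u - v) = L2norm (v - u).
Proof. by rewrite -L2normN opprB. Qed.

Lemma sqr_L2normD u v :
  L2norm (u + v) ^+ 2 = L2norm u ^+ 2 + L2norm v ^+ 2 + 2 * Re (L2dot u v).
Proof.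
rewrite !sqr_L2norm L2dotDl !L2dotDr !cReD (L2dotC u v) cReJ; ring.
Qed.

(** Cauchy-Schwarz, from the nonnegativity of the norm of
    [|v|^2 u - <u, v> v]. *)
Lemma cauchy_schwarz u v : cabs (L2dot u v) <= L2norm u * L2norm v.
Proof.
have [/L2norm_eq0 ->|v0] := eqVneq (L2norm v) 0.
  by rewrite L2dot0r L2norm0 mulr0 cabs0.
have vp : 0 < L2norm v by rewrite lt_def v0 L2norm_ge0.
rewrite -(@ler_pXn2r _ 2) ?nnegrE ?cabs_ge0 ?mulr_ge0 ?L2norm_ge0//.
have := sqr_ge0 (L2norm ((L2norm v ^+ 2)%:C *: u + (- L2dot u v) *: v)).
rewrite sqr_L2normD !L2normZ cabsN cabsR ger0_norm ?sqr_ge0//.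
rewrite L2dotZl L2dotZr cconjN mulNr mulrN cReN.
have -> : Re ((L2norm v ^+ 2)%:C * ((L2dot u v)^* * L2dot u v)) =
    L2norm v ^+ 2 * cabs (L2dot u v) ^+ 2.
  by rewrite (mulrC _^*) mulcJ -rmorphM.
rewrite !exprMn.
set c := cabs _ ^+ 2; set a := L2norm u ^+ 2; set b := L2norm v ^+ 2.
have bp : 0 < b by rewrite exprn_gt0.
move=> H; rewrite -(ler_pM2l bp); lra.
Qed.

Lemma Re_L2dot_le u v : Re (L2dot u v) <= L2norm u * L2norm v.
Proof.
by apply: le_trans (cauchy_schwarz u v); apply: le_trans (ler_norm _) (ler_Re_cabs _).
Qed.

Lemma L2normD u v : L2norm (u + v) <= L2norm u + L2norm v.
Proof.
rewrite -(@ler_pXn2r _ 2) ?nnegrE ?addr_ge0 ?L2norm_ge0// sqr_L2normD sqrrD.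
have := Re_L2dot_le u v; lra.
Qed.

Lemma L2normB u v : L2norm (u - v) <= L2norm u + L2norm v.
Proof. by rewrite (le_trans (L2normD _ _))// L2normN. Qed.

Lemma L2norm_tri u v w : L2norm (u - w) <= L2norm (u - v) + L2norm (v - w).
Proof. by rewrite (le_trans _ (L2normD _ _))// addrA subrK. Qed.

Lemma parallelogram u v :
  L2norm (u + v) ^+ 2 + L2norm (u - v) ^+ 2 = 2 * (L2norm u ^+ 2 + L2norm v ^+ 2).
Proof. rewrite (sqr_L2normD u v) (sqr_L2normD u (- v)) L2normN L2dotNr cReN; ring. Qed.

Lemma L2dot_ext u v : (forall w, L2dot u w = L2dot v w) -> u = v.
Proof.
move=> uv; apply/eqP; rewrite -subr_eq0; apply/eqP/L2norm_eq0.
by apply/eqP; rewrite -sqrf_eq0 sqr_L2norm L2dotBl uv subrr.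
Qed.

Lemma L2norm_le_dot u (M : R) : 0 <= M ->
  (forall v, Re (L2dot u v) <= M * L2norm v) -> L2norm u <= M.
Proof.
move=> M0 /(_ u); rewrite -sqr_L2norm expr2.
have [->//|u0] := eqVneq (L2norm u) 0.
by rewrite ler_pM2r// lt_def u0 L2norm_ge0.
Qed.

Lemma sqr_L2norm_toL2 f : f \in cL2fun mu ->
  L2norm (toL2 mu f) ^+ 2 = \int[mu]_x (cabs (f x) ^+ 2).
Proof.
move=> f2; rewrite sqr_L2norm L2dot_toL2//=.
by congr fine; apply: eq_integral => x _; congr EFin; rewrite Re_mulJ.
Qed.

Lemma toL2B f u : f \in cL2fun mu ->
  toL2 mu f - u = toL2 mu (fun x => f x - L2repr u x).
Proof.
move=> f2; have := toL2_lin (-1) (L2repr_cL2 u) f2.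
rewrite toL2K scaleN1r addrC => <-.
by congr toL2; apply/funext => x; rewrite mulN1r addrC.
Qed.

End InnerProduct.

(** * Completeness of L2 and the Riesz representation theorem *)

Lemma ex_natSinv_le (R : realType) (e : R) : 0 < e ->
  exists N : nat, forall n, (N <= n)%N -> n.+1%:R^-1 <= e.
Proof.
by move=> e0; have [N _ HN] := near_infty_natSinv_lt (PosNum e0); exists N => n /HN/ltW.
Qed.

Section Completeness.
Context d (T : measurableType d) (R : realType).
Variable mu : {measure set T -> \bar R}.

(** By hypothesis [|f (k + 1) - f k| <= sqrt M * 2^-k], so the telescoping series
    converges. *)
Lemma half_summable_cvg (f : nat -> R) (M : R) :
  (forall k, (f k.+1 - f k) ^+ 2 * 4 ^+ k <= M) -> cvgn f.
Proof.
move=> fM; have M0 : 0 <= M.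
  by apply: le_trans (fM 0%N); rewrite mulr_ge0 ?sqr_ge0 ?exprn_ge0.
have fS k : `|f k.+1 - f k| <= geometric (Num.sqrt M) 2^-1 k.
  rewrite -(@ler_pXn2r _ 2) ?nnegrE ?mulr_ge0 ?exprn_ge0 ?sqrtr_ge0//.
  rewrite real_normK ?num_real// exprMn sqr_sqrtr// exprAC.
  rewrite (_ : 2^-1 ^+ 2 = 4^-1); last by field.
  by rewrite exprVn ler_pdivlMr ?exprn_gt0.
have cv : cvgn (series (telescope f)).
  apply: normed_cvg; apply: (@series_le_cvg _ _ (geometric (Num.sqrt M) 2^-1)).
  - by move=> n; exact: normr_ge0.
  - by move=> n; rewrite /= mulr_ge0 ?exprn_ge0 ?sqrtr_ge0.
  - exact: fS.
  - by apply: is_cvg_geometric_series; rewrite ger0_norm// invf_lt1// ltr1n.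
have -> : f = (fun n => f 0%N + series (telescope f) n).
  by apply/funext => n; rewrite -eq_sum_telescope.
by apply: is_cvgD => //; exact: is_cvg_cst.
Qed.

(** A fast Cauchy sequence converges almost everywhere because
    [sum_k 4^k |f_(k+1) - f_k|^2] is integrable; Fatou's lemma turns pointwise
    convergence into convergence in norm. *)
Lemma fast_cauchy_L2 (f : nat -> T -> R) :
  (forall k, measurable_fun setT (f k)) ->
  (forall k j, (k <= j)%N -> rintegrable mu (fun x => (f j x - f k x) ^+ 2) /\
     \int[mu]_x ((f j x - f k x) ^+ 2) <= 8^-1 ^+ k) ->
  exists2 g : T -> R, measurable_fun setT g &
  forall k, rintegrable mu (fun x => (g x - f k x) ^+ 2) /\
    \int[mu]_x ((g x - f k x) ^+ 2) <= 8^-1 ^+ k.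
Proof.
move=> mf Hf.
pose D k x : \bar R := ((f k.+1 x - f k x) ^+ 2 * 4 ^+ k)%:E.
have D0 k x : (0 <= D k x)%E by rewrite lee_fin mulr_ge0 ?sqr_ge0 ?exprn_ge0.
have mD k : measurable_fun setT (D k).
  apply/measurable_EFinP; apply: measurable_funM => //.
  by apply: measurable_funX; exact: measurable_funB.
pose M x : \bar R := (\sum_(k <oo) D k x)%E.
have mM : measurable_fun setT M by apply: ge0_emeasurable_sum => // k x _ _; exact: D0.
have M0 x : (0 <= M x)%E by apply: nneseries_ge0 => k _ _; exact: D0.
have iM : (\int[mu]_x M x < +oo)%E.
  rewrite integral_nneseries//.
  apply: (@le_lt_trans _ _ (\sum_(k <oo) (2 / (2 ^ (k + 1))%:R)%:E)%E).
    apply: lee_nneseries => [k _ _|k _]; first by apply: integral_ge0.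
    have [i1 i2] := Hf k k.+1 (leqnSn k).
    rewrite /D; under eq_integral do rewrite mulrC EFinM.
    rewrite ge0_integralZl_EFin ?exprn_ge0//; last 2 first.
    - by move=> x _; rewrite lee_fin sqr_ge0.
    - by apply: measurable_int i1.
    rewrite -[X in (_ * X)%E]fineK ?integrable_fin_num// -EFinM lee_fin.
    apply: le_trans (ler_wpM2l _ i2) _; first by rewrite exprn_ge0.
    rewrite -exprMn addn1 expnS natrM natrX invfM mulrA divff// mul1r -exprVn.
    by rewrite lerXn2r ?nnegrE//; lra.
  have /cvg_lim -> // := @cvg_geometric_eseries_half R 2 0.
  by rewrite ltry.
have aeM : {ae mu, forall x, M x \is a fin_num}.
  have /integrable_ae : mu.-integrable setT M.
    apply/integrableP; split => //; under eq_integral do rewrite gee0_abs//.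
    exact: iM.
  by move=> /(_ measurableT); apply: filterS => x; apply.
have cvf x : M x \is a fin_num -> cvgn (f ^~ x).
  move=> Mx; apply: (@half_summable_cvg _ (fine (M x))) => k.
  rewrite -lee_fin fineK//.
  have := @nneseries_lim_ge _ (D ^~ x) xpredT 0 k.+1 (fun n _ _ => D0 n x).
  apply: le_trans; rewrite big_nat_recr//= leeDr// sume_ge0// => i _; exact: D0.
pose g x := fine (limn_esup (fun k => (f k x)%:E)).
have mg : measurable_fun setT g.
  apply: measurableT_comp => //.
  by apply: measurable_fun_limn_esup => n; exact/measurable_EFinP.
have cvg_g x : M x \is a fin_num -> f ^~ x @ \oo --> g x.
  move=> /cvf /cvg_ex[l fl]; suff -> : g x = l by [].
  rewrite /g.
  have : (fun k => (f k x)%:E) @ \oo --> l%:E by apply/cvg_EFin/fl; exact: nearW.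
  by move/cvg_limn_einf_sup => [_ ->].
exists g => // k.
pose h j x : \bar R := ((f (j + k)%N x - f k x) ^+ 2)%:E.
have mh j : measurable_fun setT (h j).
  by apply/measurable_EFinP; apply: measurable_funX; exact: measurable_funB.
have mgk : measurable_fun setT (fun x => (g x - f k x) ^+ 2).
  by apply: measurable_funX; exact: measurable_funB.
have gE : {ae mu, forall x, ((g x - f k x) ^+ 2)%:E = limn_einf (h ^~ x)}.
  apply: filterS aeM => x /cvg_g fg; apply/esym.
  suff /cvg_limn_einf_sup[-> _] : h ^~ x @ \oo --> ((g x - f k x) ^+ 2)%:E by [].
  apply/cvg_EFin; first exact: nearW.
  rewrite /h/= expr2; under eq_fun do rewrite /= expr2.
  have H : (fun n => f (n + k)%N x - f k x) @ \oo --> g x - f k x.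
    apply: cvgB; last exact: cvg_cst.
    by rewrite (cvg_shiftn k (f ^~ x)).
  exact: cvgM.
have main : (\int[mu]_x ((g x - f k x) ^+ 2)%:E <= (8^-1 ^+ k)%:E)%E.
  rewrite (@ge0_ae_eq_integral _ _ _ mu setT _ (fun x => limn_einf (h ^~ x)))//.
  - apply: le_trans (@fatou _ _ _ mu setT measurableT h mh _) _.
      by move=> n x _; rewrite lee_fin sqr_ge0.
    rewrite limn_einf_lim; apply: lime_le; first exact: is_cvg_einfs.
    apply: nearW => n; apply: (@le_trans _ _ (\int[mu]_x h n x)%E).
      by apply: ereal_inf_lbound; exists n => //=.
    have [i1 i2] := Hf k (n + k)%N (leq_addl n k).
    by rewrite -[X in (X <= _)%E]fineK ?integrable_fin_num// lee_fin.
  - exact/measurable_EFinP.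
  - apply: (measurableT_comp (f := -%E)) => //.
    by apply: measurable_fun_limn_esup => n; exact: measurableT_comp.
  - by move=> x _; rewrite lee_fin sqr_ge0.
  - move=> x _; rewrite limn_einf_lim; apply: lime_ge; first exact: is_cvg_einfs.
    by apply: nearW => n; apply: le_ereal_inf_tmp => _ [m _ <-]; rewrite lee_fin sqr_ge0.
  - by apply: filterS gE => x + _.
have ig : rintegrable mu (fun x => (g x - f k x) ^+ 2).
  apply/integrableP; split; first exact/measurable_EFinP.
  under eq_integral do rewrite gee0_abs ?lee_fin ?sqr_ge0//.
  exact: le_lt_trans main (ltry _).
split => //; rewrite -lee_fin fineK//; exact: integrable_fin_num.
Qed.

(** A Cauchy sequence has a fast Cauchy subsequence, whose real and imaginary parts
    have limits. *)
Lemma L2_complete (u : nat -> L2 mu) :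
  (forall e : R, 0 < e -> exists N, forall m n, (N <= m)%N -> (N <= n)%N ->
     L2norm (u m - u n) <= e) ->
  exists l, forall e : R, 0 < e -> exists N, forall n, (N <= n)%N ->
     L2norm (u n - l) <= e.
Proof.
move=> Hu.
have /choice[s Hs] : forall k, exists N, forall m n, (N <= m)%N -> (N <= n)%N ->
    L2norm (u m - u n) ^+ 2 <= 8^-1 ^+ k.
  move=> k; have [N HN] := Hu (Num.sqrt (8^-1 ^+ k)) ltac:(by rewrite sqrtr_gt0 exprn_gt0).
  exists N => m n Nm Nn.
  rewrite -[leRHS]sqr_sqrtr ?exprn_ge0// lerXn2r ?nnegrE ?sqrtr_ge0 ?L2norm_ge0//.
  exact: HN.
pose t := fix t k := if k is k'.+1 then maxn (t k') (s k) else s 0%N.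
have st k : (s k <= t k)%N by case: k => //= k; exact: leq_maxr.
have tm k j : (k <= j)%N -> (t k <= t j)%N.
  elim: j => [|j IH]; first by rewrite leqn0 => /eqP ->.
  by rewrite leq_eqVlt ltnS => /predU1P[->//|/IH kj]; rewrite (leq_trans kj)//= leq_maxl.
pose F k := L2repr (u (t k)).
have F2 k : F k \in cL2fun mu by exact: L2repr_cL2.
have FB k j : (k <= j)%N -> rintegrable mu (fun x => cabs (F j x - F k x) ^+ 2) /\
    \int[mu]_x (cabs (F j x - F k x) ^+ 2) <= 8^-1 ^+ k.
  move=> kj; have FB2 := cL2B (F2 j) (F2 k).
  split; first by have [] := (cL2P _ _).1 FB2.
  rewrite -sqr_L2norm_toL2// -toL2B// toL2K.
  by apply: Hs; [rewrite (leq_trans (st k))// tm|exact: st].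
have mF k : cmeasurable (F k) by exact: L2repr_measurable.
have le_int (h h' : T -> R) (k : nat) : measurable_fun setT h ->
    (forall x, h x ^+ 2 <= h' x) -> rintegrable mu h' /\ \int[mu]_x h' x <= 8^-1 ^+ k ->
    rintegrable mu (fun x => h x ^+ 2) /\ \int[mu]_x (h x ^+ 2) <= 8^-1 ^+ k.
  move=> mh hh' [ih' le8].
  have ih : rintegrable mu (fun x => h x ^+ 2).
    apply: le_rintegrable ih'; first exact: measurable_funX.
    by move=> x; rewrite ger0_norm ?sqr_ge0.
  by split => //; apply: le_trans le8; apply: le_Rintegral.
have [gr mgr Hgr] : exists2 g : T -> R, measurable_fun setT g &
    forall k, rintegrable mu (fun x => (g x - Re (F k x)) ^+ 2) /\
      \int[mu]_x ((g x - Re (F k x)) ^+ 2) <= 8^-1 ^+ k.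
  apply: (@fast_cauchy_L2 (fun k x => Re (F k x))) => [k|k j kj]; first by have [] := mF k.
  apply: (le_int _ _ _ _ _ (FB k j kj)) => [|x].
    by have [[? _] [? _]] := (mF k, mF j); exact: measurable_funB.
  by rewrite sqr_cabs cReD cReN lerDl sqr_ge0.
have [gi mgi Hgi] : exists2 g : T -> R, measurable_fun setT g &
    forall k, rintegrable mu (fun x => (g x - Im (F k x)) ^+ 2) /\
      \int[mu]_x ((g x - Im (F k x)) ^+ 2) <= 8^-1 ^+ k.
  apply: (@fast_cauchy_L2 (fun k x => Im (F k x))) => [k|k j kj]; first by have [] := mF k.
  apply: (le_int _ _ _ _ _ (FB k j kj)) => [|x].
    by have [[_ ?] [_ ?]] := (mF k, mF j); exact: measurable_funB.
  by rewrite sqr_cabs cImD cImN lerDr sqr_ge0.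
pose g x : R[i] := gr x +i* gi x.
have gF2 k : (fun x => g x - F k x) \in cL2fun mu.
  apply/cL2P; split; first by apply: cmeasurableB.
  under eq_fun do rewrite sqr_cabs cReD cReN cImD cImN.
  by apply: rintegrableD; [have [] := Hgr k|have [] := Hgi k].
have g2 : g \in cL2fun mu.
  have := cL2D (gF2 0%N) (F2 0%N); under eq_fun do rewrite subrK.
  by [].
have gB k : L2norm (toL2 mu g - u (t k)) ^+ 2 <= 2 * 8^-1 ^+ k.
  rewrite (toL2B _ g2) (sqr_L2norm_toL2 (gF2 k)).
  have [[? ?] [? ?]] := (Hgr k, Hgi k).
  rewrite (_ : (fun x => _) = (fun x => (gr x - Re (F k x)) ^+ 2 + (gi x - Im (F k x)) ^+ 2)).
    by rewrite RintegralD//; lra.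
  by apply/funext => x; rewrite sqr_cabs cReD cReN cImD cImN.
exists (toL2 mu g) => e e0.
have [k Hk] : exists k, 2 * 8^-1 ^+ k <= (e / 2) ^+ 2 :> R.
  have : (fun k => 2 * 8^-1 ^+ k : R) @ \oo --> (0 : R).
    by apply: cvg_geometric; rewrite ger0_norm// invf_lt1// ltr1n.
  move/cvgrPdist_le => /(_ ((e / 2) ^+ 2)); rewrite exprn_gt0 ?divr_gt0// => /(_ isT)[k _ Hk].
  exists k; have := Hk k (leqnn k); rewrite /= sub0r normrN; apply: le_trans.
  exact: ler_norm.
have le_e2 x : 0 <= x -> x ^+ 2 <= 2 * 8^-1 ^+ k -> x <= e / 2.
  move=> x0 xk; rewrite -(@ler_pXn2r _ 2) ?nnegrE//; last by rewrite divr_ge0// ltW.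
  exact: le_trans Hk.
exists (t k) => n tn; apply: le_trans (L2norm_tri _ (u (t k)) _) _.
rewrite [leRHS]splitr lerD//; apply: le_e2; rewrite ?L2norm_ge0//; last first.
  by rewrite L2normBC.
apply: le_trans (Hs k _ _ _ _) _; rewrite ?(leq_trans (st k))//.
by rewrite ler_peMl ?exprn_ge0// ler1n.
Qed.

End Completeness.

Section RieszRepresentation.
Context d (T : measurableType d) (R : realType).
Variable mu : {measure set T -> \bar R}.
Implicit Types (u v w : L2 mu) (S : L2 mu -> L2 mu).

Definition opbound S (M : R) := forall u, L2norm (S u) <= M * L2norm u.

(** The minimiser [w] of [|u|^2 - 2 Re (phi u)] represents [phi]; the
    parallelogram identity makes minimising sequences Cauchy. *)
Lemma riesz (phi : L2 mu -> R[i]) (M : R) :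
  (forall a u v, phi (a *: u + v) = a * phi u + phi v) ->
  (forall u, cabs (phi u) <= M * L2norm u) ->
  exists w, forall u, phi u = L2dot u w.
Proof.
move=> phil phib.
have phiD u v : phi (u + v) = phi u + phi v.
  by rewrite -[u in LHS]scale1r phil mul1r.
have phi0 : phi 0 = 0.
  by apply: (addrI (phi 0)); rewrite -phiD !addr0.
have phiZ a u : phi (a *: u) = a * phi u.
  by rewrite -[_ *: _]addr0 phil phi0 addr0.
have phiN u : phi (- u) = - phi u by rewrite -scaleN1r phiZ mulN1r.
have Rephib u : `|Re (phi u)| <= M * L2norm u by apply: le_trans (ler_Re_cabs _) _.
pose J u := L2norm u ^+ 2 - 2 * Re (phi u).
have Jlb u : - M ^+ 2 <= J u.
  have := Rephib u; rewrite ler_norml => /andP[_ H].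
  rewrite /J; have := sqr_ge0 (L2norm u - M); nra.
have infJ : has_inf (range J).
  by split; [exists (J 0), 0|exists (- M ^+ 2) => _ [u _ <-]].
pose m := inf (range J).
have Jm u : m <= J u by apply: ge_inf; [exact: infJ.2|exists u].
have Jmid u v : L2norm (u - v) ^+ 2 <= 2 * (J u - m) + 2 * (J v - m).
  have := parallelogram u v; have := Jm ((2^-1 : R)%:C *: (u + v)).
  rewrite /J phiZ phiD L2normZ cabsR exprMn ger0_norm// cReM mul0r subr0 cReD/=.
  lra.
have /choice[u Hu] : forall n : nat, exists u, J u < m + n.+1%:R^-1.
  move=> n; have n0 : 0 < n.+1%:R^-1 :> R by rewrite invr_gt0.
  by have [_ [u _ <-] Ju] := inf_adherent n0 infJ; exists u.
have small := @ex_natSinv_le R.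
have [w Hw] : exists l, forall e : R, 0 < e -> exists N, forall n, (N <= n)%N ->
     L2norm (u n - l) <= e.
  apply: L2_complete => e e0.
  have [N HN] := small (e ^+ 2 / 4) ltac:(by rewrite divr_gt0 ?exprn_gt0).
  exists N => i j Ni Nj.
  rewrite -(@ler_pXn2r _ 2) ?nnegrE ?L2norm_ge0//; last exact: ltW.
  have := Jmid (u i) (u j); have := HN _ Ni; have := HN _ Nj.
  have := Hu i; have := Hu j.
  move: (J (u i)) (J (u j)) (i.+1%:R^-1) (j.+1%:R^-1) (e ^+ 2) => a b x y z.
  lra.
have Jw : J w <= m.
  apply/ler_addgt0Pr => /= e e0; move: (e : R) e0 => {}e e0.
  pose K := 2 * L2norm w + 3 + 2 * `|M|.
  have K0 : 0 < K by rewrite /K; have := L2norm_ge0 w; have := normr_ge0 M; lra.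
  pose h := Num.min 1 (e / (2 * K)).
  have h0 : 0 < h by rewrite lt_min ltr01 divr_gt0// mulr_gt0.
  have h1 : h <= 1 by rewrite ge_min lexx.
  have hK : h * K <= e / 2.
    rewrite -ler_pdivlMr// (le_trans (_ : h <= e / (2 * K))) ?ge_min ?lexx ?orbT//.
    by rewrite invfM mulrA.
  have [N1 HN1] := Hw h h0.
  have [N2 HN2] := small (e / 2) ltac:(by rewrite divr_gt0).
  pose n := maxn N1 N2.
  have := HN1 n (leq_maxl _ _); have := HN2 n (leq_maxr _ _); have := Hu n.
  move=> H1 H2 H3.
  have H4 := Re_L2dot_le w (w - u n).
  have JB z : J w - J (w - z) = 2 * Re (L2dot w z) - L2norm z ^+ 2 - 2 * Re (phi z).
    rewrite /J (sqr_L2normD w (- z)) L2normN L2dotNr cReN phiD phiN cReD cReN; ring.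
  have H5 := JB (w - u n); rewrite subKr in H5.
  have H6 := Rephib (w - u n); move: H6; rewrite ler_norml => /andP[H6 _].
  have := sqr_ge0 (L2norm (w - u n)).
  have := L2norm_ge0 (w - u n); rewrite (L2normBC w) in H4 H5 H6 *.
  move=> z0 z1.
  have H7 : L2norm w * L2norm (u n - w) <= L2norm w * h by rewrite ler_wpM2l ?L2norm_ge0.
  have H8 : M * L2norm (u n - w) <= `|M| * h.
    apply: (@le_trans _ _ (`|M| * L2norm (u n - w))).
      by rewrite ler_wpM2r// ler_norm.
    by rewrite ler_wpM2l.
  clear HN1 H3 z0 K0; move: hK H1 H2 H4 H5 H6 z1 H7 H8; rewrite /K.
  move: (J w) (J (u n)) (Re (L2dot _ _)) (Re (phi _)) (_ ^+ 2) (n.+1%:R^-1).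
  move: (L2norm w) (L2norm (u n - w)) h h0 h1 => a b c c0 c1 p q r s t o.
  lra.
have ReE v : Re (phi v) = Re (L2dot v w).
  have H (t : R) : 0 <= t ^+ 2 * L2norm v ^+ 2 + t * (2 * (Re (L2dot v w) - Re (phi v))).
    have := le_trans Jw (Jm (w + t%:C *: v)).
    rewrite /J (sqr_L2normD w (t%:C *: v)) L2normZ cabsR exprMn real_normK ?num_real//.
    rewrite phiD phiZ L2dotC L2dotZl cReJ cReD !cReM !mul0r !subr0/=.
    lra.
  set b := 2 * _ in H; set a := L2norm v ^+ 2 in H.
  have a0 : 0 <= a by exact: sqr_ge0.
  have a1 : 0 < a + 1 by lra.
  have {}H := H (- b / (a + 1)).
  have E : (- b / (a + 1)) ^+ 2 * a + (- b / (a + 1)) * b = - (b / (a + 1)) ^+ 2.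
    by field; rewrite gt_eqF.
  have : b / (a + 1) == 0.
    rewrite -sqrf_eq0 eq_le sqr_ge0 andbT; rewrite E in H; lra.
  rewrite mulf_eq0 invr_eq0 (gt_eqF a1) orbF /b mulf_eq0 pnatr_eq0/= subr_eq0.
  by move=> /eqP ->.
exists w => v; apply: eq_ReIm => //.
have := ReE ('i *: v); rewrite phiZ L2dotZl !cReM/= !mul0r !mul1r !sub0r.
exact: oppr_inj.
Qed.

(** [S u] represents the linear functional [v |-> (B u v)^*]. *)
Lemma riesz_sesquilinear (B : L2 mu -> L2 mu -> R[i]) (M : R) :
  (forall a u v w, B (a *: u + v) w = a * B u w + B v w) ->
  (forall a u v w, B w (a *: u + v) = a^* * B w u + B w v) ->
  (forall u v, cabs (B u v) <= M * L2norm u * L2norm v) ->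
  0 <= M ->
  exists S, [/\ linear S, opbound S M & forall u v, L2dot (S u) v = B u v].
Proof.
move=> Bl Br Bb M0.
have /choice[S HS] : forall u, exists w, forall v, (B u v)^* = L2dot v w.
  move=> u; apply: (@riesz _ (M * L2norm u)).
    by move=> a v w; rewrite Br cconjD cconjM cconjK.
  by move=> v; rewrite cabsJ.
have SE u v : L2dot (S u) v = B u v by rewrite L2dotC -HS cconjK.
exists S; split => //.
  move=> a u v; apply: L2dot_ext => w.
  by rewrite SE L2dotDl L2dotZl !SE Bl.
move=> u; apply: L2norm_le_dot; first by rewrite mulr_ge0 ?L2norm_ge0.
move=> v; rewrite SE; apply: le_trans (Bb u v).
exact: le_trans (ler_norm _) (ler_Re_cabs _).
Qed.

Definition adjoint S S' := forall u v, L2dot (S u) v = L2dot u (S' v).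

Lemma adjointC S S' : adjoint S S' -> adjoint S' S.
Proof. by move=> SS' u v; rewrite L2dotC -SS' -L2dotC. Qed.

Lemma ex_adjoint S (M : R) : linear S -> opbound S M -> 0 <= M ->
  exists S', [/\ linear S', opbound S' M & adjoint S S'].
Proof.
move=> Sl Sb M0.
have [||||S' [S'l S'b S'E]] := @riesz_sesquilinear (fun u v => L2dot u (S v)) M.
- by move=> a u v w; rewrite L2dot_linl.
- by move=> a u v w; rewrite Sl L2dotDr L2dotZr.
- move=> u v; apply: le_trans (cauchy_schwarz _ _) _.
  by rewrite (mulrC M) -mulrA ler_wpM2l ?L2norm_ge0.
- by [].
exists S'; split => //; apply: adjointC => u v; exact: S'E.
Qed.

End RieszRepresentation.

(** * Real polynomials on the unit interval *)

Section UnitIntervalPolynomials.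
Variable R : realType.
Implicit Types (p q r : {poly R}) (t a : R) (L : {poly R} -> R).

(** The positivity of a linear functional on the generators of the quadratic
    module of [0, 1], the data of a truncated Hausdorff moment problem. *)
Record moment_functional L : Prop := {
  momentD : forall p q, L (p + q) = L p + L q;
  momentZ : forall (c : R) p, L (c *: p) = c * L p;
  moment_sq : forall q, 0 <= L (q * q);
  momentX : forall q, 0 <= L ('X * (q * q));
  moment1X : forall q, 0 <= L ((1 - 'X) * (q * q));
  momentX1X : forall q, 0 <= L ('X * (1 - 'X) * (q * q))
}.

Lemma moment_mulX L : moment_functional L -> moment_functional (fun p => L ('X * p)).
Proof.
case=> LD LZ L1 L2 L3 L4; split=> [p q|c p|q|q|q|q].
- by rewrite mulrDr LD.
- by rewrite -scalerAr LZ.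
- exact: L2.
- suff -> : 'X * ('X * (q * q)) = ('X * q) * ('X * q) by exact: L1.
  by ring.
- suff -> : 'X * ((1 - 'X) * (q * q)) = 'X * (1 - 'X) * (q * q) by exact: L4.
  by ring.
- suff -> : 'X * ('X * (1 - 'X) * (q * q)) = (1 - 'X) * (('X * q) * ('X * q)).
    exact: L3.
  by ring.
Qed.

Lemma moment_mul1X L : moment_functional L ->
  moment_functional (fun p => L ((1 - 'X) * p)).
Proof.
case=> LD LZ L1 L2 L3 L4; split=> [p q|c p|q|q|q|q].
- by rewrite mulrDr LD.
- by rewrite -scalerAr LZ.
- exact: L3.
- suff -> : (1 - 'X) * ('X * (q * q)) = 'X * (1 - 'X) * (q * q) by exact: L4.
  by ring.
- suff -> : (1 - 'X) * ((1 - 'X) * (q * q)) = ((1 - 'X) * q) * ((1 - 'X) * q).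
    exact: L1.
  by ring.
- suff -> : (1 - 'X) * ('X * (1 - 'X) * (q * q)) =
    'X * (((1 - 'X) * q) * ((1 - 'X) * q)) by exact: L2.
  by ring.
Qed.

Lemma moment_mul_sqr L r : moment_functional L ->
  moment_functional (fun p => L (r * r * p)).
Proof.
case=> LD LZ L1 L2 L3 L4; split=> [p q|c p|q|q|q|q].
- by rewrite mulrDr LD.
- by rewrite -scalerAr LZ.
- suff -> : r * r * (q * q) = (r * q) * (r * q) by exact: L1.
  by ring.
- suff -> : r * r * ('X * (q * q)) = 'X * ((r * q) * (r * q)) by exact: L2.
  by ring.
- suff -> : r * r * ((1 - 'X) * (q * q)) = (1 - 'X) * ((r * q) * (r * q)).
    exact: L3.
  by ring.
- suff -> : r * r * ('X * (1 - 'X) * (q * q)) =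
    'X * (1 - 'X) * ((r * q) * (r * q)) by exact: L4.
  by ring.
Qed.

Lemma horner_lt0_near p a : p.[a] < 0 ->
  exists2 d : R, 0 < d & forall t, `|t - a| < d -> p.[t] < 0.
Proof.
move=> pa; have := @continuous_horner R p a.
move/cvgrPdist_lt => /(_ (- p.[a])); rewrite oppr_gt0 => /(_ pa).
move=> /nbhs_ballP[d /= d0 Hd]; exists d => // t td.
have := Hd t; rewrite /ball/= distrC => /(_ td).
by rewrite ltr_norml ltrBlDr => /andP[+ _]; rewrite opprK; lra.
Qed.

Lemma horner_ge0_limit p a : 0 <= a <= 1 ->
  (forall t, 0 <= t <= 1 -> t != a -> 0 <= p.[t]) -> 0 <= p.[a].
Proof.
move=> /andP[a0 a1] H; rewrite leNgt; apply/negP => /horner_lt0_near[d d0 Hd].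
pose h := Num.min (d / 2) (1 / 2).
have h0 : 0 < h by rewrite lt_min !divr_gt0.
have [hd h1] : h <= d / 2 /\ h <= 1 / 2 by rewrite !ge_min !lexx orbT.
have [a2|a2] := lerP a (1 / 2).
  have := H (a + h); have := Hd (a + h); rewrite addrAC subrr add0r gtr0_norm//.
  move=> /(_ ltac:(lra)) ? /(_ ltac:(apply/andP; split; lra)).
  by move=> /(_ ltac:(rewrite gt_eqF; lra)); lra.
have := H (a - h); have := Hd (a - h); rewrite addrAC subrr add0r normrN gtr0_norm//.
move=> /(_ ltac:(lra)) ? /(_ ltac:(apply/andP; split; lra)).
by move=> /(_ ltac:(rewrite lt_eqF; lra)); lra.
Qed.

(** Subtracting its minimum gives a nonnegative polynomial a root in [0, 1],
    simple at an end point or of even order inside; dividing by the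
    corresponding factor lowers the degree. *)
Lemma moment_ge0 L p : moment_functional L ->
  (forall t, 0 <= t <= 1 -> 0 <= p.[t]) -> 0 <= L p.
Proof.
have [n] := ubnP (size p); elim: n L p => // n IH L p; rewrite ltnS => pn Lm p0.
have L1 : 0 <= L 1 by have := moment_sq Lm 1; rewrite mulr1.
have LC c : L c%:P = c * L 1 by rewrite -(momentZ Lm) alg_polyC.
have [p1|p1] := leqP (size p) 1.
  by rewrite (size1_polyC p1) LC mulr_ge0//; have := p0 0; rewrite lexx ler01 horner_coef0; apply.
have [a a01 pa] : exists2 a, a \in `[0, 1]%R & forall t, t \in `[0, 1]%R -> p.[a] <= p.[t].
  apply: EVT_min => //; apply: continuous_subspaceT => t; exact: continuous_horner.
rewrite in_itv/= in a01; have /andP[a0 a1] := a01.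
pose m := p.[a]; have m0 : 0 <= m by exact: p0.
have mp t : 0 <= t <= 1 -> m <= p.[t] by move=> t01; apply: pa; rewrite in_itv.
have [q pq] : exists q, p - m%:P = q * ('X - a%:P).
  by apply/factor_theorem; rewrite rootE !hornerE subrr.
have q0 : q != 0.
  apply/eqP => q0; move: pq; rewrite q0 mul0r => /eqP; rewrite subr_eq0 => /eqP pE.
  by move: p1; rewrite pE ltnNge size_polyC_leq1.
have sq : (size q < n)%N.
  have : (size (p - m%:P)%R <= size p)%N.
    by rewrite (leq_trans (size_polyD _ _))// geq_max leqnn size_polyN (leq_trans (size_polyC_leq1 _))// ltnW.
  rewrite pq size_Mmonic ?monicXsubC// size_XsubC addn2 /= => H.
  exact: leq_trans H pn.
have qa t : 0 <= t <= 1 -> 0 <= q.[t] * (t - a).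
  by move=> /mp; rewrite -subr_ge0; have := congr1 (horner^~ t) pq; rewrite !hornerE => ->.
have -> : p = (p - m%:P) + m%:P by rewrite subrK.
rewrite (momentD Lm) LC addr_ge0 ?mulr_ge0// pq.
have key r : (forall t, 0 <= t <= 1 -> t != a -> 0 <= r.[t]) ->
    forall t, 0 <= t <= 1 -> 0 <= r.[t].
  move=> H t t01; have [->|] := eqVneq t a; last exact: H.
  exact: horner_ge0_limit.
have [a00|a0n] := eqVneq a 0.
  rewrite mulrC a00 subr0; apply: (IH (fun p => L ('X * p))) => //.
    exact: moment_mulX.
  apply: key => t t01 ta; have := qa t t01; rewrite a00 subr0 pmulr_lge0//.
  by rewrite lt_def -{1}a00 ta; case/andP: t01.
have [a11|a1n] := eqVneq a 1.
  have -> : q * ('X - a%:P) = (1 - 'X) * (- q) by rewrite a11; ring.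
  apply: (IH (fun p => L ((1 - 'X) * p))); rewrite ?size_polyN//.
    exact: moment_mul1X.
  apply: key => t t01 ta; have := qa t t01.
  rewrite a11 -mulrNN opprB hornerN pmulr_lge0// subr_gt0 lt_neqAle -{1}a11 ta.
  by case/andP: t01.
have a0' : 0 < a by rewrite lt_def a0n.
have a1' : a < 1 by rewrite lt_neqAle a1n.
have qa0 : q.[a] = 0.
  apply/eqP; rewrite eq_le; apply/andP; split; rewrite leNgt; apply/negP => H.
    have : (- q).[a] < 0 by rewrite hornerN oppr_lt0.
    move=> /horner_lt0_near[d d0 /(_ (a - Num.min (d / 2) a))].
    have h0 : 0 < Num.min (d / 2) a by rewrite lt_min a0' divr_gt0.
    have [hd ha] : Num.min (d / 2) a <= d / 2 /\ Num.min (d / 2) a <= a.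
      by rewrite !ge_min !lexx orbT.
    have := qa (a - Num.min (d / 2) a).
    move: (Num.min _ _) h0 hd ha => h h0 hd ha.
    rewrite addrAC subrr sub0r normrN gtr0_norm// hornerN.
    move=> /(_ ltac:(apply/andP; split; lra)) + /(_ ltac:(lra)); nra.
  move: H => /horner_lt0_near[d d0 /(_ (a + Num.min (d / 2) (1 - a)))].
  have h0 : 0 < Num.min (d / 2) (1 - a) by rewrite lt_min subr_gt0 a1' divr_gt0.
  have [hd ha] : Num.min (d / 2) (1 - a) <= d / 2 /\ Num.min (d / 2) (1 - a) <= 1 - a.
    by rewrite !ge_min !lexx orbT.
  have := qa (a + Num.min (d / 2) (1 - a)).
  move: (Num.min _ _) h0 hd ha => h h0 hd ha.
  rewrite addrAC subrr add0r gtr0_norm//.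
  move=> /(_ ltac:(apply/andP; split; lra)) + /(_ ltac:(lra)); nra.
have [r qr] : exists r, q = r * ('X - a%:P) by apply/factor_theorem; rewrite rootE qa0.
have sr : (size r < n)%N.
  have r0 : r != 0 by apply: contraNneq q0 => r0; rewrite qr r0 mul0r.
  by apply: leq_ltn_trans sq; rewrite qr size_Mmonic ?monicXsubC// size_XsubC addn2 /=.
have -> : q * ('X - a%:P) = ('X - a%:P) * ('X - a%:P) * r by rewrite qr; ring.
apply: (IH (fun p => L (('X - a%:P) * ('X - a%:P) * p))) => //.
  exact: moment_mul_sqr.
apply: key => t t01 ta; have := qa t t01; rewrite qr !hornerE -mulrA -expr2.
by rewrite pmulr_lge0// exprn_even_gt0//= subr_eq0.
Qed.

(** The expectation of [g] under the binomial distribution. *)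
Definition bernstein_sum (n : nat) (t : R) (g : nat -> R) : R :=
  \sum_(k < n.+1) g k * ('C(n, k)%:R * t ^+ k * (1 - t) ^+ (n - k)).

Lemma bernstein_sumD n t g h : bernstein_sum n t (fun k => g k + h k) =
  bernstein_sum n t g + bernstein_sum n t h.
Proof. by rewrite /bernstein_sum -big_split; apply: eq_bigr => k _; rewrite mulrDl. Qed.

Lemma bernstein_sumZ n t (c : R) g : bernstein_sum n t (fun k => c * g k) =
  c * bernstein_sum n t g.
Proof. by rewrite /bernstein_sum mulr_sumr; apply: eq_bigr => k _; rewrite -mulrA. Qed.

Lemma bernstein_sum1 n t : bernstein_sum n t (fun=> 1) = 1.
Proof.
have E := exprDn (1 - t) t n; rewrite subrK expr1n in E; rewrite [RHS]E.
by apply: eq_bigr => k _; rewrite mul1r -mulr_natl; ring.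
Qed.

Lemma bernstein_sum_shift n t g : bernstein_sum n.+1 t (fun k => k%:R * g k) =
  n.+1%:R * t * bernstein_sum n t (fun k => g k.+1).
Proof.
rewrite /bernstein_sum big_ord_recl/= !mul0r add0r mulr_sumr.
apply: eq_bigr => k _; rewrite /bump/= add1n subSS exprS.
have /(congr1 (fun m : nat => m%:R : R)) := mul_bin_diag n.+1 k.
rewrite /= !natrM => H; rewrite -[RHS]mulrA.
transitivity (k.+1%:R * 'C(n.+1, k.+1)%:R * g k.+1 * (t * t ^+ k * (1 - t) ^+ (n - k))).
  by ring.
by rewrite -H; ring.
Qed.

Lemma bernstein_sum_le n t g h : 0 <= t <= 1 -> (forall k, (k <= n)%N -> g k <= h k) ->
  bernstein_sum n t g <= bernstein_sum n t h.
Proof.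
move=> /andP[t0 t1] gh; apply: ler_sum => k _; rewrite ler_wpM2r//.
  by rewrite !mulr_ge0 ?exprn_ge0// subr_ge0.
by apply: gh; rewrite -ltnS.
Qed.

Lemma bernstein_variance n t :
  bernstein_sum n.+1 t (fun k => (k%:R / n.+1%:R - t) ^+ 2) = t * (1 - t) / n.+1%:R.
Proof.
have n0 : n.+1%:R != 0 :> R by rewrite pnatr_eq0.
have E1 m : bernstein_sum m t (fun k => k%:R) = m%:R * t.
  case: m => [|m]; first by rewrite /bernstein_sum big_ord_recl big_ord0 !mul0r addr0.
  have := bernstein_sum_shift m t (fun=> 1); rewrite bernstein_sum1 mulr1 => <-.
  by congr bernstein_sum; apply/funext => k; rewrite mulr1.
have E2 : bernstein_sum n.+1 t (fun k => k%:R * k%:R) = n.+1%:R * t * (n%:R * t + 1).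
  rewrite bernstein_sum_shift; congr (_ * _).
  under eq_fun do rewrite -natr1.
  by rewrite bernstein_sumD E1 bernstein_sum1.
have -> : (fun k : nat => (k%:R / n.+1%:R - t) ^+ 2) = (fun k =>
    (n.+1%:R^-1 ^+ 2) * (k%:R * k%:R) + ((- 2 * t / n.+1%:R) * k%:R + t ^+ 2 * 1)).
  by apply/funext => k; move: n.+1%:R n0 => a a0; field.
rewrite !bernstein_sumD !bernstein_sumZ E2 E1 bernstein_sum1.
move: n0; rewrite -natr1; move: n%:R => a a0.
by field.
Qed.

(** The Bernstein polynomials of a Lipschitz function converge uniformly: with
    [|s - t| <= h + h^-1 (s - t)^2] the error is bounded by the variance
    [t (1 - t) / n] of the binomial distribution. *)
Lemma lipschitz_poly_approx (f : R -> R) (K e : R) : 0 < e ->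
  (forall s t, 0 <= s <= 1 -> 0 <= t <= 1 -> `|f s - f t| <= K * `|s - t|) ->
  exists p, forall t, 0 <= t <= 1 -> `|p.[t] - f t| <= e.
Proof.
move=> e0 fK.
have K0 : 0 <= K.
  have := fK 1 0; rewrite !lexx !ler01 subr0 normr1 mulr1 => /(_ isT isT).
  exact: le_trans.
have K1 : 0 < K + 1 by lra.
pose h := e / (2 * (K + 1)); have h0 : 0 < h by rewrite divr_gt0// mulr_gt0.
have [n Hn] : exists n : nat, n.+1%:R^-1 <= h ^+ 2.
  have /cvgrPdist_le /(_ (h ^+ 2)) := @cvg_harmonic R.
  rewrite exprn_gt0// => /(_ isT)[N _ /(_ N (leqnn _))] /=.
  by rewrite sub0r normrN => H; exists N; apply: le_trans H; exact: ler_norm.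
pose N : nat := n.+1; have N0 : 0 < N%:R :> R by rewrite ltr0n.
exists (\sum_(k < N.+1) f (k%:R / N%:R) *:
  ('C(N, k)%:R *: ('X ^+ k * (1 - 'X) ^+ (N - k)))).
move=> t t01.
have -> : (\sum_(k < N.+1) f (k%:R / N%:R) *:
  ('C(N, k)%:R *: ('X ^+ k * (1 - 'X) ^+ (N - k)))).[t] =
    bernstein_sum N t (fun k => f (k%:R / N%:R)).
  rewrite horner_sum; apply: eq_bigr => k _.
  by rewrite !(hornerE, horner_exp); ring.
have -> : f t = bernstein_sum N t (fun=> f t).
  rewrite -[LHS]mulr1 -(bernstein_sum1 N t) -bernstein_sumZ.
  by congr bernstein_sum; apply/funext => k; rewrite mulr1.
have -> : forall a b : nat -> R, bernstein_sum N t a - bernstein_sum N t b =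
    bernstein_sum N t (fun k => a k - b k).
  move=> a b; rewrite -mulN1r -bernstein_sumZ -bernstein_sumD.
  by congr bernstein_sum; apply/funext => k; rewrite mulN1r.
have B0 k : (k <= N)%N -> `|f (k%:R / N%:R) - f t| <=
    K * (h * 1 + h^-1 * (k%:R / N%:R - t) ^+ 2).
  move=> kN; apply: le_trans (fK _ _ _ t01) _.
    rewrite divr_ge0 ?ler0n//= ler_pdivrMr// mul1r ler_nat//.
  rewrite ler_wpM2l//; set a := _ - t; rewrite mulr1 -[X in _ <= _ + _ * X]real_normK ?num_real//.
  move: `|a| (normr_ge0 a) => b b0.
  rewrite -subr_ge0 -(pmulr_rge0 _ h0) mulrBr mulrDr mulVKf ?gt_eqF//.
  nra.
have S k : - (K * (h * 1 + h^-1 * (k%:R / N%:R - t) ^+ 2)) = -1 * (K * (h * 1 + h^-1 * (k%:R / N%:R - t) ^+ 2)).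
  by rewrite mulN1r.
have V : bernstein_sum N t (fun k => K * (h * 1 + h^-1 * (k%:R / N%:R - t) ^+ 2)) <= e.
  rewrite bernstein_sumZ bernstein_sumD !bernstein_sumZ bernstein_sum1 bernstein_variance.
  have t1 : t * (1 - t) <= 1 by move/andP: t01 => [? ?]; nra.
  have A : h^-1 * (t * (1 - t) / N%:R) <= h.
    rewrite ler_pdivrMl// -expr2; apply: le_trans Hn.
    by rewrite -[leRHS]mul1r ler_wpM2r// invr_ge0 ltW.
  apply: (@le_trans _ _ (K * (h + h))); first by rewrite ler_wpM2l// mulr1 lerD2l.
  have : h * (2 * (K + 1)) = e by rewrite /h divfK// gt_eqF// mulr_gt0.
  by move: h0; nra.
rewrite ler_norml; apply/andP; split.
  rewrite -lerN2 opprK; apply: le_trans V.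
  rewrite -[leLHS]mulN1r -bernstein_sumZ; apply: bernstein_sum_le => // k kN.
  rewrite mulN1r; apply: le_trans (B0 k kN).
  by rewrite -normrN ler_norm.
apply: le_trans V; apply: bernstein_sum_le => // k kN.
by apply: le_trans (B0 k kN); exact: ler_norm.
Qed.

(** [t^k] divides the cut-off [max (t - c) 0] with the Lipschitz quotient
    [max (t - c) 0 * (max t c)^-k] of size [c^-k]; approximate it by a polynomial. *)
Lemma cutoff_quotient (c : R) (k : nat) (e : R) : 0 < c <= 1 -> 0 < e ->
  exists h, (forall t, 0 <= t <= 1 -> `|h.[t]| <= c^-1 ^+ k + e) /\
    forall t, 0 <= t <= 1 -> `|(h * 'X^k).[t] - Num.max (t - c) 0| <= e.
Proof.
move=> /andP[c0 c1] e0.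
pose g t : R := Num.max (t - c) 0; pose m t : R := (Num.max t c)^-1.
have m0 t : 0 < m t by rewrite invr_gt0 lt_max c0 orbT.
have mc t : m t <= c^-1 by rewrite lef_pV2 ?posrE ?lt_max ?c0 ?orbT// le_max lexx orbT.
have mX t j : m t ^+ j <= c^-1 ^+ j.
  by apply: lerXn2r (mc t); rewrite nnegrE ltW// invr_gt0.
have g01 t : 0 <= t <= 1 -> 0 <= g t <= 1.
  move=> /andP[t0 t1]; rewrite le_max lexx orbT ge_max ler01 andbT; lra.
have gL s t : `|g s - g t| <= `|s - t|.
  have A : s - t <= `|s - t| by exact: ler_norm.
  have B : t - s <= `|s - t| by rewrite distrC ler_norm.
  rewrite /g; case: (lerP (s - c) 0) => sc; case: (lerP (t - c) 0) => tc;
    by rewrite ler_norml; apply/andP; split; lra.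
have mL s t : `|m s - m t| <= c^-1 ^+ 2 * `|s - t|.
  have ms : Num.max s c != 0 by rewrite gt_eqF// lt_max c0 orbT.
  have mt : Num.max t c != 0 by rewrite gt_eqF// lt_max c0 orbT.
  have -> : m s - m t = m s * m t * (Num.max t c - Num.max s c) by rewrite /m; field; rewrite ms mt.
  rewrite normrM ler_pM//.
    rewrite gtr0_norm ?mulr_gt0// expr2 ler_pM// ltW//.
  have A : s - t <= `|s - t| by exact: ler_norm.
  have B : t - s <= `|s - t| by rewrite distrC ler_norm.
  case: (lerP s c) => sc; case: (lerP t c) => tc;
    by rewrite ler_norml; apply/andP; split; lra.
move: (c^-1 ^+ 2) mL => C2 mL.
have [K HK] : exists K, forall s t, 0 <= s <= 1 -> 0 <= t <= 1 ->
    `|g s * m s ^+ k - g t * m t ^+ k| <= K * `|s - t|.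
  elim: k => [|k [K IH]]; first by exists 1 => s t _ _; rewrite !mulr1 mul1r.
  exists (K * c^-1 + c^-1 ^+ k * C2) => s t s01 t01.
  rewrite (exprSr (m s)) (exprSr (m t)) !mulrA.
  have -> : g s * m s ^+ k * m s - g t * m t ^+ k * m t =
    (g s * m s ^+ k - g t * m t ^+ k) * m s + (g t * m t ^+ k) * (m s - m t) by ring.
  apply: le_trans (ler_normD _ _) _; rewrite [leRHS]mulrDl lerD//.
    rewrite normrM mulrAC ler_pM//; first exact: IH.
    by rewrite gtr0_norm.
  rewrite normrM -mulrA ler_pM//.
  have /andP[g0 g1] := g01 t t01.
  rewrite ger0_norm ?mulr_ge0 ?exprn_ge0 ?(ltW (m0 _))//.
  by rewrite -[leRHS]mul1r ler_pM ?exprn_ge0 ?(ltW (m0 _))//; exact: mX.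
have [h Hh] := lipschitz_poly_approx e0 HK.
exists h; split=> t t01.
  have -> : h.[t] = (h.[t] - g t * m t ^+ k) + g t * m t ^+ k by rewrite subrK.
  rewrite addrC (le_trans (ler_normD _ _))// lerD//; last exact: Hh.
  have /andP[g0 g1] := g01 t t01.
  rewrite ger0_norm ?mulr_ge0 ?exprn_ge0 ?(ltW (m0 _))//.
  by rewrite -[leRHS]mul1r ler_pM ?exprn_ge0 ?(ltW (m0 _))//; exact: mX.
have /andP[t0 t1] := t01.
have -> : Num.max (t - c) 0 = g t * m t ^+ k * t ^+ k.
  rewrite /g; case: (lerP (t - c) 0) => tc; first by rewrite !mul0r.
  rewrite /m; have -> : Num.max t c = t by apply/max_idPl; lra.
  by rewrite -mulrA -exprMn mulVf ?expr1n ?mulr1// gt_eqF//; lra.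
rewrite hornerM hornerXn -mulrBl normrM -[leRHS]mulr1 ler_pM//; first exact: Hh.
by rewrite ger0_norm ?exprn_ge0// exprn_ile1.
Qed.

End UnitIntervalPolynomials.

(** * Bounded operators and functional calculus *)

Section LinearMaps.
Variables (K : pzRingType) (U V : lmodType K).
Implicit Types (u v : U) (S : U -> V).

Lemma linD S u v : linear S -> S (u + v) = S u + S v.
Proof. by move=> Sl; rewrite -[u in LHS]scale1r Sl scale1r. Qed.

Lemma lin0 S : linear S -> S 0 = 0.
Proof. by move=> Sl; apply: (addrI (S 0)); rewrite -linD// !addr0. Qed.

Lemma linZ S a u : linear S -> S (a *: u) = a *: S u.
Proof. by move=> Sl; rewrite -[a *: u]addr0 Sl lin0// addr0. Qed.

Lemma linN S u : linear S -> S (- u) = - S u.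
Proof. by move=> Sl; rewrite -scaleN1r linZ// scaleN1r. Qed.

Lemma linB S u v : linear S -> S (u - v) = S u - S v.
Proof. by move=> Sl; rewrite linD// linN. Qed.

Lemma lin_sum S I (s : seq I) (P : pred I) (F : I -> U) : linear S ->
  S (\sum_(i <- s | P i) F i) = \sum_(i <- s | P i) S (F i).
Proof.
by move=> Sl; apply: (big_morph S) => [u v|]; [rewrite linD|rewrite lin0].
Qed.

End LinearMaps.

Section Operators.
Context d (T : measurableType d) (R : realType).
Variable mu : {measure set T -> \bar R}.
Implicit Types (u v w : L2 mu) (S X Y : L2 mu -> L2 mu) (p q r : {poly R}).

Lemma opboundW S (M M' : R) : M <= M' -> opbound S M -> opbound S M'.
Proof.
by move=> MM' SM u; apply: le_trans (SM u) _; rewrite ler_wpM2r ?L2norm_ge0.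
Qed.

Lemma opbound_le S (M : R) u : 0 <= M -> opbound S M -> L2norm u <= 1 -> L2norm (S u) <= M.
Proof.
by move=> M0 SM u1; apply: le_trans (SM u) _; rewrite -[leRHS]mulr1 ler_wpM2l.
Qed.

Lemma bounded_opbound S : bounded_operator S -> exists2 M : R, 0 <= M & opbound S M.
Proof.
move=> [_ [M SM]]; exists (Num.max M 0); first by rewrite le_max lexx orbT.
by apply: opboundW SM; rewrite le_max lexx.
Qed.

Lemma bounded_id : bounded_operator (id : L2 mu -> L2 mu).
Proof. by split; [move=> a u v|exists 1 => u; rewrite mul1r]. Qed.

Lemma bounded0 : bounded_operator (0 : L2 mu -> L2 mu).
Proof.
split; first by move=> a u v; rewrite /= scaler0 addr0.
by exists 0 => u; rewrite L2norm0 mul0r.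
Qed.

Lemma bounded_comp S S' : bounded_operator S -> bounded_operator S' ->
  bounded_operator (S \o S').
Proof.
move=> Sb S'b; have [M M0 SM] := bounded_opbound Sb.
have [M' M'0 SM'] := bounded_opbound S'b; split.
  by move=> a u v /=; rewrite S'b.1 Sb.1.
exists (M * M') => u; apply: le_trans (SM _) _.
by rewrite -mulrA ler_wpM2l.
Qed.

Lemma opbound_comp S S' (M M' : R) : 0 <= M -> opbound S M -> opbound S' M' ->
  opbound (S \o S') (M * M').
Proof.
by move=> M0 SM SM' u; apply: le_trans (SM _) _; rewrite -mulrA ler_wpM2l.
Qed.

Lemma opboundBC S S' (M : R) : opbound (S - S') M -> opbound (S' - S) M.
Proof. by move=> SM u; rewrite -[(S' - S) u]/(S' u - S u) L2normBC; exact: SM. Qed.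

Lemma opbound_tri S S1 S' (M M' : R) : opbound (S - S1) M -> opbound (S1 - S') M' ->
  opbound (S - S') (M + M').
Proof.
move=> SM SM' u; rewrite -[(S - S') u]/(S u - S' u) mulrDl.
by apply: le_trans (L2norm_tri _ (S1 u) _) _; apply: lerD; [exact: SM|exact: SM'].
Qed.

Lemma bounded_lin (a : R[i]) S S' : bounded_operator S -> bounded_operator S' ->
  bounded_operator (a *: S + S').
Proof.
move=> Sb S'b; have [M M0 SM] := bounded_opbound Sb.
have [M' M'0 SM'] := bounded_opbound S'b; split.
  move=> b u v; rewrite -![(a *: S + S') _]/(a *: S _ + S' _) Sb.1 S'b.1.
  by rewrite scalerDr scalerA mulrC -scalerA addrACA -scalerDr.
exists (cabs a * M + M') => u; apply: le_trans (L2normD _ _) _.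
by rewrite mulrDl lerD// L2normZ -mulrA ler_wpM2l ?cabs_ge0.
Qed.

Lemma boundedB S S' : bounded_operator S -> bounded_operator S' ->
  bounded_operator (S - S').
Proof.
move=> Sb S'b; have := bounded_lin (-1) S'b Sb.
by rewrite scaleN1r addrC.
Qed.

Lemma opnorm_has_sup S : bounded_operator S ->
  has_sup [set L2norm (S u) | u in [set u : L2 mu | L2norm u <= 1]].
Proof.
move=> Sb; have [M M0 SM] := bounded_opbound Sb; split.
  by exists (L2norm (S 0)), 0; rewrite //= L2norm0.
by exists M => _ [u /= u1 <-]; exact: opbound_le.
Qed.

Lemma opnorm_leP S (M : R) : bounded_operator S -> 0 <= M -> opbound S M -> opnorm S <= M.
Proof.
move=> Sb M0 SM; apply: ge_sup.
  by exists (L2norm (S 0)), 0; rewrite //= L2norm0.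
by move=> _ [u /= u1 <-]; exact: opbound_le.
Qed.

Lemma opbound_opnorm S : bounded_operator S -> opbound S (opnorm S).
Proof.
move=> Sb u; have [u0|u0] := eqVneq (L2norm u) 0.
  by rewrite (L2norm_eq0 u0) (lin0 Sb.1) !L2norm0 mulr0.
have up : 0 < L2norm u by rewrite lt_def u0 L2norm_ge0.
rewrite -ler_pdivrMr//; apply: sup_ubound; first by have [] := opnorm_has_sup Sb.
exists ((L2norm u)^-1%:C *: u).
  by rewrite /= L2normZ cabsR ger0_norm ?invr_ge0 ?L2norm_ge0// mulVf.
by rewrite (linZ _ _ Sb.1) L2normZ cabsR ger0_norm ?invr_ge0 ?L2norm_ge0// mulrC.
Qed.

(** This form of the operator norm closure avoids the supremum in [opnorm]. *)
Lemma opclosureP (A : set (L2 mu -> L2 mu)) S : A `<=` bounded_operator (mu := mu) ->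
  opclosure A S <-> bounded_operator S /\
    forall e : R, 0 < e -> exists2 S', A S' & opbound (S - S') e.
Proof.
move=> Ab; split=> -[Sb HS]; split=> // e e0.
  have [S' AS' SS'] := HS e e0; exists S' => //.
  by apply: opboundW (ltW SS') _; apply: opbound_opnorm; apply: boundedB => //; exact: Ab.
have e2 : 0 < e / 2 by rewrite divr_gt0.
have [S' AS' SS'] := HS _ e2; exists S' => //.
apply: (@le_lt_trans _ _ (e / 2)); last by rewrite ltr_pdivrMr// mulr_natr mulr2n ltrDl.
by apply: opnorm_leP => //; [apply: boundedB => //; exact: Ab|exact: ltW].
Qed.

Lemma operators_complete (S : nat -> L2 mu -> L2 mu) :
  (forall n, bounded_operator (S n)) ->
  (forall e : R, 0 < e -> exists N, forall m n, (N <= m)%N -> (N <= n)%N ->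
     opbound (S m - S n) e) ->
  exists2 X, bounded_operator X & forall e : R, 0 < e -> exists N, forall n, (N <= n)%N ->
     opbound (S n - X) e.
Proof.
move=> Sb Sc.
have /choice[X HX] : forall u, exists l, forall e : R, 0 < e -> exists N, forall n,
    (N <= n)%N -> L2norm (S n u - l) <= e.
  move=> u; apply: L2_complete => e e0.
  have u1 : 0 < L2norm u + 1 by rewrite ltr_wpDl ?L2norm_ge0.
  have [N HN] := Sc (e / (L2norm u + 1)) ltac:(by rewrite divr_gt0).
  exists N => m n Nm Nn; apply: le_trans (HN m n Nm Nn u) _.
  by rewrite -mulrA ler_piMr ?ltW// mulrC ltr_pdivrMr// mul1r ltrDl.
have XS (e : R) N : (forall m n, (N <= m)%N -> (N <= n)%N -> opbound (S m - S n) e) ->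
    forall n, (N <= n)%N -> opbound (S n - X) e.
  move=> HN n Nn u; apply/ler_addgt0Pr => h h0.
  have [N' HN'] := HX u h h0.
  apply: le_trans (L2norm_tri _ (S (maxn N N') u) _) _; apply: lerD.
    by apply: HN => //; exact: leq_maxl.
  by apply: HN'; exact: leq_maxr.
have Xl : linear X.
  move=> a u v; apply/eqP; rewrite -subr_eq0; apply/eqP/L2norm_eq0/eqP.
  rewrite eq_le L2norm_ge0 andbT; apply/ler_addgt0Pr => e e0; rewrite add0r.
  pose K := cabs a + 2; have K0 : 0 < K by rewrite ltr_wpDl ?cabs_ge0.
  pose h := e / K; have h0 : 0 < h by rewrite divr_gt0.
  have [N1 H1] := HX (a *: u + v) h h0; have [N2 H2] := HX u h h0.
  have [N3 H3] := HX v h h0.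
  pose n := (N1 + N2 + N3)%N.
  have {}H1 := H1 n ltac:(by rewrite /n -addnA leq_addr).
  have {}H2 := H2 n ltac:(by rewrite /n addnAC leq_addl).
  have {}H3 := H3 n ltac:(by rewrite /n leq_addl).
  have -> : X (a *: u + v) - (a *: X u + X v) =
     (X (a *: u + v) - S n (a *: u + v)) + (a *: (S n u - X u) + (S n v - X v)).
    rewrite (Sb n).1 scalerBr.
    by rewrite (addrACA (a *: S n u)) -opprD addrA subrK.
  apply: le_trans (L2normD _ _) _.
  have := L2normD (a *: (S n u - X u)) (S n v - X v); rewrite L2normZ.
  rewrite (L2normBC (X (a *: u + v))).
  have -> : e = h + cabs a * h + h by rewrite /h /K; field; rewrite -/K gt_eqF.
  have := ler_wpM2l (cabs_ge0 a) H2; move: H1 H3.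
  move: (L2norm _) (L2norm _) (L2norm _) (L2norm _) (cabs a) => n1 n2 n3 n4 ca.
  lra.
have [N0 H0] := Sc 1 ltr01.
have [M M0 HM] := bounded_opbound (Sb N0).
exists X.
  split => //; exists (M + 1) => u.
  have := XS _ _ H0 N0 (leqnn _) u; have := HM u.
  have := L2normD (S N0 u) (X u - S N0 u); rewrite addrC subrK (L2normBC (X u)).
  rewrite mulrDl -[(S N0 - X) u]/(S N0 u - X u); lra.
by move=> e e0; have [N HN] := Sc e e0; exists N; exact: XS.
Qed.

Definition opoly (p : {poly R}) S u : L2 mu :=
  \sum_(i < size p) (p`_i)%:C *: iter i S u.

Lemma opolyE p S u n : (size p <= n)%N ->
  opoly p S u = \sum_(i < n) (p`_i)%:C *: iter i S u.
Proof.
move=> pn; rewrite /opoly (big_ord_widen n (fun i => (p`_i)%:C *: iter i S u))//.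
rewrite big_mkcond; apply: eq_bigr => i _; case: ltnP => // pi.
by rewrite nth_default// scale0r.
Qed.

Lemma opolyD p q S u : opoly (p + q) S u = opoly p S u + opoly q S u.
Proof.
rewrite !(@opolyE _ _ _ (maxn (size p) (size q))) ?leq_maxl ?leq_maxr ?size_polyD//.
by rewrite -big_split; apply: eq_bigr => i _; rewrite coefD rmorphD scalerDl.
Qed.

Lemma opolyZ (c : R) p S u : opoly (c *: p) S u = c%:C *: opoly p S u.
Proof.
rewrite !(@opolyE _ _ _ (size p)) ?size_scale_leq// scaler_sumr.
by apply: eq_bigr => i _; rewrite coefZ rmorphM scalerA.
Qed.

Lemma opolyB p q S u : opoly (p - q) S u = opoly p S u - opoly q S u.
Proof. by rewrite opolyD -scaleN1r opolyZ rmorphN1 scaleN1r. Qed.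

Lemma opolyC (c : R) S u : opoly c%:P S u = c%:C *: u.
Proof. by rewrite (@opolyE _ _ _ 1) ?size_polyC_leq1// big_ord1 coefC. Qed.

Lemma opoly1 S u : opoly 1 S u = u.
Proof. by rewrite opolyC scale1r. Qed.

Lemma opolyMX p S u : opoly (p * 'X) S u = opoly p S (S u).
Proof.
have sp : (size (p * 'X)%R <= (size p).+1)%N.
  by apply: leq_trans (size_polyMleq _ _) _; rewrite size_polyX addn2.
rewrite (opolyE _ _ sp) (@opolyE p _ _ (size p))// big_ord_recl coefMX/= scale0r add0r.
by apply: eq_bigr => i _; rewrite coefMX/= -iterSr.
Qed.

Lemma opolyM p q S u : linear S -> opoly (p * q) S u = opoly p S (opoly q S u).
Proof.
move=> Sl.
have SO r w : S (opoly r S w) = opoly r S (S w).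
  rewrite /opoly lin_sum//; apply: eq_bigr => i _.
  by rewrite linZ// -iterS iterSr.
elim/poly_ind: p q u => [|p c IH] q u.
  by rewrite mul0r -[0]/(0%:P) !opolyC !scale0r.
rewrite mulrDl !opolyD mulrAC opolyMX !opolyC opolyMX SO.
by rewrite mul_polyC opolyZ IH.
Qed.

Lemma opolyX S u : opoly 'X S u = S u.
Proof. by rewrite -[X in opoly X]mul1r opolyMX opoly1. Qed.

(** The order interval [0 <= X <= 1] of the self-adjoint operators. *)
Record positive_contraction X : Prop := {
  pc_linear : linear X;
  pc_adjoint : adjoint X X;
  pc_ge0 : forall u, 0 <= Re (L2dot (X u) u);
  pc_le1 : forall u, Re (L2dot (X u) u) <= L2norm u ^+ 2
}.

Lemma opoly_adjoint p X : positive_contraction X -> adjoint (opoly p X) (opoly p X).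
Proof.
move=> Xp; elim/poly_ind: p => [|p c IH] u v.
  by rewrite -[0]/(0%:P) !opolyC !scale0r L2dot0l L2dot0r.
have Xl := pc_linear Xp.
rewrite !opolyD !opolyC L2dotDl L2dotDr L2dotZl L2dotZr cconjR; congr (_ + _).
by rewrite opolyMX IH (pc_adjoint Xp) mulrC opolyM// opolyX.
Qed.

Lemma opoly_moment X u : positive_contraction X ->
  moment_functional (fun p => Re (L2dot (opoly p X u) u)).
Proof.
move=> Xp; have Xl := pc_linear Xp.
have sq q r : L2dot (opoly (r * (q * q)) X u) u =
    L2dot (opoly r X (opoly q X u)) (opoly q X u).
  by rewrite mulrA (mulrC _ q) opolyM// (opoly_adjoint q Xp) opolyM.
split=> [p q|c p|q|q|q|q].
- by rewrite opolyD L2dotDl cReD.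
- by rewrite opolyZ L2dotZl cReM mul0r subr0.
- by rewrite -[q * q]mul1r sq opoly1 -sqr_L2norm sqr_ge0.
- by rewrite sq opolyX (pc_ge0 Xp).
- by rewrite sq opolyB opoly1 opolyX L2dotBl cReD cReN -sqr_L2norm subr_ge0 (pc_le1 Xp).
rewrite sq; move: (opoly q X u) => w.
rewrite opolyM// opolyX opolyB opoly1 opolyX (linB _ _ Xl).
(* [X (1 - X) = (1 - X) X (1 - X) + X (1 - X) X] *)
have := pc_ge0 Xp (w - X w); have := pc_le1 Xp (X w).
rewrite sqr_L2norm (linB _ _ Xl) !L2dotBl !L2dotBr.
rewrite (pc_adjoint Xp (X w) w) !(cReD, cReN).
lra.
Qed.

(** [|p(X)|^2 <= c^2] because [c^2 - p^2] is nonnegative on [0, 1]. *)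
Lemma opoly_bound p X (c : R) : positive_contraction X ->
  (forall t, 0 <= t <= 1 -> `|p.[t]| <= c) -> opbound (opoly p X) c.
Proof.
move=> Xp pc u; have Xl := pc_linear Xp.
have c0 : 0 <= c by apply: le_trans (pc 0 _); rewrite // lexx ler01.
rewrite -(@ler_pXn2r _ 2) ?nnegrE ?mulr_ge0 ?L2norm_ge0//.
have := @moment_ge0 _ _ ((c ^+ 2)%:P - p * p) (opoly_moment u Xp).
rewrite opolyB opolyC opolyM// L2dotBl (opoly_adjoint p Xp) L2dotZl.
rewrite cReD cReN cReM mul0r subr0 -!sqr_L2norm exprMn subr_ge0; apply => t t01.
rewrite !hornerE subr_ge0 -expr2 -[leLHS]real_normK ?num_real// lerXn2r ?nnegrE//.
exact: pc.
Qed.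

Lemma pc_bounded X : positive_contraction X -> bounded_operator X.
Proof.
move=> Xp; split; first exact: pc_linear.
exists 1 => u; rewrite -opolyX; apply: opoly_bound => // t /andP[t0 t1].
by rewrite hornerX ger0_norm.
Qed.

Lemma opoly_bounded p X : bounded_operator X -> bounded_operator (opoly p X).
Proof.
move=> Xb; elim/poly_ind: p => [|p c IH].
  have -> : opoly 0 X = 0 by apply/funext => u; rewrite -[0]/(0%:P) opolyC scale0r.
  exact: bounded0.
have -> : opoly (p * 'X + c%:P) X = c%:C *: id + (opoly p X \o X).
  by apply/funext => u; rewrite opolyD opolyMX opolyC addrC.
by apply: bounded_lin; [exact: bounded_id|exact: bounded_comp].
Qed.

(** [Z] is [max (X - c) 0], the limit of [opoly (p n) X] for polynomials [p n] tending
    to [max (t - c) 0] uniformly on [0, 1]. It is approximately divisible by every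
    power of [X]. *)
Lemma cutoff_operator X (c : R) : positive_contraction X -> 0 < c <= 1 ->
  exists2 Z, bounded_operator Z & opbound (Z - X) c /\
  forall k (e : R), 0 < e -> exists h : {poly R},
    opbound (opoly h X) (c^-1 ^+ k + e) /\ opbound (Z - opoly (h * 'X^k) X) e.
Proof.
move=> Xp c01; have /andP[c0 c1] := c01; have Xb := pc_bounded Xp.
have /choice[p Hp] : forall n : nat, exists p : {poly R}, forall t, 0 <= t <= 1 ->
    `|p.[t] - Num.max (t - c) 0| <= n.+1%:R^-1.
  move=> n; have n0 : 0 < n.+1%:R^-1 :> R by rewrite invr_gt0.
  have [h [_ Hh]] := cutoff_quotient 0 c01 n0; exists h => t t01.
  by have := Hh t t01; rewrite expr0 mulr1.
have pB p1 p2 (e1 e2 : R) : (forall t, 0 <= t <= 1 -> `|p1.[t] - Num.max (t - c) 0| <= e1) ->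
   (forall t, 0 <= t <= 1 -> `|p2.[t] - Num.max (t - c) 0| <= e2) ->
   opbound (opoly p1 X - opoly p2 X) (e1 + e2).
  move=> H1 H2 u; rewrite -[(_ - _) u]/(opoly p1 X u - opoly p2 X u) -opolyB.
  apply: opoly_bound => // t t01; rewrite hornerD hornerN.
  have := H1 t t01; have := H2 t t01; rewrite !ler_norml => /andP[? ?] /andP[? ?].
  by apply/andP; split; lra.
have small := @ex_natSinv_le R.
have [|e e0|Z Zb HZ] := @operators_complete (fun n => opoly (p n) X).
- by move=> n; exact: opoly_bounded.
- have [N HN] := small (e / 2) ltac:(by rewrite divr_gt0).
  exists N => m n Nm Nn; apply: opboundW (pB _ _ _ _ (Hp m) (Hp n)).
  by rewrite [leRHS]splitr lerD// HN.
have ZP q (e : R) : (forall t, 0 <= t <= 1 -> `|q.[t] - Num.max (t - c) 0| <= e) ->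
    opbound (Z - opoly q X) e.
  move=> Hq u; apply/ler_addgt0Pr => h h0.
  have u1 : 0 < L2norm u + 1 by rewrite ltr_wpDl ?L2norm_ge0.
  have h1 : 0 < h / (L2norm u + 1) / 2 by rewrite !divr_gt0.
  have [N1 H1] := HZ _ h1; have [N2 H2] := small _ h1.
  pose n := maxn N1 N2; have {}H1 := H1 n (leq_maxl _ _); have {}H2 := H2 n (leq_maxr _ _).
  have := opbound_tri (opboundBC H1) (pB _ _ _ _ (Hp n) Hq) u.
  move/le_trans; apply; rewrite addrA [leLHS]mulrDl [leLHS]addrC lerD2l.
  apply: (@le_trans _ _ (h / (L2norm u + 1) * L2norm u)).
    by rewrite ler_wpM2r ?L2norm_ge0// [leRHS]splitr lerD2l.
  by rewrite -mulrA ler_piMr ?ltW// mulrC ltr_pdivrMr// mul1r ltrDl.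
exists Z => //; split.
  have := ZP 'X c; have -> : opoly 'X X = X by apply/funext => u; rewrite opolyX.
  apply=> t /andP[t0 t1]; rewrite hornerX.
  by case: (lerP (t - c) 0) => tc; rewrite ler_norml; apply/andP; split; lra.
move=> k e e0; have [h [h1 h2]] := cutoff_quotient k c01 e0.
by exists h; split; [exact: opoly_bound|exact: ZP].
Qed.

End Operators.

(** * Measure-preserving maps and truncation *)

Section MeasurePreserving.
Context d1 d2 (T1 : measurableType d1) (T2 : measurableType d2) (R : realType).
Variables (mu1 : {measure set T1 -> \bar R}) (mu2 : {measure set T2 -> \bar R}).

Definition measure_preserving (phi : T1 -> T2) := measurable_fun setT phi /\
  forall A, measurable A -> mu1 (phi @^-1` A) = mu2 A.

Variable phi : T1 -> T2.
Hypothesis mp : measure_preserving phi.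

Let mphi : measurable_fun setT phi := mp.1.

Let push_integral (f : T2 -> \bar R) :
  (\int[pushforward mu1 phi]_y f y = \int[mu2]_y f y)%E.
Proof. by apply: eq_measure_integral => A mA _; exact: mp.2. Qed.

Lemma mp_ge0_integral (f : T2 -> \bar R) : measurable_fun setT f ->
  (forall x, 0 <= f x)%E -> (\int[mu1]_x f (phi x) = \int[mu2]_x f x)%E.
Proof.
move=> mf f0; rewrite -push_integral.
by rewrite (ge0_integral_pushforward mphi mu1 measurableT)//; exact: measurable_funTS.
Qed.

Lemma mp_rintegrable (h : T2 -> R) : rintegrable mu2 h -> rintegrable mu1 (h \o phi).
Proof.
move=> /integrableP[mh ih]; apply/integrableP; split.
  by apply: (@measurableT_comp _ _ _ _ _ _ (EFin \o h)).
rewrite -[X in (X < _)%E](_ : \int[mu2]_x `|(EFin \o h) x| = _)%E//.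
rewrite -(mp_ge0_integral (f := fun y => `|(EFin \o h) y|%E))//.
exact: measurableT_comp.
Qed.

Lemma mp_Rintegral (h : T2 -> R) : rintegrable mu2 h ->
  \int[mu1]_x h (phi x) = \int[mu2]_x h x.
Proof.
move=> ih; congr fine; rewrite -push_integral.
rewrite (integral_pushforward mphi)//; first exact: (measurable_int _ ih).
by have := mp_rintegrable ih.
Qed.

Lemma mp_cmeasurable (f : T2 -> R[i]) : cmeasurable f -> cmeasurable (f \o phi).
Proof. by move=> [rf jf]; split; [exact: (measurableT_comp rf mphi)|exact: (measurableT_comp jf mphi)]. Qed.

Lemma mp_cLfun1 (f : T2 -> R[i]) : f \in cLfun mu2 1 -> f \o phi \in cLfun mu1 1.
Proof.
by move=> /cLfun1P[rf jf]; apply/cLfun1P; split; [exact: (mp_rintegrable rf)|exact: (mp_rintegrable jf)].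
Qed.

Lemma mp_cintegral (f : T2 -> R[i]) : f \in cLfun mu2 1 ->
  cintegral mu1 (fun x => f (phi x)) = cintegral mu2 f.
Proof.
move=> /cLfun1P[rf jf].
by apply: eq_ReIm => /=; [exact: (mp_Rintegral rf)|exact: (mp_Rintegral jf)].
Qed.

Lemma mp_cL2 (f : T2 -> R[i]) : f \in cL2fun mu2 -> f \o phi \in cL2fun mu1.
Proof.
move=> /cL2P[mf f2]; apply/cL2P; split; first exact: mp_cmeasurable.
exact: (mp_rintegrable f2).
Qed.

Lemma mp_ae (P : T2 -> Prop) : {ae mu2, forall x, P x} -> {ae mu1, forall x, P (phi x)}.
Proof.
move=> [N [mN N0 PN]]; exists (phi @^-1` N); split.
- by rewrite -[X in measurable X]setTI; exact: mphi.
- by rewrite mp.2.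
- by move=> x /= Px; apply: PN.
Qed.

End MeasurePreserving.

Section Truncation.
Context d (T : measurableType d) (R : realType).
Variable mu : {measure set T -> \bar R}.

Definition band (f : T -> R) (n : nat) : set T :=
  [set x | n.+1%:R^-1 <= f x <= n.+1%:R].

Lemma measurable_band f n : measurable_fun setT f -> measurable (band f n).
Proof.
move=> mf; have := mf measurableT _ (measurable_itv `[n.+1%:R^-1, n.+1%:R]).
by rewrite setTI; congr measurable; apply/seteqP; split => x /=; rewrite in_itv.
Qed.

Lemma band_lty f n : rintegrable mu f -> (forall x, 0 <= f x) -> (mu (band f n) < +oo)%E.
Proof.
move=> fi f0; have mf := rintegrable_measurable fi.
have mb := measurable_band n mf.
have n0 : (0 < n.+1%:R^-1%:E :> \bar R)%E by rewrite lte_fin invr_gt0.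
have fib : mu.-integrable (band f n) (EFin \o f) by exact: integrableS fi.
have H : (n.+1%:R^-1%:E * mu (band f n) < +oo)%E.
  rewrite -integral_cst//; apply: le_lt_trans (integrable_lty mb fib).
  apply: ge0_le_integral => //.
  - by move=> x _; rewrite lee_fin invr_ge0.
  - exact: (measurable_int _ fib).
  - by move=> x /= /andP[+ _]; rewrite lee_fin.
rewrite ltNge leye_eq; apply/negP => /eqP E.
by move: H; rewrite E gt0_muley.
Qed.

Lemma Rintegral_dominated (f : nat -> T -> R) (g h : T -> R) :
  (forall n, measurable_fun setT (f n)) ->
  (forall x, f ^~ x @ \oo --> g x) -> (forall n x, `|f n x| <= h x) ->
  rintegrable mu h -> (fun n => \int[mu]_x f n x) @ \oo --> \int[mu]_x g x.
Proof.
move=> mf fg fh hi.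
have mg : measurable_fun setT g by apply: (measurable_fun_cvg mf) => x _; exact: fg.
have [] := @dominated_convergence _ _ _ mu setT measurableT (fun n => EFin \o f n)
  (EFin \o g) (EFin \o h).
- by move=> n; exact/measurable_EFinP.
- exact/measurable_EFinP.
- by apply: aeW => x _; apply: cvg_EFin; [exact: nearW|exact: fg].
- exact: hi.
- by apply: aeW => x n _; rewrite lee_fin.
move=> gi _ H; apply: fine_cvg; rewrite fineK//; exact: integrable_fin_num.
Qed.

(** Dominated convergence along the sets where [f] is neither tiny nor huge. *)
Lemma band_tail f (e : R) : rintegrable mu f -> (forall x, 0 <= f x) -> 0 < e ->
  exists N, forall n, (N <= n)%N ->
    rintegrable mu (fun x => f x * \1_(~` band f n) x) /\
    \int[mu]_x (f x * \1_(~` band f n) x) <= e.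
Proof.
move=> fi f0 e0; have mf := rintegrable_measurable fi.
pose g n x := f x * \1_(~` band f n) x.
have mg n : measurable_fun setT (g n).
  apply: measurable_funM => //; apply: measurable_indic; apply: measurableC.
  exact: measurable_band.
have gf n x : `|g n x| <= f x.
  rewrite normrM ger0_norm// indicE; case: (_ \in _); rewrite ?normr1 ?normr0 ?mulr1//.
  by rewrite mulr0.
have ig n : rintegrable mu (g n) by exact: le_rintegrable fi.
have gcv x : g ^~ x @ \oo --> (0 : R).
  apply: cvg_near_cst.
  have [fx|fx] := eqVneq (f x) 0; first by apply: nearW => n; rewrite /g fx mul0r.
  have fx0 : 0 < f x by rewrite lt_def fx f0.
  have [N _ HN] : \forall n \near \oo, n.+1%:R^-1 <= f x.
    have /cvgrPdist_le /(_ _ fx0) := @cvg_harmonic R.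
    apply: filterS => n; rewrite /= sub0r normrN; apply: le_trans; exact: ler_norm.
  exists (N + Num.truncn (f x))%N => // n /= Nn.
  rewrite /g indicE memNset ?mulr0// => /=; apply.
  apply/andP; split; first by apply: HN; apply: leq_trans Nn; exact: leq_addr.
  have := truncnS_gt (f x) => /ltW/le_trans; apply.
  by rewrite ler_nat ltnS; apply: leq_trans Nn; exact: leq_addl.
have := @Rintegral_dominated g (cst 0) f mg gcv gf fi.
rewrite (_ : \int[mu]_x cst 0 x = 0); last by rewrite /Rintegral integral0.
move=> /cvgrPdist_le /(_ e e0)[N _ HN]; exists N => n /HN /=.
by rewrite sub0r normrN => H; split; [exact: ig|apply: le_trans H; exact: ler_norm].
Qed.

End Truncation.

(** * Haar measure on a locally compact group *)

Section GroupTopology.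
Variable G : topologicalGroupType.

Lemma continuous_mulgl (y : G) : continuous (fun x : G => (y * x)%g).
Proof.
move=> x; apply: (@continuous_comp _ _ _ (fun x => (y, x)) (fun z : G * G => (z.1 * z.2)%g)).
  by apply: cvg_pair; [exact: cvg_cst|exact: cvg_id].
exact: mulg_continuous.
Qed.

Lemma continuous_mulgr (y : G) : continuous (fun x : G => (x * y)%g).
Proof.
move=> x; apply: (@continuous_comp _ _ _ (fun x => (x, y)) (fun z : G * G => (z.1 * z.2)%g)).
  by apply: cvg_pair; [exact: cvg_id|exact: cvg_cst].
exact: mulg_continuous.
Qed.

Lemma continuous_invg : continuous (fun x : G => x^-1%g).
Proof. exact: invg_continuous. Qed.

Lemma open_mulgl (y : G) (U : set G) : open U -> open [set x | U (y * x)%g].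
Proof.
by move=> oU; apply: open_comp oU => x _; exact: continuous_mulgl.
Qed.

Lemma open_mulgr (y : G) (U : set G) : open U -> open [set x | U (x * y)%g].
Proof.
by move=> oU; apply: open_comp oU => x _; exact: continuous_mulgr.
Qed.

Lemma compact_image (T U : topologicalType) (f : T -> U) (K : set T) :
  continuous f -> compact K -> compact (f @` K).
Proof. by move=> cf; apply: continuous_compact; exact: continuous_subspaceT. Qed.

(** The tube lemma for the multiplication map. *)
Lemma compact_mulgl_near (K U : set G) : compact K -> open U -> K `<=` U ->
  \forall y \near (1%g : G), forall x, K x -> U (y * x)%g.
Proof.
move=> cK oU KU.
have /compact_near_coveringP H := cK.
apply: (H G (nbhs (1%g : G)) (fun y x => U (y * x)%g)) => x Kx.
have : nbhs ((1%g : G), x) [set z : G * G | U (z.1 * z.2)%g].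
  have := @mulg_continuous G (1%g, x) U; rewrite /= mul1g; apply.
  by apply: open_nbhs_nbhs; split => //; exact: KU.
move=> [[A B] /= [A1 Bx] AB]; exists (B, A) => // -[a b] /= [Ba Ab].
by have := AB (b, a); apply.
Qed.

End GroupTopology.

Section Haar.
Variables (R : realType) (G : topologicalGroupType).
Hypothesis hG : hausdorff_space G.
Variable mu : {measure set (borel G) -> \bar R}.
Hypothesis hmu : left_haar mu.

Lemma borel_open (U : set (borel G)) : open U -> measurable U.
Proof. by move=> oU; exact: sub_sigma_algebra. Qed.

Lemma borel_closed (U : set (borel G)) : closed U -> measurable U.
Proof.
by move=> cU; rewrite -[U]setCK; apply: measurableC; apply: borel_open; exact: closed_openC.
Qed.

Lemma borel_compact (K : set (borel G)) : compact K -> measurable K.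
Proof. by move=> cK; apply: borel_closed; exact: compact_closed. Qed.

Lemma continuous_borel (G' : topologicalGroupType) (f : borel G -> borel G') :
  continuous f -> measurable_fun setT f.
Proof.
move=> /continuousP cf; apply: (measurability (@open (borel G'))) => //.
by move=> _ [U oU <-]; rewrite setTI; apply: borel_open; exact: cf.
Qed.

Lemma continuous_borelR (f : borel G -> R) : continuous f -> measurable_fun setT f.
Proof.
move=> /continuousP cf; apply: (measurability _ (RGenOpens.measurableE R)) => //.
move=> _ [_ [a [b -> <-]]]; rewrite setTI; apply: borel_open; apply: cf.
exact: interval_open.
Qed.

Lemma mulgl_measure_preserving (y : G) :
  measure_preserving mu mu (fun x : borel G => (y * x)%g).
Proof.
have my z : measurable_fun setT (fun x : borel G => (z * x)%g).
  by apply: continuous_borel; exact: (@continuous_mulgl (borel G)).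
split=> // A mA; rewrite -(haar_invariant hmu y); last first.
  by rewrite -[X in measurable X]setTI; exact: my.
congr (mu _); apply/seteqP; split=> [_ [x /= Ax <-]//|x Ax].
by exists (y^-1 * x)%g; rewrite /= mulVKg.
Qed.

Lemma compact_seq_cover (K : set (borel G)) (O : borel G -> set (borel G)) :
  compact K -> (forall x, open (O x)) -> (forall x, K x -> O x x) ->
  exists s : seq (borel G), forall y, K y -> exists2 x, x \in s & O x y.
Proof.
rewrite compact_cover => cK oO KO.
have [|x Kx|D _ HD] := cK (borel G) K O; first by move=> x _; exact: oO.
  by exists x => //; exact: KO.
by exists (finmap.enum_fset D) => y /HD[x /= xD Oxy]; exists x.
Qed.

(** A null open set has null translates; these would cover every compact set, and
    [mu] would vanish by inner regularity. *)
Lemma haar_open_gt0 (U : set (borel G)) : open U -> U 1%g -> (0 < mu U)%E.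
Proof.
move=> oU U1; rewrite lt_def measure_ge0 andbT; apply/eqP => U0.
pose O (x : borel G) := [set y | U (x^-1 * y)%g].
have oO x : open (O x) by exact: open_mulgl.
have O0 x : mu (O x) = 0%E.
  by rewrite -U0; apply: (mulgl_measure_preserving _).2; exact: borel_open.
have K0 (K : set (borel G)) : compact K -> mu K = 0%E.
  move=> cK; have [|s Hs] := compact_seq_cover cK oO.
    by move=> x _; rewrite /O/= mulVg.
  apply/eqP; rewrite eq_le measure_ge0 andbT.
  apply: (@le_trans _ _ (mu (\big[setU/set0]_(x <- s) O x))).
    apply: le_measure; rewrite ?inE; first exact: borel_compact.
      by apply: bigsetU_measurable => x _; exact: borel_open.
    by move=> y /Hs[x xs Oy]; rewrite -bigcup_seq; exists x.
  elim: s {Hs} => [|x s IH]; first by rewrite big_nil measure0.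
  rewrite big_cons; apply: le_trans (measureU2 _ _ _) _.
  - exact: borel_open.
  - by apply: bigsetU_measurable => z _; exact: borel_open.
  - have Ox : (mu (O x) <= 0)%E by rewrite O0.
    by apply: le_trans (leeD Ox IH) _; rewrite adde0.
have := haar_inner_regular hmu openT.
have := haar_neq0 hmu; move/eqP => + E; apply; rewrite E.
apply/eqP; rewrite eq_le; apply/andP; split.
  by apply: ge_ereal_sup => _ [K [cK _] <-]; rewrite K0.
by apply: ereal_sup_ubound; exists set0; rewrite ?measure0//; split => //; exact: compact0.
Qed.

Lemma haar_outer_approx (E : set (borel G)) (e : R) : measurable E ->
  (mu E < +oo)%E -> 0 < e -> exists U, [/\ open U, E `<=` U & (mu (U `\` E) <= e%:E)%E].
Proof.
move=> mE Efin e0.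
have Ef : mu E \is a fin_num by rewrite ge0_fin_numE.
have : (mu E < mu E + e%:E)%E by rewrite lteDl// lte_fin.
rewrite {1}(haar_outer_regular hmu mE) => /ereal_inf_lt[_ [U [oU EU] <-] HU].
exists U; split => //; have mU := borel_open oU.
have Uf : (mu U < +oo)%E by apply: lt_le_trans HU (leey _).
rewrite measureD// (setIidr EU) leeBlDl//; exact: ltW.
Qed.

(** Inner regularity is only assumed for open sets: approximate [E] by an open set
    from outside and that one by a compact set from inside. *)
Lemma haar_inner_approx (E : set (borel G)) (e : R) : measurable E ->
  (mu E < +oo)%E -> 0 < e -> exists K,
  [/\ compact K, (mu (E `\` K) <= e%:E)%E & (mu (K `\` E) <= e%:E)%E].
Proof.
move=> mE Efin e0; have [U [oU EU UE]] := haar_outer_approx mE Efin e0.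
have mU := borel_open oU.
have Uf : (mu U < +oo)%E.
  rewrite -(setDUK EU); apply: le_lt_trans (measureU2 _ _ _) _ => //.
    exact: measurableD.
  by rewrite lte_add_pinfty//; apply: le_lt_trans UE (ltry _).
have Uff : mu U \is a fin_num by rewrite ge0_fin_numE.
have : (mu U - e%:E < mu U)%E by rewrite lteBlDr// lteDl// lte_fin.
rewrite {2}(haar_inner_regular hmu oU) => /ereal_sup_gt[_ [K [cK KU] <-] HK].
have mK := borel_compact cK.
exists K; split => //; last first.
  apply: le_trans UE; apply: le_measure; rewrite ?inE; [exact: measurableD|exact: measurableD|].
  exact: setSD.
apply: (@le_trans _ _ (mu (U `\` K))).
  by apply: le_measure; rewrite ?inE; [exact: measurableD|exact: measurableD|exact: setSD].
rewrite measureD// (setIidr KU).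
move: HK; rewrite lteBlDr// => /ltW H; rewrite leeBlDl// ge0_fin_numE//.
by apply: le_lt_trans Uf; apply: le_measure; rewrite ?inE.
Qed.

Lemma indic_rintegrable d (T : measurableType d) (nu : {measure set T -> \bar R})
  (E : set T) : measurable E -> (nu E < +oo)%E -> rintegrable nu \1_E.
Proof.
move=> mE Ef; apply/integrableP; split; first exact/measurable_EFinP.
under eq_integral => x _ do rewrite gee0_abs ?lee_fin//.
by rewrite integral_indic// setIT.
Qed.

Lemma Rintegral_indic d (T : measurableType d) (nu : {measure set T -> \bar R})
  (E : set T) : measurable E -> \int[nu]_x (\1_E x) = fine (nu E).
Proof. by move=> mE; rewrite /Rintegral integral_indic// setIT. Qed.

Lemma haar_tail (f : borel G -> R) (e : R) : rintegrable mu f -> (forall x, 0 <= f x) ->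
  0 < e -> exists2 K : set (borel G), compact K & \int[mu]_x (f x * \1_(~` K) x) <= e.
Proof.
move=> fi f0 e0; have mf := rintegrable_measurable fi.
have e2 : 0 < e / 2 by rewrite divr_gt0.
have [n Hn] := band_tail fi f0 e2; have [i1 H1] := Hn n (leqnn n).
set E := band f n in i1 H1; have mE : measurable E by exact: measurable_band.
have n0 : 0 < n.+1%:R :> R by rewrite ltr0n.
have [K [cK HK _]] := haar_inner_approx mE (band_lty n fi f0) (divr_gt0 e2 n0).
have mK := borel_compact cK.
have mEK : measurable (E `\` K) by exact: measurableD.
have EKf : (mu (E `\` K) < +oo)%E by apply: le_lt_trans HK (ltry _).
have i2 := rintegrableZ n.+1%:R (indic_rintegrable mEK EKf).
exists K => //.
apply: (@le_trans _ _ (\int[mu]_x (f x * \1_(~` E) x + n.+1%:R * \1_(E `\` K) x))).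
  apply: le_Rintegral => //.
  - apply: le_rintegrable fi.
      by apply: measurable_funM => //; apply: measurable_indic; exact: measurableC.
    move=> x; rewrite normrM ger0_norm// indicE; case: (_ \in _); rewrite ?normr1 ?normr0 ?mulr1//.
    by rewrite mulr0.
  - exact: rintegrableD.
  - move=> x _; rewrite !indicE !in_setC in_setD.
    have [xE|xE] := boolP (x \in E); have [xK|xK] := boolP (x \in K);
      rewrite /= ?mulr0 ?mulr1 ?addr0 ?add0r//.
    by move: xE; rewrite inE => /andP[].
rewrite RintegralD//.
rewrite RintegralZl//; last exact: indic_rintegrable.
rewrite Rintegral_indic// [leRHS]splitr lerD// mulrC -ler_pdivlMr//.
by rewrite -lee_fin fineK// ge0_fin_numE.
Qed.

Definition l1_continuous (g : borel G -> R) := rintegrable mu g /\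
  forall e : R, 0 < e -> \forall y \near (1%g : borel G),
    \int[mu]_x `|g (y^-1 * x)%g - g x| <= e.

Lemma rintegrable_mulgl (y : borel G) (g : borel G -> R) : rintegrable mu g ->
  rintegrable mu (fun x => g (y * x)%g).
Proof. by move=> ig; exact: (mp_rintegrable (mulgl_measure_preserving y) ig). Qed.

Lemma rintegrable_norm d (T : measurableType d) (nu : {measure set T -> \bar R})
  (g : T -> R) : rintegrable nu g -> rintegrable nu (fun x => `|g x|).
Proof. exact: integrable_norm. Qed.

Lemma Rintegral_mulgl (y : borel G) (g : borel G -> R) : rintegrable mu g ->
  \int[mu]_x g (y * x)%g = \int[mu]_x g x.
Proof. by move=> ig; exact: (mp_Rintegral (mulgl_measure_preserving y) ig). Qed.

Lemma l1_continuousD g h : l1_continuous g -> l1_continuous h ->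
  l1_continuous (fun x => g x + h x).
Proof.
move=> [ig gc] [ih hc]; split; first exact: rintegrableD.
move=> e e0; have e2 : 0 < e / 2 by rewrite divr_gt0.
near=> y.
have Hg : \int[mu]_x `|g (y^-1 * x)%g - g x| <= e / 2 by near: y; exact: gc.
have Hh : \int[mu]_x `|h (y^-1 * x)%g - h x| <= e / 2 by near: y; exact: hc.
have iy (k : borel G -> R) : rintegrable mu k ->
    rintegrable mu (fun x => `|k (y^-1 * x)%g - k x|).
  by move=> ik; apply/rintegrable_norm/rintegrableB => //; exact: rintegrable_mulgl.
rewrite [leRHS]splitr; apply: le_trans (lerD Hg Hh).
rewrite -RintegralD//; [|exact: iy|exact: iy].
apply: le_Rintegral => //; [by apply: (iy (fun x => g x + h x)); exact: rintegrableD| |].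
  by apply: rintegrableD; exact: iy.
by move=> x _; rewrite opprD addrACA; exact: ler_normD.
Unshelve. all: end_near. Qed.

Lemma l1_continuousZ (k : R) g : l1_continuous g -> l1_continuous (fun x => k * g x).
Proof.
move=> [ig gc]; split; first exact: rintegrableZ.
move=> e e0; have e2 : 0 < e / (`|k| + 1) by rewrite divr_gt0// ltr_wpDl.
apply: filterS (gc _ e2) => y Hy.
have iy : rintegrable mu (fun x => `|g (y^-1 * x)%g - g x|).
  by apply/rintegrable_norm/rintegrableB => //; exact: rintegrable_mulgl.
rewrite (_ : \int[mu]_x _ = `|k| * \int[mu]_x `|g (y^-1 * x)%g - g x|); last first.
  rewrite -RintegralZl//; congr fine; apply: eq_integral => x _.
  by rewrite -mulrBr normrM.
apply: le_trans (ler_wpM2l (normr_ge0 k) Hy) _.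
by rewrite mulrCA ler_piMr ?ltW// ltr_pdivrMr ?ltr_wpDl// mul1r ltrDl.
Qed.

Lemma l1_continuous_limit g : rintegrable mu g ->
  (forall e : R, 0 < e -> exists2 h, l1_continuous h & \int[mu]_x `|g x - h x| <= e) ->
  l1_continuous g.
Proof.
move=> ig H; split => // e e0; have e3 : 0 < e / 3 by rewrite divr_gt0.
have [h [ih hc] gh] := H _ e3.
apply: filterS (hc _ e3) => y Hy.
have igh : rintegrable mu (fun x => `|g x - h x|) by exact/rintegrable_norm/rintegrableB.
have ihh : rintegrable mu (fun x => `|h (y^-1 * x)%g - h x|).
  by apply/rintegrable_norm/rintegrableB => //; exact: rintegrable_mulgl.
have igy := rintegrable_mulgl y^-1%g igh.
have -> : e = e / 3 + e / 3 + e / 3 by field.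
apply: (@le_trans _ _ (\int[mu]_x (`|g (y^-1 * x)%g - h (y^-1 * x)%g| +
    `|h (y^-1 * x)%g - h x| + `|g x - h x|))).
  apply: le_Rintegral => //.
  - by apply/rintegrable_norm/rintegrableB => //; exact: rintegrable_mulgl.
  - by apply: rintegrableD => //; exact: rintegrableD.
  - move=> x _; rewrite (distrC (g x)).
    apply: le_trans (ler_distD (h x) _ _) _; rewrite lerD2r.
    exact: ler_distD.
rewrite RintegralD//; last exact: rintegrableD.
rewrite RintegralD//.
by rewrite (Rintegral_mulgl y^-1%g igh) !lerD.
Qed.

(** For compact [K], regularity confines both [y K] and [y^-1 K] to a slightly
    larger open set as soon as [y] is near the identity. *)
Lemma l1_continuous_compact (K : set (borel G)) : compact K -> l1_continuous \1_K.
Proof.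
move=> cK; have mK := borel_compact cK; have Kf := haar_compact hmu cK.
split; first exact: indic_rintegrable.
move=> e e0; have e2 : 0 < e / 2 by rewrite divr_gt0.
have [U [oU KU HU]] := haar_outer_approx mK Kf e2.
have mU := borel_open oU.
have near1 := @compact_mulgl_near (borel G) K U cK oU KU.
have near2 : \forall y \near (1%g : borel G), forall x, K x -> U (y^-1 * x)%g.
  have := @continuous_invg (borel G) 1%g; rewrite /continuous_at invg1 => H.
  exact: H near1.
apply: filterS2 near1 near2 => y H1 H2.
have mUK : measurable (U `\` K) by exact: measurableD.
have UKf : (mu (U `\` K) < +oo)%E by apply: le_lt_trans HU (ltry _).
have iUK := indic_rintegrable mUK UKf.
have iUKy := rintegrable_mulgl y^-1%g iUK.
apply: (@le_trans _ _ (\int[mu]_x (\1_(U `\` K) x + \1_(U `\` K) (y^-1 * x)%g))).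
  apply: le_Rintegral => //.
  - apply/rintegrable_norm/rintegrableB; last exact: indic_rintegrable.
    by apply: (rintegrable_mulgl y^-1%g); exact: indic_rintegrable.
  - exact: rintegrableD.
  move=> x _; rewrite !indicE !in_setD.
  have [xK|xK] := boolP (x \in K); have [yK|yK] := boolP ((y^-1 * x)%g \in K);
    rewrite /= ?andbF ?andbT ?subrr ?subr0 ?sub0r ?normr0 ?normrN ?normr1 ?add0r ?addr0//.
  - by rewrite (mem_set (H2 x _))//; move: xK; rewrite inE.
  - move: yK; rewrite inE => /H1; rewrite mulVKg => Ux.
    by rewrite (mem_set Ux).
rewrite RintegralD// (Rintegral_mulgl y^-1%g iUK) Rintegral_indic// [leRHS]splitr.
by rewrite lerD// -lee_fin fineK// ge0_fin_numE.
Qed.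

Lemma l1_continuous_indic (E : set (borel G)) : measurable E -> (mu E < +oo)%E ->
  l1_continuous \1_E.
Proof.
move=> mE Ef; apply: l1_continuous_limit; first exact: indic_rintegrable.
move=> e e0; have e2 : 0 < e / 2 by rewrite divr_gt0.
have [K [cK EK KE]] := haar_inner_approx mE Ef e2.
have mK := borel_compact cK.
exists \1_K; first exact: l1_continuous_compact.
have mEK : measurable (E `\` K) by exact: measurableD.
have mKE : measurable (K `\` E) by exact: measurableD.
have EKf : (mu (E `\` K) < +oo)%E by apply: le_lt_trans EK (ltry _).
have KEf : (mu (K `\` E) < +oo)%E by apply: le_lt_trans KE (ltry _).
rewrite (_ : \int[mu]_x _ = \int[mu]_x (\1_(E `\` K) x + \1_(K `\` E) x)); last first.
  congr fine; apply: eq_integral => x _; congr EFin; rewrite !indicE !in_setD.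
  have [xK|xK] := boolP (x \in K); have [xE|xE] := boolP (x \in E);
    by rewrite /= ?subrr ?subr0 ?sub0r ?normr0 ?normrN ?normr1 ?add0r ?addr0.
rewrite RintegralD//; [|exact: indic_rintegrable|exact: indic_rintegrable].
rewrite !Rintegral_indic// [leRHS]splitr lerD// -lee_fin fineK// ge0_fin_numE//.
Qed.

Import HBSimple.

Lemma l1_continuous_sfun (s : {sfun (borel G) >-> R}) : rintegrable mu s ->
  l1_continuous s.
Proof.
move=> si.
have mpre y : measurable (s @^-1` [set y]) by exact: measurable_sfunP.
have yf y : y != 0 -> (mu (s @^-1` [set y]) < +oo)%E.
  move=> y0; rewrite ltNge leye_eq; apply/negP => /eqP E.
  have [n Hn] : exists n, s @^-1` [set y] `<=` band (fun x => `|s x|) n.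
    have y0' : 0 < `|y| by rewrite normr_gt0.
    have [N _ HN] : \forall n \near \oo, n.+1%:R^-1 <= `|y|.
      have /cvgrPdist_le /(_ _ y0') := @cvg_harmonic R.
      apply: filterS => n; rewrite /= sub0r normrN; apply: le_trans; exact: ler_norm.
    exists (N + Num.truncn `|y|)%N => x /= sx; rewrite /band /= sx; apply/andP; split.
      by apply: HN; exact: leq_addr.
    have := truncnS_gt `|y| => /ltW/le_trans; apply.
    by rewrite ler_nat ltnS leq_addl.
  have nsi := rintegrable_norm si.
  have := band_lty n nsi (fun x => normr_ge0 _); apply/negP; rewrite -leNgt -E.
  apply: le_measure; rewrite ?inE//; apply: measurable_band.
  exact: rintegrable_measurable nsi.
have -> : (s : borel G -> R) = fun x => \sum_(y <- finmap.enum_fset (fset_set (range s)))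
    (y * \1_(s @^-1` [set y]) x).
  by apply/funext => x; rewrite fimfunE fsbig_finite.
elim: (finmap.enum_fset _) => [|y t IH].
  under eq_fun do rewrite big_nil; split; first exact: integrable0.
  move=> e e0; apply: nearW => z; under eq_Rintegral do rewrite subrr normr0.
  by rewrite /Rintegral integral0 ltW.
under eq_fun do rewrite big_cons; apply: l1_continuousD => //.
have [->|y0] := eqVneq y 0.
  under eq_fun do rewrite mul0r; split; first exact: integrable0.
  move=> e e0; apply: nearW => z; under eq_Rintegral do rewrite subrr normr0.
  by rewrite /Rintegral integral0 ltW.
by apply: l1_continuousZ; apply: l1_continuous_indic => //; exact: yf.
Qed.

(** Simple functions are dense, and the indicator of a set of finite measure is a limit
    of indicators of compact sets. *)
Lemma l1_continuousP (g : borel G -> R) : rintegrable mu g -> l1_continuous g.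
Proof.
move=> ig; apply: l1_continuous_limit => // e e0.
have [s [si _ sg]] := @approximation_sfun_integrable _ _ _ mu setT measurableT _ ig.
move: sg => /fine_cvgP[_] /cvgrPdist_le /(_ e e0)[N _ HN].
exists (s N); first by apply: l1_continuous_sfun; exact: si.
have := HN N (leqnn N); rewrite /= sub0r normrN; apply: le_trans.
exact: ler_norm.
Qed.

Lemma cLfun1_translation_continuous (g : borel G -> R[i]) (y0 : borel G) (e : R) :
  g \in cLfun mu 1 -> 0 < e -> \forall y \near y0,
    \int[mu]_x cabs (g (y^-1 * x)%g - g (y0^-1 * x)%g) <= e.
Proof.
move=> g1 e0; have /cLfun1P[rg jg] := g1.
have e2 : 0 < e / 2 by rewrite divr_gt0.
have [_ /(_ _ e2) Hr] := l1_continuousP rg; have [_ /(_ _ e2) Hj] := l1_continuousP jg.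
have y0y : (y0^-1 * y)%g @[y --> y0] --> (1%g : borel G).
  have := @continuous_mulgl (borel G) y0^-1%g y0.
  by rewrite /continuous_at mulVg.
near=> y.
have Hry : \int[mu]_x `|Re (g ((y0^-1 * y)^-1 * x)%g) - Re (g x)| <= e / 2.
  by near: y; exact: y0y Hr.
have Hjy : \int[mu]_x `|Im (g ((y0^-1 * y)^-1 * x)%g) - Im (g x)| <= e / 2.
  by near: y; exact: y0y Hj.
pose k x := g ((y0^-1 * y)^-1 * x)%g - g x.
have k1 : k \in cLfun mu 1.
  apply: cLfun1B => //; exact: (mp_cLfun1 (mulgl_measure_preserving _) g1).
have [_ ik] := (cLfun1_cabs _ _).1 k1.
have /cLfun1P[rk jk] := k1.
rewrite (_ : \int[mu]_x _ = \int[mu]_x cabs (k x)); last first.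
  rewrite -(Rintegral_mulgl y0^-1%g ik); congr fine; apply: eq_integral => x _.
  by rewrite /k invgM invgK -mulgA mulVKg.
rewrite [leRHS]splitr; apply: le_trans (lerD Hry Hjy).
rewrite (_ : \int[mu]_x `|Re _ - Re _| = \int[mu]_x `|Re (k x)|); last first.
  by congr fine; apply: eq_integral => x _; rewrite cReD cReN.
rewrite (_ : \int[mu]_x `|Im _ - Im _| = \int[mu]_x `|Im (k x)|); last first.
  by congr fine; apply: eq_integral => x _; rewrite cImD cImN.
rewrite -RintegralD//; [|exact: rintegrable_norm|exact: rintegrable_norm].
apply: le_Rintegral => //; first by apply: rintegrableD; exact: rintegrable_norm.
by move=> x _; exact: ler_cabs_ReIm.
Unshelve. all: end_near. Qed.

(** The left translation of a class by [y], the unitary [lambda_y]. *)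
Definition ltrans (y : borel G) (u : L2 mu) : L2 mu :=
  toL2 mu (fun x => L2repr u (y^-1 * x)%g).

Lemma ltrans_cL2 (y : borel G) (f : borel G -> R[i]) : f \in cL2fun mu ->
  (fun x => f (y^-1 * x)%g) \in cL2fun mu.
Proof. by move=> f2; exact: (mp_cL2 (mulgl_measure_preserving y^-1%g) f2). Qed.

Lemma ltrans_toL2 y f : f \in cL2fun mu ->
  ltrans y (toL2 mu f) = toL2 mu (fun x => f (y^-1 * x)%g).
Proof.
move=> f2; apply: eq_toL2; [by apply: ltrans_cL2; exact: L2repr_cL2|exact: ltrans_cL2|].
exact: (mp_ae (mulgl_measure_preserving y^-1%g) (L2repr_toL2 f2)).
Qed.

Lemma ltrans_linear y : linear (ltrans y).
Proof.
move=> a u v; rewrite -[u]toL2K -[v]toL2K -toL2_lin ?L2repr_cL2// !ltrans_toL2 ?L2repr_cL2//.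
  by rewrite toL2_lin//; apply: ltrans_cL2; exact: L2repr_cL2.
by apply: cL2_lin; exact: L2repr_cL2.
Qed.

Lemma ltransM y z u : ltrans y (ltrans z u) = ltrans (y * z)%g u.
Proof.
rewrite -[u]toL2K !ltrans_toL2 ?L2repr_cL2//; last by apply: ltrans_cL2; exact: L2repr_cL2.
by congr toL2; apply/funext => x; rewrite invgM mulgA.
Qed.

Lemma ltrans1 u : ltrans 1%g u = u.
Proof.
rewrite -[u in LHS]toL2K ltrans_toL2 ?L2repr_cL2// -[RHS]toL2K.
by congr toL2; apply/funext => x; rewrite invg1 mul1g.
Qed.

Lemma ltrans_dot y u v : L2dot (ltrans y u) (ltrans y v) = L2dot u v.
Proof.
rewrite L2dot_toL2; [|by apply: ltrans_cL2; exact: L2repr_cL2..].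
by apply: (mp_cintegral (mulgl_measure_preserving y^-1%g)); apply: cL2_mulJ; exact: L2repr_cL2.
Qed.

Lemma ltrans_adjoint y u v : L2dot (ltrans y u) v = L2dot u (ltrans y^-1%g v).
Proof. by rewrite -(ltrans_dot y u) ltransM mulgV ltrans1. Qed.

Lemma ltrans_norm y u : L2norm (ltrans y u) = L2norm u.
Proof. by rewrite /L2norm ltrans_dot. Qed.

Lemma regular_coefE (y : G) u v : @regular_coef R G mu y u v = L2dot (ltrans y u) v.
Proof.
have yu := ltrans_cL2 y (L2repr_cL2 u).
rewrite -[v in RHS]toL2K L2dot_toL2 ?L2repr_cL2//.
Qed.

End Haar.

(** * The reduced algebra *)

Section TruncateL2.
Context d (T : measurableType d) (R : realType).
Variable mu : {measure set T -> \bar R}.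

(** Cutting off the values which are too large or too small makes [u] bounded and
    integrable. *)
Lemma L2_truncate (u : L2 mu) (e : R) : 0 < e -> exists f : T -> R[i],
  [/\ f \in cL2fun mu, f \in cLfun mu 1, exists M : R, forall x, cabs (f x) <= M
    & L2norm (toL2 mu f - u) <= e].
Proof.
move=> e0; pose h x := cabs (L2repr u x) ^+ 2.
have [mu_ hi] := (cL2P _ _).1 (L2repr_cL2 u).
have h0 x : 0 <= h x by exact: sqr_ge0.
have [n Hn] := band_tail hi h0 (exprn_gt0 2 e0).
have [i1 H1] := Hn n (leqnn n); set B := band h n in i1 H1.
have mB : measurable B by apply: measurable_band; exact: rintegrable_measurable hi.
pose f x := L2repr u x * (\1_B x)%:C.
have mf : cmeasurable f.
  apply: cmeasurableM => //; split => /=; last exact: measurable_cst.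
  exact: measurable_indic.
have fh x : cabs (f x) ^+ 2 <= h x.
  rewrite cabsM cabsR indicE exprMn; case: (_ \in _); rewrite ?normr1 ?normr0 ?expr1n ?mulr1//.
  by rewrite expr0n mulr0.
have f2 : f \in cL2fun mu by exact: le_cL2 hi.
have fb x : cabs (f x) <= n.+2%:R * \1_B x.
  rewrite cabsM cabsR indicE; have [xB|_] := boolP (x \in B); last by rewrite normr0 !mulr0.
  rewrite normr1 !mulr1; move: xB; rewrite inE => /andP[_]; rewrite /h => H.
  rewrite -natr1; have := cabs_ge0 (L2repr u x); nra.
exists f; split => //.
- apply: le_cLfun1 fb _ => //; apply: rintegrableZ; apply: indic_rintegrable => //.
  exact: band_lty.
- exists n.+2%:R => x; apply: le_trans (fb x) _.
  by rewrite -[leRHS]mulr1 ler_wpM2l// indicE; case: (_ \in _).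
- rewrite -(@ler_pXn2r _ 2) ?nnegrE ?L2norm_ge0 ?(ltW e0)//.
  rewrite toL2B// sqr_L2norm_toL2; last by apply: cL2B => //; exact: L2repr_cL2.
  apply: le_trans H1; rewrite le_eqVlt; apply/orP; left; apply/eqP.
  congr fine; apply: eq_integral => x _; congr EFin.
  rewrite -[X in _ - X]mulr1 -mulrBr cabsM exprMn -/(h x); congr (_ * _).
  rewrite !indicE in_setC; case: (_ \in _) => /=.
    by rewrite !subrr !expr0n/= addr0 sqrtr0 expr0n.
  by rewrite sub0r subrr sqrrN expr1n expr0n addr0 sqrtr1 expr1n.
Qed.

End TruncateL2.

Section Coefficients.
Variables (R : realType) (G : topologicalGroupType).
Hypothesis hG : hausdorff_space G.
Variable mu : {measure set (borel G) -> \bar R}.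
Hypothesis hmu : left_haar mu.
Implicit Types (f g : borel G -> R[i]) (u v w : L2 mu) (S : L2 mu -> L2 mu).

Local Notation U := (@ltrans R G mu).

Lemma coef_le y u v : cabs (L2dot (U y u) v) <= L2norm u * L2norm v.
Proof. by apply: le_trans (cauchy_schwarz _ _) _; rewrite ltrans_norm. Qed.

(** The coefficient of bounded integrable functions is continuous in [y] since
    translation is continuous in L1; the general one is a limit of those. *)
Lemma measurable_coef u v : cmeasurable (fun y => L2dot (U y u) v).
Proof.
have /choice[fu Hu] : forall n : nat, exists f : borel G -> R[i],
  [/\ f \in cL2fun mu, f \in cLfun mu 1, exists M : R, forall x, cabs (f x) <= M
    & L2norm (toL2 mu f - u) <= n.+1%:R^-1].
  by move=> n; apply: L2_truncate; rewrite invr_gt0.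
have /choice[fv Hv] : forall n : nat, exists f : borel G -> R[i],
  [/\ f \in cL2fun mu, f \in cLfun mu 1, exists M : R, forall x, cabs (f x) <= M
    & L2norm (toL2 mu f - v) <= n.+1%:R^-1].
  by move=> n; apply: L2_truncate; rewrite invr_gt0.
pose c n y := L2dot (U y (toL2 mu (fu n))) (toL2 mu (fv n)).
have ccont n y0 (e : R) : 0 < e -> \forall y \near y0, cabs (c n y0 - c n y) <= e.
  move=> e0; have [u2 u1 _ _] := Hu n; have [v2 _ [M HM] _] := Hv n.
  have M0 : 0 <= M by apply: le_trans (HM 1%g); exact: cabs_ge0.
  have e1 : 0 < e / (M + 1) by rewrite divr_gt0// ltr_wpDl.
  apply: filterS (cLfun1_translation_continuous hG hmu y0 u1 e1) => y Hy.
  have cE z : c n z = cintegral mu (fun x => fu n (z^-1 * x)%g * (fv n x)^*).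
    by rewrite /c ltrans_toL2// L2dot_toL2//; exact: ltrans_cL2.
  have i1 z : (fun x => fu n (z^-1 * x)%g * (fv n x)^*) \in cLfun mu 1.
    by apply: cL2_mulJ => //; exact: ltrans_cL2.
  have id1 : (fun x => fu n (y^-1 * x)%g - fu n (y0^-1 * x)%g) \in cLfun mu 1.
    by apply: cLfun1B; exact: (mp_cLfun1 (mulgl_measure_preserving hmu _) u1).
  have [_ id2] := (cLfun1_cabs _ _).1 id1.
  rewrite -cabsN opprB !cE -cintegralB//.
  apply: le_trans (cabs_cintegral _) _; first exact: cLfun1B.
  apply: (@le_trans _ _ (\int[mu]_x (M * cabs (fu n (y^-1 * x)%g - fu n (y0^-1 * x)%g)))).
    apply: le_Rintegral => //.
    - by have [] := (cLfun1_cabs _ _).1 (cLfun1B (i1 y) (i1 y0)).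
    - exact: rintegrableZ.
    - by move=> x _; rewrite -mulrBl cabsM cabsJ mulrC ler_wpM2r ?cabs_ge0.
  rewrite RintegralZl//; apply: le_trans (ler_wpM2l M0 Hy) _.
  by rewrite mulrCA ler_piMr ?ltW// ltr_pdivrMr ?ltr_wpDl// mul1r ltrDl.
have mc n : cmeasurable (c n).
  split; apply: continuous_borelR => y0; apply/cvgrPdist_le => e e0;
    apply: filterS (ccont n y0 e e0) => y; apply: le_trans.
    by rewrite -cReN -cReD; exact: ler_Re_cabs.
  by rewrite -cImN -cImD; exact: ler_Im_cabs.
have clim y (e : R) : 0 < e ->
    \forall n \near \oo, cabs (L2dot (U y u) v - c n y) <= e.
  move=> e0; pose K := L2norm u + L2norm v + 1.
  have K0 : 0 < K by rewrite ltr_wpDl// addr_ge0 ?L2norm_ge0.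
  have eK : 0 < e / K by rewrite divr_gt0.
  have [N _ HN] : \forall n \near \oo, n.+1%:R^-1 <= Num.min 1 (e / K).
    have /cvgrPdist_le /(_ (Num.min 1 (e / K))) := @cvg_harmonic R.
    rewrite lt_min ltr01 eK => /(_ isT).
    apply: filterS => n; rewrite /= sub0r normrN; apply: le_trans; exact: ler_norm.
  exists N => // n /HN; rewrite le_min => /andP[n1 nK].
  have [_ _ _ un] := Hu n; have [_ _ _ vn] := Hv n.
  rewrite /c; set un' := toL2 mu (fu n) in un *; set vn' := toL2 mu (fv n) in vn *.
  have -> : L2dot (U y u) v - L2dot (U y un') vn' =
      - (L2dot (U y u) (vn' - v) + L2dot (U y (un' - u)) vn').
    rewrite (linB _ _ (ltrans_linear hmu y)) L2dotBr L2dotBl.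
    by ring.
  rewrite cabsN; apply: le_trans (cabsD _ _) _.
  have vn'1 : L2norm vn' <= L2norm v + 1.
    have := L2normD v (vn' - v); rewrite addrC subrK => /le_trans; apply.
    by rewrite lerD2l (le_trans vn).
  apply: le_trans (lerD (coef_le _ _ _) (coef_le _ _ _)) _.
  have -> : e = e / K * K by rewrite divfK// gt_eqF.
  rewrite {2}/K -addrA mulrDr lerD//.
    by rewrite mulrC ler_wpM2r ?L2norm_ge0// (le_trans vn).
  by rewrite ler_pM ?L2norm_ge0// (le_trans un).
split.
- apply: (@measurable_fun_cvg _ _ _ _ (fun n y => Re (c n y))).
    by move=> n; have [] := mc n.
  move=> y _; apply/cvgrPdist_le => e e0; apply: filterS (clim y e e0) => n.
  by apply: le_trans; rewrite -cReN -cReD; exact: ler_Re_cabs.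
- apply: (@measurable_fun_cvg _ _ _ _ (fun n y => Im (c n y))).
    by move=> n; have [] := mc n.
  move=> y _; apply/cvgrPdist_le => e e0; apply: filterS (clim y e e0) => n.
  by apply: le_trans; rewrite -cImN -cImD; exact: ler_Im_cabs.
Qed.

Lemma cLfun1_coefM f (s : borel G -> borel G) u v : f \in cLfun mu 1 ->
  continuous s -> (fun y => f y * L2dot (U (s y) u) v) \in cLfun mu 1.
Proof.
move=> f1 cs; have [mf fi] := (cLfun1_cabs _ _).1 f1.
have ms : measurable_fun setT s by exact: continuous_borel.
apply: (@le_cLfun1 _ _ _ _ _ (fun y => (L2norm u * L2norm v) * cabs (f y))).
- apply: cmeasurableM => //; have [mr mi] := measurable_coef u v.
  by split; [exact: (measurableT_comp mr ms)|exact: (measurableT_comp mi ms)].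
- by move=> y; rewrite cabsM mulrC ler_wpM2r ?cabs_ge0// coef_le.
- exact: rintegrableZ.
Qed.

Lemma cLfun1_coef f u v : f \in cLfun mu 1 ->
  (fun y => f y * L2dot (U y u) v) \in cLfun mu 1.
Proof. by move=> f1; apply: (cLfun1_coefM u v f1) => x; exact: cvg_id. Qed.

Lemma integrated_formP f S : integrated_form f S <-> bounded_operator S /\
  forall u v, L2dot (S u) v = cintegral mu (fun y => f y * L2dot (U y u) v).
Proof.
have E u v : (fun y => f y * @regular_coef R G mu y u v) = (fun y => f y * L2dot (U y u) v).
  by apply/funext => y; rewrite (regular_coefE hmu).
rewrite /integrated_form; split=> -[Sb H]; split=> [|u v]; try exact: Sb.
  by rewrite (H u v) (E u v).
by rewrite (H u v) (E u v).
Qed.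

Lemma opbound_weak S (M : R) : 0 <= M ->
  (forall u v, cabs (L2dot (S u) v) <= M * (L2norm u * L2norm v)) -> opbound S M.
Proof.
move=> M0 H u; apply: L2norm_le_dot; first by rewrite mulr_ge0 ?L2norm_ge0.
move=> v; rewrite -mulrA; apply: le_trans (H u v).
exact: le_trans (ler_norm _) (ler_Re_cabs _).
Qed.

Lemma wint_le f u v : f \in cLfun mu 1 ->
  cabs (cintegral mu (fun y => f y * L2dot (U y u) v)) <=
  (\int[mu]_x cabs (f x)) * (L2norm u * L2norm v).
Proof.
move=> f1; have [mf fi] := (cLfun1_cabs _ _).1 f1.
have cf := cLfun1_coef u v f1; have [_ cfi] := (cLfun1_cabs _ _).1 cf.
apply: le_trans (cabs_cintegral cf) _.
rewrite mulrC -RintegralZl//; apply: le_Rintegral => //; first exact: rintegrableZ.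
by move=> y _; rewrite cabsM mulrC ler_wpM2r ?cabs_ge0// coef_le.
Qed.

Lemma integrated_form_bound f S : f \in cLfun mu 1 -> integrated_form f S ->
  opbound S (\int[mu]_x cabs (f x)).
Proof.
move=> f1 /integrated_formP[Sb SE]; apply: opbound_weak.
  by apply: Rintegral_ge0 => x _; exact: cabs_ge0.
by move=> u v; rewrite SE; exact: wint_le.
Qed.

(** The weak integral exists by the Riesz representation theorem. *)
Lemma ex_integrated_form f : f \in cLfun mu 1 -> exists S, integrated_form f S.
Proof.
move=> f1; pose M := \int[mu]_x cabs (f x).
have M0 : 0 <= M by apply: Rintegral_ge0 => x _; exact: cabs_ge0.
have [|||S [Sl Sb SE]] := @riesz_sesquilinear _ _ _ mu
  (fun u v => cintegral mu (fun y => f y * L2dot (U y u) v)) M _ _ _ M0.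
- move=> a u v w; rewrite -cintegralZ ?cLfun1_coef// -cintegralD ?cLfun1Z ?cLfun1_coef//.
  congr cintegral; apply/funext => y.
  by rewrite (ltrans_linear hmu) L2dot_linl; ring.
- move=> a u v w; rewrite -cintegralZ ?cLfun1_coef// -cintegralD ?cLfun1Z ?cLfun1_coef//.
  congr cintegral; apply/funext => y.
  by rewrite L2dotDr L2dotZr; ring.
- by move=> u v; rewrite -mulrA; exact: wint_le.
by exists S; apply/integrated_formP; split => //; split => //; exists M.
Qed.

Lemma integrated_form_lin a f g S S' : f \in cLfun mu 1 -> g \in cLfun mu 1 ->
  integrated_form f S -> integrated_form g S' ->
  integrated_form (fun x => a * f x + g x) (a *: S + S').
Proof.
move=> f1 g1 /integrated_formP[Sb SE] /integrated_formP[Sb' SE'].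
apply/integrated_formP; split; first exact: bounded_lin.
move=> u v; rewrite L2dot_linl SE SE'.
rewrite -cintegralZ ?cLfun1_coef// -cintegralD ?cLfun1Z ?cLfun1_coef//.
by congr cintegral; apply/funext => y; ring.
Qed.

Lemma ltrans_bounded y : bounded_operator (U y).
Proof.
by split; [exact: ltrans_linear|exists 1 => u; rewrite ltrans_norm// mul1r].
Qed.

Lemma cLfun1_mulgl y g : g \in cLfun mu 1 -> (fun x => g (y * x)%g) \in cLfun mu 1.
Proof. by move=> g1; exact: (mp_cLfun1 (mulgl_measure_preserving hmu y) g1). Qed.

Lemma integrated_form_ltrans y g S : g \in cLfun mu 1 -> integrated_form g S ->
  integrated_form (fun x => g (y^-1 * x)%g) (U y \o S).
Proof.
move=> g1 /integrated_formP[Sb SE]; apply/integrated_formP; split.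
  by apply: bounded_comp => //; exact: ltrans_bounded.
move=> u v; rewrite -[(U y \o S) u]/(U y (S u)) (ltrans_adjoint hmu y) SE.
have H := cLfun1_coef u v (cLfun1_mulgl y^-1%g g1).
rewrite -(mp_cintegral (mulgl_measure_preserving hmu y) H).
congr cintegral; apply/funext => z /=.
by rewrite mulKg -(ltransM hmu y z) (ltrans_adjoint hmu y (U z u)).
Qed.

Local Notation L1op := (L1_operators mu).
Local Notation A := (reduced_algebra mu).

Lemma L1_operators_bounded : L1op `<=` bounded_operator (mu := mu).
Proof. by move=> S [f _ []]. Qed.

Lemma reduced_algebraP S : A S <-> bounded_operator S /\
  forall e : R, 0 < e -> exists2 S', L1op S' & opbound (S - S') e.
Proof. exact: (opclosureP S L1_operators_bounded). Qed.

Lemma reduced_algebra_bounded : A `<=` bounded_operator (mu := mu).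
Proof. by move=> S []. Qed.

Lemma L1_operators_lin a S S' : L1op S -> L1op S' -> L1op (a *: S + S').
Proof.
move=> [f f1 fS] [g g1 gS']; exists (fun x => a * f x + g x).
  by apply: cLfun1D => //; exact: cLfun1Z.
exact: integrated_form_lin.
Qed.

Lemma cLfun1_0 : (fun=> 0) \in cLfun mu 1.
Proof. by apply/cLfun1P; split; exact: integrable0. Qed.

Lemma cintegral0 d (T : measurableType d) (nu : {measure set T -> \bar R}) :
  cintegral nu (fun=> 0) = 0.
Proof. by apply: eq_ReIm; rewrite /= /Rintegral integral0. Qed.

Lemma L1_operators0 : L1op 0.
Proof.
exists (fun=> 0); first exact: cLfun1_0.
apply/integrated_formP; split; first exact: bounded0.
move=> u v; rewrite L2dot0l; under eq_fun do rewrite mul0r.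
by rewrite cintegral0.
Qed.

Lemma sub_L1_reduced : L1op `<=` A.
Proof.
move=> S LS; apply/reduced_algebraP; split; first exact: L1_operators_bounded.
move=> e e0; exists S => // u; rewrite subrr L2norm0 mulr_ge0 ?L2norm_ge0//.
exact: ltW.
Qed.

Lemma reduced_algebra0 : A 0.
Proof. by apply: sub_L1_reduced; exact: L1_operators0. Qed.

Lemma reduced_algebra_closed : opclosure A `<=` A.
Proof.
move=> S /(opclosureP _ reduced_algebra_bounded)[Sb HS].
apply/reduced_algebraP; split => // e e0; have e2 : 0 < e / 2 by rewrite divr_gt0.
have [S1 /reduced_algebraP[_ /(_ _ e2)[S2 LS2 H2]] H1] := HS _ e2.
exists S2 => //; rewrite [e]splitr; exact: opbound_tri H2.
Qed.

Lemma reduced_algebra_lin a S S' : A S -> A S' -> A (a *: S + S').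
Proof.
move=> /reduced_algebraP[Sb HS] /reduced_algebraP[Sb' HS'].
apply/reduced_algebraP; split; first exact: bounded_lin.
move=> e e0; have a0 : 0 < cabs a + 1 by rewrite ltr_wpDl ?cabs_ge0.
have e1 : 0 < e / (cabs a + 1) by rewrite divr_gt0.
have [S1 L1 H1] := HS _ e1; have [S2 L2 H2] := HS' _ e1.
exists (a *: S1 + S2); first exact: L1_operators_lin.
move=> u; rewrite -[(_ - _) u]/(a *: S u + S' u - (a *: S1 u + S2 u)).
rewrite opprD addrACA -scalerBr; apply: le_trans (L2normD _ _) _.
rewrite L2normZ; apply: le_trans (lerD (ler_wpM2l (cabs_ge0 _) (H1 u)) (H2 u)) _.
have E : e / (cabs a + 1) * (cabs a + 1) = e by rewrite divfK// gt_eqF.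
rewrite le_eqVlt; apply/orP; left; apply/eqP; rewrite -[in RHS]E; ring.
Qed.

Lemma cLfun1_restrict f (B : set (borel G)) : measurable B -> f \in cLfun mu 1 ->
  (fun x => f x * (\1_B x)%:C) \in cLfun mu 1.
Proof.
move=> mB /cLfun1_cabs[mf fi]; apply: le_cLfun1 fi.
  apply: cmeasurableM => //; split => /=; last exact: measurable_cst.
  exact: measurable_indic.
move=> x; rewrite cabsM cabsR indicE; case: (_ \in _); rewrite ?normr1 ?normr0 ?mulr1//.
by rewrite mulr0 cabs_ge0.
Qed.

Lemma L1_operators_ltrans y S : L1op S -> L1op (U y \o S).
Proof.
move=> [g g1 gS]; exists (fun x => g (y^-1 * x)%g); first exact: cLfun1_mulgl.
exact: integrated_form_ltrans.
Qed.

(** Averages of translates of an integrable function are approximated in norm by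
    finite linear combinations of them: [y |-> lambda_(s y) g] is continuous in
    L1, hence nearly constant on the pieces of a finite Borel partition of a
    compact set. *)
Lemma average_in_reduced f g (s : borel G -> borel G) S X : f \in cLfun mu 1 ->
  g \in cLfun mu 1 -> integrated_form g S -> continuous s -> bounded_operator X ->
  (forall u v, L2dot (X u) v = cintegral mu (fun y => f y * L2dot (U (s y) (S u)) v)) ->
  A X.
Proof.
move=> f1 g1 gS cs Xb XE; apply/reduced_algebraP; split => // e e0.
have [Sb _] := gS; have [M M0 SM] := bounded_opbound Sb.
have [mf fi] := (cLfun1_cabs _ _).1 f1.
pose F := \int[mu]_x cabs (f x).
have F0 : 0 <= F by apply: Rintegral_ge0 => x _; exact: cabs_ge0.
pose dl := e / 2 / (F + 1).
have dl0 : 0 < dl by rewrite !divr_gt0// ltr_wpDl.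
pose dM := e / 2 / (M + 1).
have dM0 : 0 < dM by rewrite !divr_gt0// ltr_wpDl.
have [K cK HK] := haar_tail hG hmu fi (fun x => cabs_ge0 _) dM0.
have mK := borel_compact hG cK.
pose near_piece y0 := [set y | \int[mu]_x cabs (g ((s y)^-1 * x)%g - g ((s y0)^-1 * x)%g) <= dl].
have /choice[V HV] : forall y0, exists V : set (borel G),
    [/\ open V, V y0 & V `<=` near_piece y0].
  move=> y0; have : nbhs y0 (near_piece y0).
    exact: cs (cLfun1_translation_continuous hG hmu (s y0) g1 dl0).
  by rewrite nbhsE => -[V [oV Vy] VP]; exists V.
pose fB (B : set (borel G)) y := f y * (\1_B y)%:C.
pose good (B : set (borel G)) := exists2 L, L1op L & forall u v,
  cabs (cintegral mu (fun y => fB B y * L2dot (U (s y) (S u)) v) - L2dot (L u) v) <=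
  dl * (\int[mu]_y (cabs (f y) * \1_B y)) * (L2norm u * L2norm v).
have ifB (B : set (borel G)) : measurable B -> rintegrable mu (fun y => cabs (f y) * \1_B y).
  move=> mB; have [_] := (cLfun1_cabs _ _).1 (cLfun1_restrict mB f1).
  by under eq_fun do rewrite cabsM cabsR (ger0_norm (_ : 0 <= \1_B _))//.
have piece y0 (B : set (borel G)) : measurable B -> B `<=` V y0 -> good B.
  move=> mB BO; have [_ _ VP] := HV y0.
  have fB1 : fB B \in cLfun mu 1 by exact: cLfun1_restrict.
  exists ((cintegral mu (fB B)) *: (U (s y0) \o S)).
    rewrite -[_ *: _]addr0; apply: L1_operators_lin; last exact: L1_operators0.
    by apply: L1_operators_ltrans; exists g.
  move=> u v; rewrite -[(_ *: _) u]/(_ *: U (s y0) (S u)) L2dotZl mulrC.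
  rewrite -cintegralZ//.
  have c1 := cLfun1_coefM (S u) v fB1 cs.
  rewrite -cintegralB//; last exact: cLfun1Z.
  have cB := cLfun1B c1 (cLfun1Z (L2dot (U (s y0) (S u)) v) fB1).
  apply: le_trans (cabs_cintegral cB) _.
  rewrite mulrAC -RintegralZl//; last exact: ifB.
  apply: le_Rintegral => //.
  - by have [_] := (cLfun1_cabs _ _).1 cB.
  - by apply: rintegrableZ; exact: ifB.
  move=> y _; rewrite [X in _ - X]mulrC -mulrBr cabsM /fB cabsM cabsR.
  rewrite (ger0_norm (_ : 0 <= \1_B y))// indicE.
  have [yB|_] := boolP (y \in B); last by rewrite !(mulr0, mul0r).
  rewrite !mulr1 mulrC ler_wpM2r ?cabs_ge0//.
  have Hy := VP y (BO y ltac:(by move: yB; rewrite inE)).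
  rewrite -L2dotBl.
  have iy := integrated_form_ltrans (s y) g1 gS.
  have iy0 := integrated_form_ltrans (s y0) g1 gS.
  have := integrated_form_lin (-1) (cLfun1_mulgl (s y0)^-1%g g1) (cLfun1_mulgl (s y)^-1%g g1) iy0 iy.
  have E1 : (fun x => -1 * g ((s y0)^-1 * x)%g + g ((s y)^-1 * x)%g) =
      (fun x => g ((s y)^-1 * x)%g - g ((s y0)^-1 * x)%g).
    by apply/funext => x; rewrite mulN1r addrC.
  rewrite E1 => H.
  have D1 := cLfun1B (cLfun1_mulgl (s y)^-1%g g1) (cLfun1_mulgl (s y0)^-1%g g1).
  have := opboundW Hy (integrated_form_bound D1 H) u.
  rewrite -[(_ + _) u]/(-1 *: U (s y0) (S u) + U (s y) (S u)) scaleN1r addrC => H'.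
  apply: le_trans (cauchy_schwarz _ _) _.
  by rewrite mulrA ler_wpM2r ?L2norm_ge0.
have goodU (B1 B2 : set (borel G)) : measurable B1 -> measurable B2 ->
    B1 `&` B2 = set0 -> good B1 -> good B2 -> good (B1 `|` B2).
  move=> mB1 mB2 B12 [L1 LL1 H1] [L2 LL2 H2]; exists (1 *: L1 + L2).
    exact: L1_operators_lin.
  have ind y : \1_(B1 `|` B2) y = \1_B1 y + \1_B2 y :> R.
    rewrite !indicE in_setU.
    have [y1|y1] := boolP (y \in B1); have [y2|y2] := boolP (y \in B2);
      rewrite /= ?addr0 ?add0r//.
    have : (B1 `&` B2) y by split; [move: y1|move: y2]; rewrite inE.
    by rewrite B12.
  move=> u v; rewrite -[(_ + _) u]/(1 *: L1 u + L2 u) scale1r L2dotDl.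
  rewrite (_ : (fun y => fB (B1 `|` B2) y * _) = (fun y =>
    fB B1 y * L2dot (U (s y) (S u)) v + fB B2 y * L2dot (U (s y) (S u)) v)); last first.
    by apply/funext => y; rewrite /fB ind rmorphD/= mulrDr mulrDl.
  rewrite cintegralD; [|apply: cLfun1_coefM => //; exact: cLfun1_restrict..].
  rewrite (_ : (\int[mu]_y (cabs (f y) * \1_(B1 `|` B2) y)) =
    (\int[mu]_y (cabs (f y) * \1_B1 y)) + (\int[mu]_y (cabs (f y) * \1_B2 y))); last first.
    rewrite -RintegralD//; [|exact: ifB..].
    by congr fine; apply: eq_integral => y _; rewrite ind mulrDr.
  rewrite opprD addrACA mulrDr mulrDl; apply: le_trans (cabsD _ _) _.
  exact: lerD.
have [sq Hsq] := compact_seq_cover cK (fun x => let: And3 o _ _ := HV x in o)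
  (fun x _ => let: And3 _ o _ := HV x in o).
have cover (t : seq (borel G)) (B : set (borel G)) : measurable B ->
    (forall y, B y -> exists2 x, x \in t & V x y) -> good B.
  elim: t B => [|x t IH] B mB HB.
    apply: (piece 1%g) => //; move=> y /HB[x]; by rewrite in_nil.
  have mO : measurable (V x) by apply: borel_open; have [] := HV x.
  have -> : B = (B `&` V x) `|` (B `\` V x) by rewrite setUIDK.
  apply: goodU; [exact: measurableI|exact: measurableD| | |].
  - by apply/seteqP; split=> // y [[_ Oy] [_ nOy]].
  - apply: (piece x); first exact: measurableI.
    by move=> y [].
  - apply: IH; first exact: measurableD.
    move=> y [By nOy]; have [z] := HB y By; rewrite inE => /predU1P[->//|zt Oz].
    by exists z.
have [L LL HL] := cover sq K mK Hsq.
exists L => //; apply: opbound_weak; first exact: ltW.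
move=> u v; rewrite -[(X - L) u]/(X u - L u) L2dotBl XE.
have mKc : measurable (~` K) by exact: measurableC.
rewrite (_ : (fun y => f y * _) = (fun y =>
    fB K y * L2dot (U (s y) (S u)) v + fB (~` K) y * L2dot (U (s y) (S u)) v)); last first.
  apply/funext => y; rewrite -mulrDl -mulrDr -rmorphD !indicE in_setC/=.
  by case: (_ \in _); rewrite /= ?addr0 ?add0r mulr1.
have fKc1 := cLfun1_restrict mKc f1.
rewrite cintegralD; [|apply: cLfun1_coefM => //; exact: cLfun1_restrict..].
rewrite addrAC; apply: le_trans (cabsD _ _) _.
rewrite [e]splitr mulrDl; apply: lerD.
  apply: le_trans (HL u v) _; rewrite ler_wpM2r ?mulr_ge0 ?L2norm_ge0//.
  rewrite /dl -mulrA ler_piMr ?divr_ge0 ?(ltW e0)//.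
  rewrite mulrC ler_pdivrMr ?ltr_wpDl// mul1r (@le_trans _ _ F)//; last by rewrite lerDl.
  apply: le_Rintegral => //; first exact: ifB.
  move=> y _; rewrite indicE; case: (_ \in _); rewrite ?mulr1 ?mulr0 ?cabs_ge0//.
have cc := cLfun1_coefM (S u) v fKc1 cs.
apply: le_trans (cabs_cintegral cc) _.
apply: (@le_trans _ _ (\int[mu]_y ((M * (L2norm u * L2norm v)) * (cabs (f y) * \1_(~` K) y)))).
  apply: le_Rintegral => //.
  - by have [_] := (cLfun1_cabs _ _).1 cc.
  - by apply: rintegrableZ; exact: ifB.
  move=> y _; rewrite /fB !cabsM cabsR (ger0_norm (_ : 0 <= \1_(~` K) y))//.
  rewrite mulrC ler_wpM2r ?mulr_ge0 ?cabs_ge0//.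
  by apply: le_trans (coef_le _ _ _) _; rewrite mulrA ler_wpM2r ?L2norm_ge0.
rewrite RintegralZl//; last exact: ifB.
rewrite mulrAC ler_wpM2r ?mulr_ge0 ?L2norm_ge0//.
apply: le_trans (ler_wpM2l M0 HK) _.
by rewrite /dM mulrCA ler_piMr ?divr_ge0 ?(ltW e0)// ler_pdivrMr ?ltr_wpDl// mul1r lerDl.
Qed.

(** [lambda(f) lambda(g)] is the average of [lambda_y lambda(g)] for the weight [f];
    this avoids convolution, which would require a measurable structure on [G * G]. *)
Lemma L1_operators_comp S S' : L1op S -> L1op S' -> A (S \o S').
Proof.
move=> [f f1 fS] [g g1 gS'].
have [Sb SE] := (integrated_formP _ _).1 fS; have [Sb' _] := gS'.
apply: (average_in_reduced (s := id) f1 g1 gS').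
- by move=> x; exact: cvg_id.
- exact: bounded_comp.
- by move=> u v; rewrite -[(S \o S') u]/(S (S' u)) SE.
Qed.

Lemma reduced_algebra_comp S S' : A S -> A S' -> A (S \o S').
Proof.
move=> AS AS'; apply: reduced_algebra_closed.
have [/reduced_algebraP[Sb HS] /reduced_algebraP[Sb' HS']] := (AS, AS').
apply/(opclosureP _ reduced_algebra_bounded); split; first exact: bounded_comp.
move=> e e0; have [M M0 SM] := bounded_opbound Sb.
have M1 : 0 < M + 1 by rewrite ltr_wpDl.
have e1 : 0 < e / 2 / (M + 1) by rewrite !divr_gt0.
have [S2 L2 H2] := HS' _ e1.
have [M' M0' SM'] := bounded_opbound (L1_operators_bounded L2).
have M1' : 0 < M' + 1 by rewrite ltr_wpDl.
have e2 : 0 < e / 2 / (M' + 1) by rewrite !divr_gt0.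
have [S1 L1 H1] := HS _ e2.
exists (S1 \o S2); first exact: L1_operators_comp.
move=> u; rewrite -[(_ - _) u]/(S (S' u) - S1 (S2 u)).
apply: le_trans (L2norm_tri _ (S (S2 u)) _) _.
rewrite -(linB _ _ Sb.1) [e]splitr mulrDl; apply: lerD.
  apply: le_trans (SM _) _; apply: le_trans (ler_wpM2l M0 (H2 u)) _.
  rewrite mulrA ler_wpM2r ?L2norm_ge0//.
  by rewrite mulrCA ler_piMr ?divr_ge0 ?(ltW e0)// ler_pdivrMr// mul1r lerDl.
apply: le_trans (H1 _) _; apply: le_trans (ler_wpM2l (ltW e2) (SM' u)) _.
rewrite mulrA ler_wpM2r ?L2norm_ge0//.
by rewrite mulrAC ler_pdivrMr// ler_wpM2l ?divr_ge0 ?(ltW e0)// lerDl.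
Qed.

Hypothesis lcG : locally_compact [set: borel G].

Lemma ex_compact_nbhs1 : exists2 C : set (borel G), compact C & nbhs (1%g : borel G) C.
Proof.
by have [C] := @lcG (1%g : borel G) I; rewrite withinET => C1 [cC _]; exists C.
Qed.

(** [lambda(f)^* lambda(e)] is an average of translates of [e], and it is close
    to [lambda(f)^*] when [e] is concentrated near the identity. *)
Lemma L1_operators_adjoint S : L1op S -> exists2 S', A S' & adjoint S S'.
Proof.
move=> [f f1 fS]; have [Sb SE] := (integrated_formP _ _).1 fS.
have [M M0 SM] := bounded_opbound Sb.
have [S' [S'l S'M SS']] := ex_adjoint Sb.1 SM M0.
have S'b : bounded_operator S' by split => //; exists M.
exists S' => //; apply: reduced_algebra_closed.
apply/(opclosureP _ reduced_algebra_bounded); split => // e e0.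
pose N := [set y : borel G | \int[mu]_x cabs (f (y^-1^-1 * x)%g - f x) <= e].
have N1 : nbhs (1%g : borel G) N.
  have H := cLfun1_translation_continuous hG hmu (1%g : borel G) f1 e0.
  have ci := @continuous_invg (borel G) 1%g; rewrite /continuous_at invg1 in ci.
  have H' : nbhs (1%g : borel G) [set y : borel G |
      \int[mu]_x cabs (f (y^-1^-1 * x)%g - f (1^-1 * x)%g) <= e] := ci _ H.
  by apply: filterS H' => y; rewrite /N /= invg1; under eq_Rintegral do rewrite mul1g.
have [C cC C1] := ex_compact_nbhs1.
have : nbhs (1%g : borel G) (N `&` C) by exact: filterI.
rewrite nbhsE => -[W [oW W1] WNC].
have mW := borel_open oW.
have Wf : (mu W < +oo)%E.
  apply: le_lt_trans (haar_compact hmu cC); apply: le_measure; rewrite ?inE//.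
    exact: borel_compact.
  by move=> y /WNC[].
have Wp := haar_open_gt0 hG hmu oW W1.
pose m := fine (mu W); have m0 : 0 < m by rewrite fine_gt0// Wp.
pose E (y : borel G) : R[i] := (m^-1 * \1_W y)%:C.
have iW := rintegrableZ m^-1 (indic_rintegrable mW Wf).
have E1 : E \in cLfun mu 1 by apply/cLfun1P; split => //=; exact: integrable0.
have intE : cintegral mu E = 1.
  apply: eq_ReIm => /=; last by rewrite /Rintegral integral0.
  by rewrite RintegralZl ?Rintegral_indic ?mulVf ?gt_eqF//; exact: indic_rintegrable.
have [S1 ES1] := ex_integrated_form E1.
have [S1b S1E] := (integrated_formP _ _).1 ES1.
exists (S' \o S1).
  apply: (average_in_reduced (s := fun y => y^-1%g) (cLfun1J f1) E1 ES1).
  - exact: continuous_invg.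
  - exact: bounded_comp.
  move=> u v; rewrite -[(S' \o S1) u]/(S' (S1 u)) (adjointC SS') L2dotC SE -cintegralJ; last first.
    exact: cLfun1_coef.
  congr cintegral; apply/funext => y; rewrite cconjM -L2dotC; congr (_ * _).
  by rewrite (ltrans_adjoint hmu y^-1%g) invgK.
apply: opbound_weak; first exact: ltW.
move=> u v; rewrite -[(S' - _) u]/(S' u - S' (S1 u)) L2dotBl !(adjointC SS').
rewrite [X in X - _](_ : _ = cintegral mu (fun y => E y * L2dot u (S v))); last first.
  under eq_fun do rewrite mulrC.
  by rewrite cintegralZ// intE mulr1.
rewrite S1E -cintegralB; last 2 first.
- by under eq_fun do rewrite mulrC; exact: cLfun1Z.
- exact: cLfun1_coef.
have c1 : (fun y => E y * L2dot u (S v) - E y * L2dot (U y u) (S v)) \in cLfun mu 1.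
  apply: cLfun1B; last exact: cLfun1_coef.
  by under eq_fun do rewrite mulrC; exact: cLfun1Z.
apply: le_trans (cabs_cintegral c1) _.
apply: (@le_trans _ _ (\int[mu]_y ((e * (L2norm u * L2norm v)) * (m^-1 * \1_W y)))).
  apply: le_Rintegral => //.
  - by have [_] := (cLfun1_cabs _ _).1 c1.
  - exact: rintegrableZ.
  move=> y _; rewrite -mulrBr cabsM cabsR ger0_norm ?mulr_ge0 ?invr_ge0 ?(ltW m0)//.
  rewrite indicE; have [yW|_] := boolP (y \in W); last by rewrite !(mulr0, mul0r).
  rewrite mulrC ler_wpM2r ?mulr_ge0 ?invr_ge0 ?(ltW m0)//.
  have [Ny _] := WNC y ltac:(by move: yW; rewrite inE).
  rewrite (ltrans_adjoint hmu y) -L2dotBr.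
  have iy := integrated_form_ltrans y^-1%g f1 fS.
  have := integrated_form_lin (-1) f1 (cLfun1_mulgl (y^-1)^-1%g f1) fS iy.
  have E2 : (fun x => -1 * f x + f ((y^-1)^-1 * x)%g) = (fun x => f ((y^-1)^-1 * x)%g - f x).
    by apply/funext => x; rewrite mulN1r addrC.
  rewrite E2 => H.
  have D1 := cLfun1B (cLfun1_mulgl (y^-1)^-1%g f1) f1.
  have := opboundW Ny (integrated_form_bound D1 H) v.
  rewrite -[(_ + _) v]/(-1 *: S v + U y^-1%g (S v)) scaleN1r addrC L2normBC => H'.
  apply: le_trans (cauchy_schwarz _ _) _.
  by rewrite mulrCA ler_wpM2l ?L2norm_ge0.
rewrite RintegralZl// RintegralZl ?Rintegral_indic//; last exact: indic_rintegrable.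
by rewrite mulVf ?gt_eqF// mulr1.
Qed.

Lemma reduced_algebra_adjoint S : A S -> exists2 S', A S' & adjoint S S'.
Proof.
move=> /reduced_algebraP[Sb HS]; have [M M0 SM] := bounded_opbound Sb.
have [S' [S'l S'M SS']] := ex_adjoint Sb.1 SM M0.
exists S' => //; apply: reduced_algebra_closed.
apply/(opclosureP _ reduced_algebra_bounded); split; first by split => //; exists M.
move=> e e0; have [S1 L1 H1] := HS e e0.
have [S2 A2 H2] := L1_operators_adjoint L1.
exists S2 => // u; apply: L2norm_le_dot; first by rewrite mulr_ge0 ?L2norm_ge0 ?ltW.
move=> v; rewrite -[(S' - S2) u]/(S' u - S2 u) L2dotBl (adjointC SS') (adjointC H2) -L2dotBr.
apply: le_trans (Re_L2dot_le _ _) _.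
by rewrite (mulrC e) -mulrA ler_wpM2l ?L2norm_ge0//; exact: H1.
Qed.

End Coefficients.

(** * Uniqueness of Haar measure *)

(** On the one-point compactification, which is normal, Urysohn's lemma separates
    [K] from the complement of [U]; cutting off below [1/2] makes the support
    compact. *)
Lemma compact_bump (R : realType) (X : topologicalType) (K U : set X) :
  hausdorff_space X -> locally_compact [set: X] -> compact K -> open U -> K `<=` U ->
  exists f : X -> R, [/\ continuous f, forall x, 0 <= f x <= 1, forall x, K x -> f x = 1 &
    exists2 C, compact C & forall x, f x != 0 -> U x /\ C x].
Proof.
move=> hX lX cK oU KU; pose opc := one_point_compactification X.
have hopc : hausdorff_space opc := one_point_compactification_hausdorff lX hX.
have nT := compact_normal hopc (@one_point_compactification_compact X).
have clB : closed (Some @` K : set opc).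
  apply: compact_closed => //; apply: compact_image cK.
  exact: one_point_compactification_some_continuous.
have clA : closed (~` (Some @` U : set opc)).
  by apply: open_closedC; exact: one_point_compactification_open_some.
have AB : ~` (Some @` U : set opc) `&` (Some @` K) = set0.
  by apply/seteqP; split => // y [nU [x Kx xy]]; apply: nU; exists x => //; exact: KU.
have [g [cg g01 gA gB]] := (uniform_separatorP (R := R) _ _).1 (normal_uniform_separator nT clA clB AB).
have g01' y : 0 <= g y <= 1 by have := g01 (g y); rewrite /= in_itv/=; apply; exists y.
have gN : g None = 0 by apply: gA; exists None => // -[].
exists (fun x => Num.max 0 (2 * g (Some x) - 1)); split.
- move=> x; apply: (@continuous_max R X (fun=> 0) (fun x => 2 * g (Some x) - 1) x).
    exact: cvg_cst.
  apply: cvgB; last exact: cvg_cst.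
  apply: cvgM; first exact: cvg_cst.
  by apply: (@continuous_comp X opc R Some g x); [exact: one_point_compactification_some_continuous|exact: cg].
- move=> x; have /andP[g0 g1] := g01' (Some x).
  by rewrite le_max lexx/= ge_max ler01/=; lra.
- move=> x Kx; have -> : g (Some x) = 1 by apply: gB; exists (Some x) => //; exists x.
  by rewrite mulr1 addrK; apply/max_idPr.
have : nbhs (None : opc) [set y | g y < 2^-1].
  have H : \forall r \near (0 : R), r < 2^-1 by apply: lt_nbhsl; rewrite invr_gt0.
  by have := cg None; rewrite /continuous_at gN => /(_ _ H).
move=> [C [cC _] HC]; exists C => // x.
have [gx|gx] := ltP (g (Some x)) 2^-1.
  have -> : Num.max 0 (2 * g (Some x) - 1) = 0; last by rewrite eqxx.
  by apply/max_idPl; rewrite subr_le0 mulrC -ler_pdivlMr// mul1r ltW.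
move=> _; split.
  apply: contrapT => nU; move: gx; rewrite (_ : g (Some x) = 0); first by rewrite leNgt invr_gt0 ltr0n.
  by apply: gA; exists (Some x) => // -[z Uz [zx]]; apply: nU; rewrite -zx.
apply: contrapT => nC; have := HC (Some x); rewrite /= ltNge gx => H.
by have := H (or_introl (ex_intro2 _ _ x nC erefl)).
Qed.

Lemma Rintegral_abs_le d (T : measurableType d) (R : realType)
  (nu : {measure set T -> \bar R}) (f h : T -> R) : measurable_fun setT f ->
  (forall x, `|f x| <= h x) -> rintegrable nu h -> `|\int[nu]_x f x| <= \int[nu]_x h x.
Proof.
move=> mf fh ih; have fi := le_rintegrable mf fh ih.
apply: le_trans (le_normr_Rintegral _ fi) _ => //.
by apply: le_Rintegral => //; exact: rintegrable_norm.
Qed.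

Lemma indic_ge0 (R : realType) (T : Type) (A : set T) x : 0 <= \1_A x :> R.
Proof. by rewrite indicE. Qed.

Lemma indic_le1 (R : realType) (T : Type) (A : set T) x : \1_A x <= 1 :> R.
Proof. by rewrite indicE; case: (_ \in _). Qed.

Section IteratedIntegrals.
Variables (R : realType) (G : topologicalGroupType).
Hypothesis hG : hausdorff_space G.

Section Tube.
Variables (F : borel G -> borel G -> R) (K1 K2 : set (borel G)).
Hypothesis cF : continuous (fun z : borel G * borel G => F z.1 z.2).
Hypotheses (cK1 : compact K1) (cK2 : compact K2).
Hypothesis FK : forall x y, `|F x y| <= \1_K1 x * \1_K2 y.

(** The tube lemma, with the support taken into account. *)
Lemma section_tube x0 (e : R) : 0 < e ->
  \forall x \near x0, forall y, `|F x y - F x0 y| <= e * \1_K2 y.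
Proof.
move=> e0; have /compact_near_coveringP H := cK2.
have : \forall x \near x0, forall y, K2 y -> `|F x y - F x0 y| <= e.
  apply: (H (borel G) (nbhs x0) (fun x y => `|F x y - F x0 y| <= e)) => y _.
  have e2 : 0 < e / 2 by rewrite divr_gt0.
  have /cvgrPdist_le/(_ _ e2)[[A B] /= [Ax By] AB] := @cF (x0, y).
  exists (B, A) => // -[y' x] /= [By' Ax'].
  have H1 := AB (x, y') (conj Ax' By'); have H2 := AB (x0, y') (conj (nbhs_singleton Ax) By').
  rewrite /= in H1 H2.
  rewrite [e]splitr (_ : _ - _ = - (F x0 y - F x y') + (F x0 y - F x0 y')); last by lra.
  by apply: le_trans (ler_normD _ _) _; rewrite normrN; exact: lerD.
apply: filterS => x Hx y; rewrite indicE.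
have [yK|yK] := boolP (y \in K2); first by rewrite mulr1; apply: Hx; move: yK; rewrite inE.
have F0 z : F z y = 0.
  by apply/eqP; rewrite -normr_le0; apply: le_trans (FK _ _) _; rewrite !indicE (negPf yK) mulr0.
by rewrite !F0 subrr normr0 mulr0.
Qed.

Lemma continuous_section x : continuous (F x).
Proof.
move=> y; apply: (@continuous_comp _ _ _ (fun y => (x, y)) (fun z : borel G * borel G => F z.1 z.2)).
  by apply: cvg_pair; [exact: cvg_cst|exact: cvg_id].
exact: cF.
Qed.

Variable nu : {measure set (borel G) -> \bar R}.
Hypothesis hnu : left_haar nu.

Let iK2 : rintegrable nu \1_K2.
Proof. by apply: indic_rintegrable; [exact: borel_compact|exact: haar_compact]. Qed.

Lemma section_rintegrable x : rintegrable nu (F x).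
Proof.
apply: le_rintegrable iK2; first by apply: continuous_borelR; exact: continuous_section.
by move=> y; apply: le_trans (FK _ _) _; rewrite ler_piMl ?indic_ge0 ?indic_le1.
Qed.

Lemma section_integral_continuous : continuous (fun x => \int[nu]_y F x y).
Proof.
move=> x0; apply/cvgrPdist_le => e e0.
pose n := fine (nu K2); have n0 : 0 < n + 1 by rewrite ltr_wpDl// fine_ge0.
have := section_tube x0 (divr_gt0 e0 n0).
apply: filterS => x Hx; rewrite -RintegralB//; [|exact: section_rintegrable..].
apply: le_trans (Rintegral_abs_le (h := fun y => e / (n + 1) * \1_K2 y) _ _ _) _.
- by apply: rintegrable_measurable; apply: rintegrableB; exact: section_rintegrable.
- by move=> y; rewrite distrC.
- exact: rintegrableZ.
rewrite RintegralZl// Rintegral_indic; last exact: borel_compact.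
by rewrite mulrAC ler_pdivrMr// ler_wpM2l ?(ltW e0)// lerDl.
Qed.

Lemma section_integral_le x : `|\int[nu]_y F x y| <= fine (nu K2) * \1_K1 x.
Proof.
apply: le_trans (Rintegral_abs_le (h := fun y => \1_K1 x * \1_K2 y) _ _ _) _.
- by apply: rintegrable_measurable; exact: section_rintegrable.
- by move=> y; exact: FK.
- exact: rintegrableZ.
by rewrite RintegralZl// Rintegral_indic 1?mulrC//; exact: borel_compact.
Qed.

Lemma section_integral_rintegrable (mu : {measure set (borel G) -> \bar R}) :
  left_haar mu -> rintegrable mu (fun x => \int[nu]_y F x y).
Proof.
move=> hmu; apply: le_rintegrable; first exact: (continuous_borelR section_integral_continuous).
  exact: section_integral_le.
apply: rintegrableZ; apply: indic_rintegrable; first exact: borel_compact.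
exact: haar_compact.
Qed.

End Tube.

Variables mu nu : {measure set (borel G) -> \bar R}.
Hypotheses (hmu : left_haar mu) (hnu : left_haar nu).

(** Fubini's theorem for compactly supported continuous functions. Such a function
    is almost constant in [x] on the pieces of a finite Borel partition,
    uniformly in [y]; for functions which are constant in [x] on each piece the
    two iterated integrals agree. *)
Lemma fubini_continuous (F : borel G -> borel G -> R) (K1 K2 : set (borel G)) :
  continuous (fun z : borel G * borel G => F z.1 z.2) -> compact K1 -> compact K2 ->
  (forall x y, `|F x y| <= \1_K1 x * \1_K2 y) ->
  \int[mu]_x \int[nu]_y F x y = \int[nu]_y \int[mu]_x F x y.
Proof.
move=> cF cK1 cK2 FK.
have mK1 := borel_compact hG cK1; have mK2 := borel_compact hG cK2.
have cF' : continuous (fun z : borel G * borel G => F z.2 z.1).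
  move=> z; apply: (@continuous_comp _ _ _ (fun z => (z.2, z.1)) (fun z : borel G * borel G => F z.1 z.2)).
    by apply: cvg_pair; [exact: cvg_snd|exact: cvg_fst].
  exact: cF.
have FK' y x : `|F x y| <= \1_K2 y * \1_K1 x by rewrite mulrC.
pose n := fine (nu K2); pose m B := fine (mu (B `&` K1)).
have n0 : 0 <= n by rewrite fine_ge0.
have m0 B : 0 <= m B by rewrite fine_ge0.
have fK1 := haar_compact hmu cK1.
have iB (B : set (borel G)) : measurable B -> rintegrable mu \1_(B `&` K1).
  move=> mB; apply: indic_rintegrable; first exact: measurableI.
  by apply: le_lt_trans fK1; apply: le_measure; rewrite ?inE//; exact: measurableI.
have iK2 : rintegrable nu \1_K2 by apply: indic_rintegrable => //; exact: haar_compact.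
pose Phi x := \int[nu]_y F x y.
have iPhi : rintegrable mu Phi := section_integral_rintegrable cF cK1 cK2 FK hnu hmu.
pose FB (B : set (borel G)) x y := \1_(B `&` K1) x * F x y.
have FBle B x y : `|FB B x y| <= \1_(B `&` K1) x * \1_K2 y.
  rewrite /FB normrM ger0_norm ?indic_ge0// ler_wpM2l ?indic_ge0//.
  by apply: le_trans (FK _ _) _; rewrite ler_piMl ?indic_ge0 ?indic_le1.
have iF y : rintegrable mu (fun x => F x y).
  exact: (section_rintegrable (F := fun y x => F x y) cF' cK1 FK' hmu y).
have iFB B y : measurable B -> rintegrable mu (FB B ^~ y).
  move=> mB; apply: le_rintegrable (FBle B ^~ y) _; last first.
    by under eq_fun do rewrite mulrC; apply: rintegrableZ; exact: iB.
  apply: measurable_funM; last exact: rintegrable_measurable.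
  by apply: rintegrable_measurable; exact: iB.
pose Psi B y := \int[mu]_x FB B x y.
have Psi_le B y : measurable B -> `|Psi B y| <= m B * \1_K2 y.
  move=> mB; apply: le_trans (Rintegral_abs_le (h := fun x => \1_K2 y * \1_(B `&` K1) x) _ _ _) _.
  - by apply: rintegrable_measurable; exact: iFB.
  - by move=> x; rewrite mulrC.
  - by apply: rintegrableZ; exact: iB.
  by rewrite RintegralZl ?Rintegral_indic 1?mulrC//; [exact: measurableI|exact: iB].
have iPsi B : measurable B -> rintegrable nu (Psi B).
  move=> mB; apply: le_rintegrable (Psi_le B ^~ mB) _; last exact: rintegrableZ.
  apply: continuous_borelR => y0; apply/cvgrPdist_le => e e0.
  have m1 : 0 < m setT + 1 by rewrite ltr_wpDl.
  have := section_tube cF' cK1 FK' y0 (divr_gt0 e0 m1).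
  apply: filterS => y Hy; rewrite -RintegralB//; [|exact: iFB..].
  apply: le_trans (Rintegral_abs_le (h := fun x => e / (m setT + 1) * \1_(setT `&` K1) x) _ _ _) _.
  - by apply: rintegrable_measurable; apply: rintegrableB; exact: iFB.
  - move=> x; rewrite distrC /FB -mulrBr normrM ger0_norm ?indic_ge0// setTI.
    apply: le_trans (ler_wpM2l (indic_ge0 _ _ _) (Hy x)) _.
    by rewrite ler_piMl ?indic_le1// mulr_ge0 ?indic_ge0// divr_ge0 ?(ltW e0)// (ltW m1).
  - by apply: rintegrableZ; exact: iB.
  rewrite RintegralZl ?Rintegral_indic//; [|exact: measurableI|exact: iB].
  by rewrite -/(m setT) mulrAC ler_pdivrMr// ler_wpM2l ?(ltW e0)// lerDl.
have PhiB_int B : measurable B -> rintegrable mu (fun x => \1_(B `&` K1) x * Phi x).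
  move=> mB; apply: (le_rintegrable (h' := fun x => `|Phi x|)); last exact: rintegrable_norm.
    apply: measurable_funM; last exact: (rintegrable_measurable iPhi).
    exact: (rintegrable_measurable (iB B mB)).
  by move=> x; rewrite normrM ger0_norm ?indic_ge0// ler_piMl ?indic_le1.
suff H (e : R) : 0 < e -> `|\int[mu]_x Phi x - \int[nu]_y \int[mu]_x F x y| <= 2 * e * (m setT * n).
  apply/eqP; rewrite -subr_eq0 -normr_le0; apply/ler_addgt0Pr => /= e e0; rewrite add0r.
  have d0 : 0 < 2 * (m setT * n) + 1 by rewrite ltr_wpDl// !mulr_ge0.
  apply: le_trans (H _ (divr_gt0 e0 d0)) _.
  move: (m setT * n) d0 => X d0.
  rewrite (_ : 2 * (e / (2 * X + 1)) * X = 2 * X * e / (2 * X + 1)); last by ring.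
  by rewrite ler_pdivrMr// mulrC ler_wpM2l ?(ltW e0)// lerDl.
move=> e0.
have /choice[V HV] : forall x0, exists V : set (borel G),
    [/\ open V, V x0 & V `<=` [set x | forall y, `|F x y - F x0 y| <= e * \1_K2 y]].
  move=> x0; have : nbhs x0 [set x | forall y, `|F x y - F x0 y| <= e * \1_K2 y].
    exact: (section_tube cF cK2 FK x0 e0).
  rewrite nbhsE => -[V [oV Vx] VP].
  by exists V.
pose good B := `|\int[mu]_x (\1_(B `&` K1) x * Phi x) - \int[nu]_y Psi B y| <= 2 * e * (m B * n).
have piece x0 B : measurable B -> B `<=` V x0 -> good B.
  move=> mB BV; have [_ _ VP] := HV x0; rewrite /good.
  rewrite -(subrK (m B * Phi x0) (\int[mu]_x _)) -addrA.
  apply: le_trans (ler_normD _ _) _.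
  rewrite (_ : 2 * e * (m B * n) = m B * (e * n) + (e * m B) * n); last by ring.
  apply: lerD.
    have -> : m B * Phi x0 = \int[mu]_x (Phi x0 * \1_(B `&` K1) x).
      by rewrite RintegralZl ?Rintegral_indic 1?mulrC//; [exact: measurableI|exact: iB].
    have iPB : rintegrable mu (fun x => Phi x0 * \1_(B `&` K1) x) by apply: rintegrableZ; exact: iB.
    rewrite -RintegralB//; last exact: PhiB_int.
    apply: le_trans (Rintegral_abs_le (h := fun x => (e * n) * \1_(B `&` K1) x) _ _ _) _.
    - exact: (rintegrable_measurable (rintegrableB (PhiB_int B mB) iPB)).
    - move=> x; rewrite [Phi x0 * _]mulrC -mulrBr normrM ger0_norm ?indic_ge0// mulrC.
      rewrite indicE; have [|_] := boolP (x \in _); last by rewrite !mulr0.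
      rewrite inE !mulr1 => -[Bx _].
      have [s1 s2] : rintegrable nu (F x) /\ rintegrable nu (F x0).
        by split; exact: (section_rintegrable cF cK2 FK hnu).
      rewrite /Phi -RintegralB//.
      apply: le_trans (Rintegral_abs_le (h := fun y => e * \1_K2 y) _ _ _) _.
      + exact: (rintegrable_measurable (rintegrableB s1 s2)).
      + exact: (VP x (BV x Bx)).
      + exact: rintegrableZ.
      by rewrite RintegralZl// Rintegral_indic.
    - by apply: rintegrableZ; exact: iB.
    by rewrite RintegralZl ?Rintegral_indic 1?mulrC//; [exact: measurableI|exact: iB].
  have s0 : rintegrable nu (F x0) by exact: (section_rintegrable cF cK2 FK hnu).
  rewrite /Phi -RintegralZl// -RintegralB//; [|exact: rintegrableZ|exact: iPsi].
  apply: le_trans (Rintegral_abs_le (h := fun y => (e * m B) * \1_K2 y) _ _ _) _.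
  - exact: (rintegrable_measurable (rintegrableB (rintegrableZ (m B) s0) (iPsi B mB))).
  - move=> y; have -> : m B * F x0 y = \int[mu]_x (F x0 y * \1_(B `&` K1) x).
      by rewrite RintegralZl ?Rintegral_indic 1?mulrC//; [exact: measurableI|exact: iB].
    have iPB : rintegrable mu (fun x => F x0 y * \1_(B `&` K1) x) by apply: rintegrableZ; exact: iB.
    rewrite -RintegralB//; last exact: iFB.
    apply: le_trans (Rintegral_abs_le (h := fun x => (e * \1_K2 y) * \1_(B `&` K1) x) _ _ _) _.
    + exact: (rintegrable_measurable (rintegrableB iPB (iFB B y mB))).
    + move=> x; rewrite distrC [F x0 y * _]mulrC -mulrBr normrM ger0_norm ?indic_ge0// mulrC.
      rewrite indicE; have [|_] := boolP (x \in _); last by rewrite !mulr0.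
      by rewrite inE !mulr1 => -[Bx _]; exact: (VP x (BV x Bx)).
    + by apply: rintegrableZ; exact: iB.
    by rewrite RintegralZl ?Rintegral_indic 1?mulrAC//; [exact: measurableI|exact: iB].
  - exact: rintegrableZ.
  by rewrite RintegralZl// Rintegral_indic.
have goodU B1 B2 : measurable B1 -> measurable B2 -> B1 `&` B2 = set0 ->
    good B1 -> good B2 -> good (B1 `|` B2).
  move=> mB1 mB2 B12; rewrite /good => H1 H2.
  have ind x : \1_((B1 `|` B2) `&` K1) x = \1_(B1 `&` K1) x + \1_(B2 `&` K1) x :> R.
    rewrite !indicE !in_setI in_setU.
    have [y1|y1] := boolP (x \in B1); have [y2|y2] := boolP (x \in B2);
      rewrite /= ?addr0 ?add0r//.
    have : (B1 `&` B2) x by split; [move: y1|move: y2]; rewrite inE.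
    by rewrite B12.
  have -> : \int[mu]_x (\1_((B1 `|` B2) `&` K1) x * Phi x) =
     \int[mu]_x (\1_(B1 `&` K1) x * Phi x) + \int[mu]_x (\1_(B2 `&` K1) x * Phi x).
    rewrite -RintegralD//; [|exact: PhiB_int..].
    by congr fine; apply: eq_integral => x _; rewrite ind mulrDl.
  have -> : \int[nu]_y Psi (B1 `|` B2) y = \int[nu]_y Psi B1 y + \int[nu]_y Psi B2 y.
    rewrite -RintegralD//; [|exact: iPsi..].
    congr fine; apply: eq_integral => y _; rewrite /Psi -RintegralD//; [|exact: iFB..].
    by congr ((fine _)%:E); apply: eq_integral => x _; rewrite /FB ind mulrDl.
  have -> : m (B1 `|` B2) = m B1 + m B2.
    rewrite /m -!Rintegral_indic; [|exact: measurableI..|by apply: measurableI => //; exact: measurableU].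
    rewrite -RintegralD//; [|exact: iB..].
    by congr fine; apply: eq_integral => x _; rewrite ind.
  rewrite opprD addrACA; apply: le_trans (ler_normD _ _) _.
  by rewrite [(m B1 + _) * n]mulrDl mulrDr; exact: lerD.
have [sq Hsq] := compact_seq_cover cK1 (fun x => let: And3 o _ _ := HV x in o)
  (fun x _ => let: And3 _ o _ := HV x in o).
have cover (t : seq (borel G)) (B : set (borel G)) : measurable B ->
    (forall y, B y -> exists2 x, x \in t & V x y) -> good B.
  elim: t B => [|x t IH] B mB HB.
    apply: (piece 1%g) => //; move=> y /HB[x]; by rewrite in_nil.
  have mV : measurable (V x) by apply: borel_open; have [] := HV x.
  have -> : B = (B `&` V x) `|` (B `\` V x) by rewrite setUIDK.
  apply: goodU; [exact: measurableI|exact: measurableD| | |].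
  - by apply/seteqP; split=> // y [[_ Vy] [_ nVy]].
  - apply: (piece x); first exact: measurableI.
    by move=> y [].
  - apply: IH; first exact: measurableD.
    move=> y [By nVy]; have [z] := HB y By; rewrite inE => /predU1P[->//|zt Vz].
    by exists z.
have := cover sq K1 mK1 Hsq; rewrite /good.
have F0 x y : \1_K1 x * F x y = F x y.
  rewrite indicE; have [xK|xK] := boolP (x \in K1); first by rewrite mul1r.
  by rewrite mul0r; apply/esym/eqP; rewrite -normr_le0; apply: le_trans (FK _ _) _; rewrite indicE (negPf xK) mul0r.
have -> : \int[mu]_x (\1_(K1 `&` K1) x * Phi x) = \int[mu]_x Phi x.
  congr fine; apply: eq_integral => x _; congr (_%:E); rewrite setIid /Phi -RintegralZl//; last first.
    exact: (section_rintegrable cF cK2 FK hnu).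
  by congr fine; apply: eq_integral => y _; rewrite F0.
have -> : \int[nu]_y Psi K1 y = \int[nu]_y \int[mu]_x F x y.
  congr fine; apply: eq_integral => y _; congr ((fine _)%:E); apply: eq_integral => x _.
  by rewrite /FB setIid F0.
by rewrite /m setIid setTI.
Qed.

End IteratedIntegrals.

Section HaarUniqueness.
Variables (R : realType) (G : topologicalGroupType).
Hypothesis hG : hausdorff_space G.
Hypothesis lcG : locally_compact [set: borel G].

Lemma bump_rintegrable (mu : {measure set (borel G) -> \bar R}) (f : borel G -> R) K :
  left_haar mu -> compact K -> continuous f -> (forall x, `|f x| <= \1_K x) -> rintegrable mu f.
Proof.
move=> hmu cK cf fK; apply: le_rintegrable fK _; first exact: continuous_borelR.
by apply: indic_rintegrable; [exact: borel_compact|exact: haar_compact].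
Qed.

Variables mu nu : {measure set (borel G) -> \bar R}.
Hypotheses (hmu : left_haar mu) (hnu : left_haar nu).

(** Two applications of Fubini's theorem and of left invariance give
    [\int h dnu \int f dmu = \int \int h y * f (x * y) dnu x dmu y], whereas
    [\int h dmu \int f dnu = \int \int h y * f (y * x) dnu x dmu y]. If [h] is
    concentrated near the identity, then [f (x * y)] and [f (y * x)] are close on
    the support of [h]. *)
Lemma haar_ratio_bound (f : borel G -> R) D K : compact D -> compact K -> continuous f ->
  (forall x, `|f x| <= \1_K x) -> exists2 C : R, 0 <= C & forall e : R, 0 < e ->
  exists2 V, nbhs (1%g : borel G) V & forall h : borel G -> R, continuous h ->
    (forall x, 0 <= h x <= \1_(D `&` V) x) -> (forall x, h x^-1%g = h x) ->
  `|\int[mu]_x h x * \int[nu]_x f x - \int[nu]_x h x * \int[mu]_x f x| <=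
    e * C * \int[mu]_x h x.
Proof.
move=> cD cK cf fK.
pose E1 : set (borel G) := (fun z : borel G * borel G => (z.1^-1 * z.2)%g) @` (D `*` K).
pose E2 : set (borel G) := (fun z : borel G * borel G => (z.2 * z.1^-1)%g) @` (D `*` K).
pose E := E1 `|` E2.
have cinv : continuous (fun z : borel G * borel G => z.1^-1%g).
  move=> z; apply: (@continuous_comp _ _ _ (fun z : borel G * borel G => z.1) (fun x : borel G => x^-1%g)).
    exact: cvg_fst.
  exact: continuous_invg.
have cmul (p q : borel G * borel G -> borel G) : continuous p -> continuous q ->
    continuous (fun z => (p z * q z)%g).
  move=> cp cq z; apply: (@continuous_comp _ _ _ (fun z => (p z, q z))
    (fun z : borel G * borel G => (z.1 * z.2)%g)).
    by apply: cvg_pair; [exact: cp|exact: cq].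
  exact: mulg_continuous.
have c1 : continuous (fun z : borel G * borel G => z.1) by move=> z; exact: cvg_fst.
have c2 : continuous (fun z : borel G * borel G => z.2) by move=> z; exact: cvg_snd.
have cE : compact E.
  apply: compactU; apply: compact_image; try exact: compact_setX.
    exact: cmul.
  exact: cmul.
have mE := borel_compact hG cE.
have iE : rintegrable nu \1_E by apply: indic_rintegrable => //; exact: haar_compact.
exists (fine (nu E)); first by rewrite fine_ge0.
move=> e e0.
have f0 x : ~ K x -> f x = 0.
  move=> nK; apply/eqP; rewrite -normr_le0; apply: le_trans (fK x) _.
  by rewrite indicE memNset.
exists [set y | forall x, E x -> `|f (y * x)%g - f (x * y)%g| <= e].
  have /compact_near_coveringP H := cE.
  apply: (H (borel G) (nbhs (1%g : borel G)) (fun y x => `|f (y * x)%g - f (x * y)%g| <= e)) => x _.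
  have cc : continuous (fun z : borel G * borel G => f (z.1 * z.2)%g - f (z.2 * z.1)%g).
    move=> z; apply: cvgB.
      apply: (@continuous_comp _ _ _ (fun z : borel G * borel G => (z.1 * z.2)%g) f); last exact: cf.
      exact: cmul.
    apply: (@continuous_comp _ _ _ (fun z : borel G * borel G => (z.2 * z.1)%g) f); last exact: cf.
    exact: cmul.
  have /cvgrPdist_le/(_ _ e0)[[A B] /= [Ax By] AB] := @cc (1%g, x).
  exists (B, A) => // -[x' y] /= [Bx Ay].
  by have := AB (y, x') (conj Ay Bx); rewrite /= mul1g mulg1 subrr sub0r normrN.
set V := [set y | _] => h ch h01 hV.
have h0 x : 0 <= h x by have /andP[] := h01 x.
have hD x : `|h x| <= \1_D x.
  rewrite ger0_norm//; have /andP[_] := h01 x; move/le_trans; apply.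
  by rewrite !indicE in_setI ler_nat; case: (x \in D); case: (x \in V).
have hnz x : h x != 0 -> D x /\ V x.
  move=> hx; have /andP[_] := h01 x; rewrite indicE.
  have [|_ H] := boolP (x \in _); first by rewrite inE.
  by move: hx; rewrite eq_le h0 H.
have imh := bump_rintegrable hmu cD ch hD; have inh := bump_rintegrable hnu cD ch hD.
have imf := bump_rintegrable hmu cK cf fK; have inf := bump_rintegrable hnu cK cf fK.
pose D2 y := \int[nu]_x (f (x * y)%g * h y).
have cF2 : continuous (fun z : borel G * borel G => f (z.1 * z.2)%g * h z.2).
  move=> z; apply: cvgM.
    apply: (@continuous_comp _ _ _ (fun z : borel G * borel G => (z.1 * z.2)%g) f); last exact: cf.
    exact: cmul.
  by apply: (@continuous_comp _ _ _ (fun z : borel G * borel G => z.2) h); [exact: c2|exact: ch].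
have cF2' : continuous (fun z : borel G * borel G => f (z.2 * z.1)%g * h z.1).
  move=> z; apply: cvgM.
    apply: (@continuous_comp _ _ _ (fun z : borel G * borel G => (z.2 * z.1)%g) f); last exact: cf.
    exact: cmul.
  by apply: (@continuous_comp _ _ _ (fun z : borel G * borel G => z.1) h); [exact: c1|exact: ch].
have le1 x y : `|f (x * y)%g * h y| <= \1_E x * \1_D y.
  rewrite normrM; have [Kxy|nK] := pselect (K (x * y)%g); last first.
    by rewrite f0// normr0 mul0r mulr_ge0 ?indic_ge0.
  have [Dy|nD] := pselect (D y); last first.
    by apply: le_trans (ler_wpM2l (normr_ge0 _) (hD y)) _; rewrite indicE memNset// !mulr0.
  rewrite [\1_E x]indicE mem_set; last by right; exists (y, (x * y)%g) => //=; rewrite mulgK.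
  by apply: ler_pM => //; apply: le_trans (fK _) (indic_le1 _ _ _).
have iD2 : rintegrable mu D2.
  apply: (section_integral_rintegrable hG (F := fun y x => f (x * y)%g * h y) cF2' cD cE _ hnu hmu).
  by move=> y x; rewrite [leRHS]mulrC.
have E2' : \int[nu]_x h x * \int[mu]_x f x = \int[mu]_y D2 y.
  rewrite /D2 -(fubini_continuous hG hnu hmu (F := fun x y => f (x * y)%g * h y) cF2 cE cD le1).
  have cF1 : continuous (fun z : borel G * borel G => f z.1 * h (z.2^-1 * z.1)%g).
    move=> z; apply: cvgM.
      by apply: (@continuous_comp _ _ _ (fun z : borel G * borel G => z.1) f); [exact: c1|exact: cf].
    apply: (@continuous_comp _ _ _ (fun z : borel G * borel G => (z.2^-1 * z.1)%g) h); last exact: ch.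
    apply: (cmul (fun z => z.2^-1%g) fst) => // w.
    apply: (@continuous_comp _ _ _ (fun z : borel G * borel G => z.2) (fun x : borel G => x^-1%g)).
      exact: cvg_snd.
    exact: continuous_invg.
  have le2 y x : `|f y * h (x^-1 * y)%g| <= \1_K y * \1_E x.
    rewrite normrM; have [Ky|nK] := pselect (K y); last first.
      by rewrite f0// normr0 mul0r mulr_ge0 ?indic_ge0.
    have [Dy|nD] := pselect (D (x^-1 * y)%g); last first.
      by apply: le_trans (ler_wpM2l (normr_ge0 _) (hD _)) _; rewrite [\1_D _]indicE memNset// !mulr0 mulr_ge0 ?indic_ge0.
    rewrite [\1_E x]indicE mem_set; last first.
      by right; exists ((x^-1 * y)%g, y) => //=; rewrite invgM invgK mulVKg.
    by apply: ler_pM => //; apply: le_trans (hD _) (indic_le1 _ _ _).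
  transitivity (\int[mu]_y \int[nu]_x (f y * h (x^-1 * y)%g)).
    rewrite -RintegralZl//; congr fine; apply: eq_integral => y _; congr (_%:E).
    rewrite (_ : \int[nu]_x (f y * h (x^-1 * y)%g) = \int[nu]_x (f y * h (y^-1 * x)%g)); last first.
      by congr fine; apply: eq_integral => x _; rewrite -[in LHS]hV invgM invgK.
    by rewrite RintegralZl ?(Rintegral_mulgl hnu) 1?mulrC//; exact: (rintegrable_mulgl hnu).
  rewrite (fubini_continuous hG hmu hnu (F := fun y x => f y * h (x^-1 * y)%g) cF1 cK cE le2).
  congr fine; apply: eq_integral => x _; congr (_%:E).
  have iy : rintegrable mu (fun y => f y * h (x^-1 * y)%g).
    apply: le_rintegrable (rintegrable_norm imf).
      apply: continuous_borelR => y; apply: cvgM; first exact: cf.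
      apply: (@continuous_comp _ _ _ (fun y : borel G => (x^-1 * y)%g) h); last exact: ch.
      exact: continuous_mulgl.
    by move=> y; rewrite normrM ler_piMr//; apply: le_trans (hD _) (indic_le1 _ _ _).
  rewrite -(Rintegral_mulgl hmu x iy); congr fine; apply: eq_integral => y _.
  by rewrite mulKg.
rewrite E2' -[X in `|X - _|]RintegralZr//.
have iD1 : rintegrable mu (fun x => h x * \int[nu]_x f x).
  by under eq_fun do rewrite mulrC; exact: rintegrableZ.
rewrite -RintegralB// -RintegralZl//.
apply: Rintegral_abs_le; [exact: (rintegrable_measurable (rintegrableB iD1 iD2))| |exact: rintegrableZ].
move=> y; have iyx : rintegrable nu (fun x => f (y * x)%g) by exact: (rintegrable_mulgl hnu).
rewrite -(Rintegral_mulgl hnu y inf) -RintegralZl// /D2.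
have s2 : rintegrable nu (fun x => f (x * y)%g * h y).
  apply: le_rintegrable (fun x => le1 x y) _; last by under eq_fun do rewrite mulrC; exact: rintegrableZ.
  under eq_fun do rewrite mulrC.
  apply: measurable_funM => //; apply: continuous_borelR => x.
  apply: (@continuous_comp _ _ _ (fun x : borel G => (x * y)%g) f); last exact: cf.
  exact: continuous_mulgr.
have s1 := rintegrableZ (h y) iyx.
rewrite -RintegralB//.
apply: le_trans (Rintegral_abs_le (h := fun x => (h y * e) * \1_E x) _ _ _) _.
- exact: (rintegrable_measurable (rintegrableB s1 s2)).
- move=> x; rewrite [f (x * y)%g * _]mulrC -mulrBr normrM ger0_norm// -mulrA.
  have [->|hy] := eqVneq (h y) 0; first by rewrite !mul0r.
  have [Dy Vy] := hnz _ hy.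
  rewrite ler_wpM2l//; have [Ex|nE] := pselect (E x).
    by rewrite indicE mem_set// mulr1; exact: Vy.
  rewrite indicE memNset// mulr0 !f0 ?subrr ?normr0//.
    by move=> Kxy; apply: nE; right; exists (y, (x * y)%g) => //=; rewrite mulgK.
  by move=> Kyx; apply: nE; left; exists (y, (y * x)%g) => //=; rewrite mulKg.
- exact: rintegrableZ.
by rewrite RintegralZl// Rintegral_indic// [leLHS]mulrAC [leRHS]mulrC mulrA mulrAC.
Qed.

Lemma symmetric_bump (V : set (borel G)) : nbhs (1%g : borel G) V ->
  exists h : borel G -> R, [/\ continuous h, forall x, 0 <= h x <= \1_V x,
    forall x, h x^-1%g = h x & h 1%g = 1].
Proof.
move=> V1; have cf1 : compact [set 1%g : borel G] by exact: compact_set1.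
have [|f [cf f01 f1 [C _ fC]]] := @compact_bump R (borel G) [set 1%g] V° hG lcG cf1 (open_interior V).
  by move=> _ ->.
exists (fun x => f x * f x^-1%g); split.
- move=> x; apply: cvgM; first exact: cf.
  apply: (@continuous_comp _ _ _ (fun x : borel G => x^-1%g) f); last exact: cf.
  exact: continuous_invg.
- move=> x; have /andP[a0 a1] := f01 x; have /andP[b0 b1] := f01 x^-1%g.
  rewrite mulr_ge0//=; have [->|fx] := eqVneq (f x) 0; first by rewrite mul0r indic_ge0.
  by rewrite indicE mem_set ?mulr_ile1//; have [/interior_subset] := fC x fx.
- by move=> x; rewrite invgK mulrC.
- by rewrite invg1 f1// mulr1.
Qed.

Lemma bump_integral_gt0 (la : {measure set (borel G) -> \bar R}) (h : borel G -> R) :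
  left_haar la -> continuous h -> (forall x, 0 <= h x) -> h 1%g = 1 ->
  rintegrable la h -> 0 < \int[la]_x h x.
Proof.
move=> hla ch h0 h1 ih; pose U := [set x | 2^-1 < h x].
have oU : open U by apply: (@open_comp _ _ h [set r | 2^-1 < r]) => // x _; exact: ch.
have mU := borel_open oU.
have U1 : U 1%g by rewrite /U/= h1 invf_lt1// ltr1n.
have Up := haar_open_gt0 hG hla oU U1.
have le x : \1_U x <= 2 * h x.
  rewrite indicE; have [|_] := boolP (x \in U); last by rewrite mulr_ge0.
  by rewrite inE /U/= => /ltW; rewrite mulrC -ler_pdivrMr// mul1r.
have iU : rintegrable la \1_U.
  apply: le_rintegrable (rintegrableZ 2 ih); first exact: measurable_indic.
  by move=> x; rewrite ger0_norm ?indic_ge0.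
have Uf : (la U < +oo)%E.
  have /integrableP[_] := iU; rewrite (_ : (\int[la]_x _ = la U)%E)//.
  rewrite -[U in RHS](setIT U) -integral_indic//; apply: eq_integral => x _.
  by rewrite /= ger0_norm ?indic_ge0.
have : 0 < \int[la]_x \1_U x by rewrite Rintegral_indic// fine_gt0// Up.
move=> /lt_le_trans/(_ (le_Rintegral measurableT iU (rintegrableZ 2 ih) (fun x _ => le x))).
by rewrite RintegralZl// pmulr_rgt0.
Qed.

(** With the same [h] for [f1] and [f2], the ratio of the integrals of [h] cancels. *)
Lemma bump_proportional (f1 f2 : borel G -> R) K1 K2 : compact K1 -> compact K2 ->
  continuous f1 -> continuous f2 -> (forall x, `|f1 x| <= \1_K1 x) ->
  (forall x, `|f2 x| <= \1_K2 x) ->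
  \int[nu]_x f1 x * \int[mu]_x f2 x = \int[nu]_x f2 x * \int[mu]_x f1 x.
Proof.
move=> cK1 cK2 cf1 cf2 fK1 fK2; have [D cD D1] := ex_compact_nbhs1 lcG.
have [C1 C10 H1] := haar_ratio_bound cD cK1 cf1 fK1.
have [C2 C20 H2] := haar_ratio_bound cD cK2 cf2 fK2.
apply/eqP; rewrite -subr_eq0 -normr_le0; apply/ler_addgt0Pr => /= e e0; rewrite add0r.
set m1 := \int[mu]_x f1 x; set m2 := \int[mu]_x f2 x.
set n1 := \int[nu]_x f1 x; set n2 := \int[nu]_x f2 x.
pose d := C1 * `|m2| + C2 * `|m1| + 1.
have d0 : 0 < d by rewrite ltr_wpDl// addr_ge0// mulr_ge0.
have ed : 0 < e / d by rewrite divr_gt0.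
have [V1 V11 HV1] := H1 _ ed; have [V2 V21 HV2] := H2 _ ed.
have [|h [ch h01 hV h1]] := @symmetric_bump (D `&` (V1 `&` V2)).
  by apply: filterI => //; exact: filterI.
have h0 x : 0 <= h x by have /andP[] := h01 x.
have hle (W : set (borel G)) x : D `&` (V1 `&` V2) `<=` W -> h x <= \1_W x.
  move=> DW; have /andP[_ /le_trans] := h01 x; apply; rewrite !indicE ler_nat.
  have [|//] := boolP (x \in D `&` (V1 `&` V2)).
  by rewrite inE => /DW Wx; rewrite mem_set.
have imh : rintegrable mu h.
  by apply: (bump_rintegrable hmu cD ch) => x; rewrite ger0_norm// hle// => y [].
have a0 := bump_integral_gt0 hmu ch h0 h1 imh.
have h1' x : 0 <= h x <= \1_(D `&` V1) x by rewrite h0 hle// => y [Dy []].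
have h2' x : 0 <= h x <= \1_(D `&` V2) x by rewrite h0 hle// => y [Dy []].
have := HV1 h ch h1' hV; have := HV2 h ch h2' hV.
rewrite -/m1 -/m2 -/n1 -/n2.
move: (\int[mu]_x h x) (\int[nu]_x h x) a0 => a b a0 P2 P1.
rewrite -(ler_pM2l a0) -[X in X * `|_|](gtr0_norm a0) -normrM.
rewrite (_ : a * _ = (a * n1 - b * m1) * m2 - (a * n2 - b * m2) * m1); last by ring.
apply: le_trans (ler_normB _ _) _; rewrite !normrM.
apply: le_trans (lerD (ler_wpM2r (normr_ge0 _) P1) (ler_wpM2r (normr_ge0 _) P2)) _.
rewrite (_ : _ + _ = a * (e / d * (C1 * `|m2| + C2 * `|m1|))); last by ring.
rewrite ler_wpM2l ?(ltW a0)// mulrAC ler_pdivrMr// ler_wpM2l ?(ltW e0)//.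
by rewrite /d lerDl.
Qed.

Lemma compact_between (K U : set (borel G)) : compact K -> open U -> K `<=` U ->
  exists f : borel G -> R, exists2 C, compact C &
    [/\ continuous f, forall x, `|f x| <= \1_C x, forall x, \1_K x <= f x & forall x, f x <= \1_U x].
Proof.
move=> cK oU KU; have [f [cf f01 fK [C cC fC]]] := @compact_bump R (borel G) K U hG lcG cK oU KU.
exists f; exists C => //; split => // x; have /andP[f0 f1] := f01 x.
- rewrite ger0_norm//; have [->|/fC[_ Cx]] := eqVneq (f x) 0; first exact: indic_ge0.
  by rewrite indicE mem_set.
- by rewrite indicE; have [|//] := boolP (x \in K); rewrite inE => /fK->.
- have [->|/fC[Ux _]] := eqVneq (f x) 0; first exact: indic_ge0.
  by rewrite indicE mem_set.
Qed.

End HaarUniqueness.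

(** Inner regularity, with a bump function between a compact subset and [U]. *)
Lemma haar_le_open (R : realType) (G : topologicalGroupType)
    (mu nu : {measure set (borel G) -> \bar R}) (D : R) (hG : hausdorff_space G)
    (lcG : locally_compact [set: borel G]) : left_haar mu -> left_haar nu -> 0 < D ->
  (forall f K, compact K -> continuous f -> (forall x, `|f x| <= \1_K x) ->
    \int[nu]_x f x = D * \int[mu]_x f x) ->
  forall U : set (borel G), open U -> (nu U <= D%:E * mu U)%E.
Proof.
move=> hmu hnu D0 HD U oU; rewrite (haar_inner_regular hnu oU).
apply: ge_ereal_sup => _ [K [cK KU] <-].
have [f [C cC [cf fC Kf fU]]] := compact_between R hG lcG cK oU KU.
have mK := borel_compact hG cK; have mU := borel_open oU.
have Kfin := haar_compact hnu cK.
have inf := bump_rintegrable hG hnu cC cf fC; have imf := bump_rintegrable hG hmu cC cf fC.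
have iK := indic_rintegrable mK Kfin.
have H := le_Rintegral measurableT iK inf (fun x _ => Kf x).
rewrite Rintegral_indic// (HD f C)// in H.
have [Uoo|Uf] := eqVneq (mu U) +oo%E.
  by rewrite Uoo mulry gtr0_sg// mul1e leey.
have Uf' : (mu U < +oo)%E by rewrite ltey.
have iU := indic_rintegrable mU Uf'.
have H' := le_Rintegral measurableT imf iU (fun x _ => fU x).
rewrite Rintegral_indic// in H'.
have := le_trans H (ler_wpM2l (ltW D0) H').
by rewrite -lee_fin EFinM !fineK// ge0_fin_numE.
Qed.

(** The integrals of bump functions are proportional; regularity transfers this to open
    sets and then to Borel sets. *)
Lemma haar_unique (R : realType) (G : topologicalGroupType)
    (mu nu : {measure set (borel G) -> \bar R}) (hG : hausdorff_space G)
    (lcG : locally_compact [set: borel G]) : left_haar mu -> left_haar nu ->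
  exists2 D : R, 0 < D & forall A : set (borel G), measurable A -> nu A = (D%:E * mu A)%E.
Proof.
move=> hmu hnu; have [C cC C1] := ex_compact_nbhs1 lcG.
have [f0 [cf0 f001 _ f01]] := symmetric_bump R hG lcG C1.
have f0ge x : 0 <= f0 x by have /andP[] := f001 x.
have f0C x : `|f0 x| <= \1_C x by rewrite ger0_norm//; have /andP[] := f001 x.
have m0 := bump_integral_gt0 hG hmu cf0 f0ge f01 (bump_rintegrable hG hmu cC cf0 f0C).
have n0 := bump_integral_gt0 hG hnu cf0 f0ge f01 (bump_rintegrable hG hnu cC cf0 f0C).
pose D := \int[nu]_x f0 x / \int[mu]_x f0 x; have D0 : 0 < D by rewrite divr_gt0.
have HD (f : borel G -> R) K : compact K -> continuous f -> (forall x, `|f x| <= \1_K x) ->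
    \int[nu]_x f x = D * \int[mu]_x f x.
  move=> cK cf fK; have := bump_proportional hG lcG hmu hnu cK cC cf cf0 fK f0C.
  by rewrite /D mulrAC => <-; rewrite mulfK ?gt_eqF.
have HD' (f : borel G -> R) K : compact K -> continuous f -> (forall x, `|f x| <= \1_K x) ->
    \int[mu]_x f x = D^-1 * \int[nu]_x f x.
  by move=> cK cf fK; rewrite (HD f K)// mulKf ?gt_eqF.
exists D => //.
have HU (U : set (borel G)) : open U -> nu U = (D%:E * mu U)%E.
  move=> oU; apply/eqP; rewrite eq_le (haar_le_open hG lcG hmu hnu D0 HD oU)/=.
  have Di : 0 < D^-1 by rewrite invr_gt0.
  have := haar_le_open hG lcG hnu hmu Di HD' oU.
  by rewrite -(lee_pmul2l _ (_ : (0 < D%:E)%E)) ?lte_fin// muleA -EFinM divff ?gt_eqF// mul1e.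
move=> A mA; apply/eqP; rewrite eq_le; apply/andP; split.
  rewrite [in leRHS](haar_outer_regular hmu mA).
  rewrite -lee_pdivrMl//; apply: le_ereal_inf_tmp => _ [U [oU AU] <-].
  rewrite lee_pdivrMl// -HU//; apply: le_measure => //; rewrite inE//; exact: borel_open.
rewrite (haar_outer_regular hnu mA); apply: le_ereal_inf_tmp => _ [U [oU AU] <-].
rewrite HU// lee_pmul2l ?lte_fin//; apply: le_measure => //; rewrite inE//; exact: borel_open.
Qed.

(** * Restriction to the cosets of an open subgroup *)

Section Cosets.
Variables (R : realType) (G : topologicalGroupType).
Hypothesis hG : hausdorff_space G.
Hypothesis lcG : locally_compact [set: G].
Variable mu : {measure set (borel G) -> \bar R}.
Hypothesis hmu : left_haar mu.
Variable H : groupClosed G.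
Hypothesis oH : open [set` H].
Local Notation Hs := (subgroup_type H).

Definition coset (c : borel G) : set (borel G) := [set x | (x * c^-1)%g \in H].

(** The bijection from [H c] onto [H], extended by [1] outside [H c]. *)
Definition coset_proj (c x : borel G) : borel Hs := insubd (1%g : Hs) (x * c^-1 : G)%g.

Definition coset_inj (c : borel G) (h : borel Hs) : borel G := (val (h : Hs) * c)%g.

Lemma coset_injK c : cancel (coset_inj c) (coset_proj c).
Proof. by move=> h; apply: val_inj; rewrite val_insubd /coset_inj mulgK ifT//; exact: valP. Qed.

Lemma coset_projK c x : coset c x -> coset_inj c (coset_proj c x) = x.
Proof. by rewrite /coset/= => cx; rewrite /coset_inj val_insubd cx mulgVK. Qed.

Lemma coset_inj_in c h : coset c (coset_inj c h).
Proof. by rewrite /coset/= /coset_inj mulgK; exact: valP. Qed.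

Lemma open_coset c : open (coset c).
Proof. exact: (open_mulgr (G := borel G) c^-1%g oH). Qed.

Lemma coset_refl c : coset c c.
Proof. by rewrite /coset/= mulgV; exact: gpred1. Qed.

Lemma coset_sym c x : coset c x -> coset x c.
Proof. by rewrite /coset/= => cx; rewrite -gpredV invgM invgK. Qed.

Lemma coset_trans c x y : coset c x -> coset x y -> coset c y.
Proof.
rewrite /coset/= => cx xy.
have -> : (y * c^-1 = (y * x^-1) * (x * c^-1))%g by rewrite -mulgA mulKg.
exact: gpredM.
Qed.

Lemma closed_coset c : closed (coset c).
Proof.
rewrite -[coset c]setCK; apply: open_closedC; rewrite openE => x ncx.
rewrite /interior/= nbhsE; exists (coset x); first by split; [exact: open_coset|exact: coset_refl].
by move=> y xy cy; apply: ncx; apply: coset_trans cy _; exact: coset_sym.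
Qed.

Lemma measurable_coset c : measurable (coset c).
Proof. by apply: borel_open; exact: open_coset. Qed.

Lemma continuous_coset_inj c : continuous (coset_inj c).
Proof.
move=> h; apply: (@continuous_comp _ _ _ (fun h : borel Hs => val (h : Hs) : borel G) (fun x : borel G => (x * c)%g)).
  exact: (@val_subgroup_continuous G H).
exact: continuous_mulgr.
Qed.

Lemma continuous_coset_proj c : continuous (coset_proj c).
Proof.
apply/continuousP => _ [U oU <-].
have -> : coset_proj c @^-1` (val @^-1` U) = (coset c `&` [set x : borel G | U (x * c^-1)%g]) `|`
    (~` coset c `&` [set _ | U 1%g]).
  apply/seteqP; split=> x; rewrite /preimage/= val_insubd /coset/=.
    by case: ifP => [cx Ux|ncx U1]; [left|right; split => //; rewrite ncx].
  by case: ifP => cx [[]|[]].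
apply: openU; apply: openI.
- exact: open_coset.
- exact: (open_mulgr (G := borel G) c^-1%g oU).
- by apply: closed_openC; exact: closed_coset.
- have [U1|nU1] := pselect (U 1%g).
    by rewrite (_ : [set _ | _] = setT); [exact: openT|apply/seteqP; split].
  by rewrite (_ : [set _ | _] = set0); [exact: open0|apply/seteqP; split].
Qed.

Lemma subgroup_hausdorff : hausdorff_space (borel Hs).
Proof.
move=> x y xy; apply: val_inj; apply: hG => A B Ax By.
have [z [Az Bz]] := xy (val @^-1` A) (val @^-1` B)
  (@val_subgroup_continuous G H x A Ax) (@val_subgroup_continuous G H y B By).
by exists (val (z : Hs)).
Qed.

Lemma subgroup_locally_compact : locally_compact [set: borel Hs].
Proof.
move=> x _; rewrite withinET.
have [C] := @lcG (val (x : Hs)) I; rewrite withinET => Cx [cC _].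
have cP : compact (coset_proj 1%g @` C) by apply: compact_image cC; exact: continuous_coset_proj.
exists (coset_proj 1%g @` C).
  have Cx' : nbhs (x : borel Hs) (val @^-1` C) := @val_subgroup_continuous G H x C Cx.
  apply: filterS Cx' => h Ch.
  by exists (coset_inj 1%g h); rewrite ?coset_injK// /coset_inj mulg1.
by split => //; apply: compact_closed => //; exact: subgroup_hausdorff.
Qed.

Let measurable_proj c : measurable_fun setT (coset_proj c).
Proof. by apply: (continuous_borel (G' := Hs)); exact: continuous_coset_proj. Qed.

Let measurable_inj c : measurable_fun setT (coset_inj c).
Proof. by apply: (continuous_borel (G' := G)); exact: continuous_coset_inj. Qed.

(** The measure [A |-> mu (A c)] on [H]. *)
Definition coset_measure c : {measure set (borel Hs) -> \bar R} :=
  measure_function_pushforward__canonical__measure_function_Measure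
    (mrestr mu (measurable_coset c)) (measurable_proj c).

Lemma coset_measureE c A : coset_measure c A = mu (coset_proj c @^-1` A `&` coset c).
Proof. by []. Qed.

(** [H c] is homeomorphic to [H], compatibly with left translation by [H]. *)
Lemma coset_measure_haar c : left_haar (coset_measure c).
Proof.
have mpre A : measurable A -> measurable (coset_proj c @^-1` A `&` coset c).
  move=> mA; apply: measurableI; last exact: measurable_coset.
  by rewrite -[X in measurable X]setTI; exact: measurable_proj.
split.
- rewrite coset_measureE preimage_setT setTI; apply/eqP => c0.
  have oc : open [set x : borel G | coset c (c * x)%g].
    by apply: (open_mulgl (G := borel G)); exact: open_coset.
  have := haar_open_gt0 hG hmu oc; rewrite /= mulg1 => /(_ (coset_refl c)).
  by rewrite (mulgl_measure_preserving hmu c).2 ?c0 ?ltxx//; exact: measurable_coset.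
- move=> K cK; rewrite coset_measureE.
  have cK' : compact (coset_inj c @` K) by apply: compact_image cK; exact: continuous_coset_inj.
  apply: le_lt_trans (haar_compact hmu cK'); apply: le_measure; rewrite ?inE.
  + by apply: mpre; apply: borel_compact cK; exact: subgroup_hausdorff.
  + exact: borel_compact.
  + by move=> x [Kx cx]; exists (coset_proj c x) => //; exact: coset_projK.
- move=> A mA; apply/eqP; rewrite eq_le; apply/andP; split.
    apply: le_ereal_inf_tmp => _ [U [oU AU] <-]; apply: le_measure; rewrite ?inE//.
    exact: borel_open.
  rewrite coset_measureE (haar_outer_regular hmu (mpre _ mA)).
  apply: le_ereal_inf_tmp => _ [W [oW AW] <-].
  have oU : open (coset_inj c @^-1` W).
    by have /continuousP cc := @continuous_coset_inj c; exact: cc.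
  apply: (@le_trans _ _ (coset_measure c (coset_inj c @^-1` W))).
    apply: ereal_inf_lbound; exists (coset_inj c @^-1` W) => //; split => // h Ah.
    by apply: AW; split; [rewrite /preimage/= coset_injK|exact: coset_inj_in].
  rewrite coset_measureE; apply: le_measure; rewrite ?inE.
  + by apply: mpre; exact: borel_open.
  + exact: borel_open.
  + by move=> x [/= Wx cx]; rewrite /preimage/= coset_projK in Wx.
- move=> U oU; apply/eqP; rewrite eq_le; apply/andP; split; last first.
    apply: ge_ereal_sup => _ [K [cK KU] <-]; apply: le_measure; rewrite ?inE//.
      by apply: borel_compact cK; exact: subgroup_hausdorff.
    exact: borel_open.
  have oV : open (coset_proj c @^-1` U `&` coset c).
    apply: openI; last exact: open_coset.
    by have /continuousP cc := @continuous_coset_proj c; exact: cc.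
  rewrite coset_measureE (haar_inner_regular hmu oV).
  apply: ge_ereal_sup => _ [K [cK KU] <-].
  have cP : compact (coset_proj c @` K) by apply: compact_image cK; exact: continuous_coset_proj.
  apply: (@le_trans _ _ (coset_measure c (coset_proj c @` K))); last first.
    apply: ereal_sup_ubound; exists (coset_proj c @` K) => //; split => //.
    by move=> _ [x Kx <-]; have [] := KU x Kx.
  rewrite coset_measureE; apply: le_measure; rewrite ?inE.
  + exact: borel_compact.
  + by apply: mpre; apply: borel_compact cP; exact: subgroup_hausdorff.
  + by move=> x Kx; split; [exists x|have [] := KU x Kx].
- move=> g A mA; rewrite !coset_measureE.
  rewrite -(haar_invariant hmu (val (g : Hs)) (mpre _ mA)).
  have pg (h : borel Hs) x : coset c x -> coset_proj c (val (h : Hs) * x)%g = (h * coset_proj c x)%g /\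
      coset c (val (h : Hs) * x)%g.
    rewrite /coset/= => cx; have cgx : (val (h : Hs) * x * c^-1)%g \in H.
      by rewrite -mulgA; apply: gpredM => //; exact: valP.
    by split => //; apply: val_inj; rewrite valM !val_insubd cx cgx mulgA.
  congr (mu _); apply/seteqP; split=> [x [[h Ah hx] cx]|_ [x [/= Ax cx] <-]]; last first.
    have [p1 p2] := pg g x cx; split => //=; rewrite /preimage/= p1.
    by exists (coset_proj c x).
  exists (val (g : Hs)^-1 * x)%g; last by rewrite mulVKg.
  have [] := pg (g^-1)%g x cx; rewrite val_subgroupV => p1 p2.
  by split => //; rewrite /preimage/= p1 -hx mulKg.
Qed.

Local Notation nu := (coset_measure 1%g).

Lemma ex_modulus c : exists D : R, 0 < D /\
  forall A, measurable A -> coset_measure c A = (D%:E * nu A)%E.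
Proof.
have [D D0 HD] := haar_unique subgroup_hausdorff subgroup_locally_compact
  (coset_measure_haar 1%g) (coset_measure_haar c).
by exists D.
Qed.

(** For [c] in [H] this is the modular function of [H]; in general it compares the Haar
    measures which [H] inherits from the cosets [H] and [H c]. *)
Definition modulus c : R := sval (cid (ex_modulus c)).

Lemma modulus_gt0 c : 0 < modulus c.
Proof. by rewrite /modulus; case: cid => D []. Qed.

Lemma modulusE c A : measurable A -> coset_measure c A = ((modulus c)%:E * nu A)%E.
Proof. by rewrite /modulus; case: cid => D [D0 HD] mA; exact: HD. Qed.

(** A compact neighborhood of [1] has positive finite measure. *)
Lemma modulus1 : modulus 1%g = 1.
Proof.
have [K cK [Kn0]] : exists2 K : set (borel Hs), compact K & nu K <> 0%E /\ True.
  have [K cK K1] := ex_compact_nbhs1 subgroup_locally_compact; exists K => //; split => //.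
  have := haar_open_gt0 subgroup_hausdorff (coset_measure_haar 1%g) (open_interior K) K1.
  move=> Ko K0; move: Ko; rewrite ltNge => /negP; apply; rewrite -K0.
  apply: le_measure; rewrite ?inE; [by apply: borel_open; exact: open_interior| |exact: interior_subset].
  by apply: borel_compact cK; exact: subgroup_hausdorff.
move=> _; have mK : measurable K by apply: borel_compact cK; exact: subgroup_hausdorff.
have Kf : nu K \is a fin_num.
  by rewrite ge0_fin_numE//; exact: haar_compact (coset_measure_haar 1%g) _ cK.
have := modulusE 1%g mK; rewrite -(fineK Kf) -EFinM => -[].
have : fine (nu K) != 0 by rewrite fine_eq0//; apply/eqP.
by move: (fine _) => a a0 /eqP; rewrite eq_sym -subr_eq0 -{2}[a]mul1r -mulrBl mulf_eq0 (negPf a0) orbF subr_eq0 => /eqP.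
Qed.

Lemma coset_ge0_integral c (f : borel Hs -> \bar R) : measurable_fun setT f ->
  (forall h, 0 <= f h)%E ->
  (\int[mu]_(x in coset c) f (coset_proj c x) = (modulus c)%:E * \int[nu]_h f h)%E.
Proof.
move=> mf f0; have mc := measurable_coset c.
have m0 : 0 <= modulus c by apply: ltW; exact: modulus_gt0.
have mfp : measurable_fun setT (fun x => f (coset_proj c x)) by exact: measurableT_comp.
have -> : (\int[mu]_(x in coset c) f (coset_proj c x) =
    \int[mrestr mu mc]_(x in coset c) f (coset_proj c x))%E.
  by apply: eq_measure_integral => A mA Ac; rewrite /= /mrestr setIidl.
have -> : (\int[mrestr mu mc]_(x in coset c) f (coset_proj c x) =
    \int[mrestr mu mc]_x f (coset_proj c x))%E.
  rewrite [RHS](ge0_negligible_integral (N := ~` coset c))//.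
  - by rewrite setTD setCK.
  - exact: measurableC.
  - by rewrite /= /mrestr setICl measure0.
rewrite -(ge0_integral_pushforward (measurable_proj c) (mrestr mu mc) measurableT)//.
rewrite -(ge0_integral_mscale nu measurableT (NngNum m0) mf (fun x _ => f0 x))//.
by apply: eq_measure_integral => A mA _; exact: modulusE.
Qed.

Lemma coset_rintegrable c (h : borel Hs -> R) : measurable_fun setT h ->
  rintegrable nu h <-> rintegrable mu (fun x => h (coset_proj c x) * \1_(coset c) x).
Proof.
move=> mh; have mhp : measurable_fun setT (fun x => h (coset_proj c x) * \1_(coset c) x).
  apply: measurable_funM; first exact: measurableT_comp.
  by apply: measurable_indic; exact: measurable_coset.
have E : (\int[mu]_x `|(h (coset_proj c x) * \1_(coset c) x)%R%:E| =
    (modulus c)%:E * \int[nu]_x `|(EFin \o h) x|)%E.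
  rewrite -coset_ge0_integral//; last first.
    by apply: (measurableT_comp (f := abse)) => //; exact/measurable_EFinP.
  rewrite [RHS]integral_mkcond; apply: eq_integral => x _.
  rewrite patchE/= indicE; case: (_ \in _); first by rewrite mulr1.
  by rewrite mulr0 normr0.
have fin (X : \bar R) : (0 <= X)%E -> ((modulus c)%:E * X < +oo)%E = (X < +oo)%E.
  case: X => [r _|_|//]; first by rewrite -EFinM !ltry.
  by rewrite mulry gtr0_sg ?modulus_gt0// mul1e.
have E' : (\int[mu]_x `|(EFin \o (fun x => (h (coset_proj c x) * \1_(coset c) x)%R)) x| < +oo)%E =
    (\int[nu]_x `|(EFin \o h) x| < +oo)%E.
  by rewrite -[LHS]/(\int[mu]_x _ < _)%E E fin// integral_ge0.
split=> /integrableP[_ ih]; apply/integrableP; split; try exact/measurable_EFinP.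
  by rewrite E'.
by rewrite -E'.
Qed.

Lemma coset_Rintegral c (h : borel Hs -> R) : rintegrable nu h ->
  \int[mu]_x (h (coset_proj c x) * \1_(coset c) x) = modulus c * \int[nu]_x h x.
Proof.
have ge0 (g : borel Hs -> R) : (forall x, 0 <= g x) -> rintegrable nu g ->
    \int[mu]_x (g (coset_proj c x) * \1_(coset c) x) = modulus c * \int[nu]_x g x.
  move=> g0 ig; have mg := rintegrable_measurable ig.
  rewrite /Rintegral -[modulus c in RHS]/(fine (modulus c)%:E) -fineM//; last exact: integrable_fin_num.
  rewrite -coset_ge0_integral//; last exact/measurable_EFinP.
  congr fine; rewrite [RHS]integral_mkcond; apply: eq_integral => x _.
  by rewrite patchE/= indicE; case: (_ \in _); rewrite ?mulr1 ?mulr0.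
move=> ih; have mh := rintegrable_measurable ih; have ia := rintegrable_norm ih.
have is' := rintegrableD ia ih.
have s0 x : 0 <= `|h x| + h x by have := ler_norm (- h x); rewrite normrN -subr_ge0 opprK.
have := ge0 _ s0 is'; have := ge0 _ (fun x => normr_ge0 (h x)) ia.
have P1 := (coset_rintegrable c (rintegrable_measurable ia)).1 ia.
have P2 := (coset_rintegrable c mh).1 ih.
under [X in _ -> X = _ -> _]eq_Rintegral do rewrite mulrDl.
rewrite RintegralD// [X in _ -> _ = _ * X -> _]RintegralD// => ->.
by rewrite mulrDr => /addrI.
Qed.

End Cosets.

Section CosetEmbedding.
Variables (R : realType) (G : topologicalGroupType).
Hypothesis hG : hausdorff_space G.
Hypothesis lcG : locally_compact [set: G].
Variable mu : {measure set (borel G) -> \bar R}.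
Hypothesis hmu : left_haar mu.
Variable H : groupClosed G.
Hypothesis oH : open [set` H].
Local Notation Hs := (subgroup_type H).
Local Notation nu := (coset_measure mu oH 1%g).
Local Notation proj := (coset_proj H).
Local Notation inj := (coset_inj (H := H)).
Local Notation Hcoset := (coset H).
Local Notation modH := (modulus hG lcG hmu oH).

Let measurable_proj c : measurable_fun setT (proj c).
Proof. by apply: (continuous_borel (G' := Hs)); exact: continuous_coset_proj. Qed.

Let measurable_inj c : measurable_fun setT (inj c).
Proof. by apply: (continuous_borel (G' := G)); exact: continuous_coset_inj. Qed.

(** The indicator hides the junk value of [coset_proj] outside [H c]. *)
Definition cext c (f : borel Hs -> R[i]) (x : borel G) : R[i] :=
  f (proj c x) * (\1_(Hcoset c) x)%:C.

Definition cres c (g : borel G -> R[i]) (h : borel Hs) : R[i] := g (inj c h).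

Lemma cext_res c g x : cext c (cres c g) x = g x * (\1_(Hcoset c) x)%:C.
Proof.
rewrite /cext /cres indicE; have [|_] := boolP (x \in _); last by rewrite !mulr0.
by rewrite inE => cx; rewrite coset_projK.
Qed.

Lemma cext_measurable c f : cmeasurable f -> cmeasurable (cext c f).
Proof.
move=> [rf jf]; apply: cmeasurableM.
  by split; [exact: (measurableT_comp rf (measurable_proj c))|exact: (measurableT_comp jf (measurable_proj c))].
split => /=; last exact: measurable_cst.
by apply: measurable_indic; exact: measurable_coset.
Qed.

Lemma cres_measurable c g : cmeasurable g -> cmeasurable (cres c g).
Proof.
by move=> [rg jg]; split; [exact: (measurableT_comp rg (measurable_inj c))|exact: (measurableT_comp jg (measurable_inj c))].
Qed.

Lemma Re_cext c f x : Re (cext c f x) = Re (f (proj c x)) * \1_(Hcoset c) x.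
Proof. by rewrite /cext cReM /= mulr0 subr0. Qed.

Lemma Im_cext c f x : Im (cext c f x) = Im (f (proj c x)) * \1_(Hcoset c) x.
Proof. by rewrite /cext cImM /= mulr0 add0r. Qed.

Lemma cabs_cext c f x : cabs (cext c f x) = cabs (f (proj c x)) * \1_(Hcoset c) x.
Proof. by rewrite /cext cabsM cabsR ger0_norm ?indic_ge0. Qed.

Lemma cext_L1 c f : f \in cLfun nu 1 <-> cmeasurable f /\ cext c f \in cLfun mu 1.
Proof.
split=> [f1|[mf]].
  have [rf jf] := (cLfun1P _ _).1 f1; split; first exact: cLfun1_measurable f1.
  apply/cLfun1P; split.
    rewrite (_ : (fun x => Re _) = (fun x => Re (f (proj c x)) * \1_(Hcoset c) x)).
      exact: (coset_rintegrable hG lcG hmu oH c (rintegrable_measurable rf)).1 rf.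
    by apply/funext => x; rewrite Re_cext.
  rewrite (_ : (fun x => Im _) = (fun x => Im (f (proj c x)) * \1_(Hcoset c) x)).
    exact: (coset_rintegrable hG lcG hmu oH c (rintegrable_measurable jf)).1 jf.
  by apply/funext => x; rewrite Im_cext.
move=> /cLfun1_cabs[_ fi]; apply/cLfun1_cabs; split => //.
apply/(coset_rintegrable hG lcG hmu oH c); first exact: measurable_cabs.
by under eq_fun do rewrite -cabs_cext.
Qed.

Lemma cext_integral c f : f \in cLfun nu 1 ->
  cintegral mu (cext c f) = (modH c)%:C * cintegral nu f.
Proof.
move=> /cLfun1P[rf jf]; apply: eq_ReIm.
  rewrite cReM /= mul0r subr0 -coset_Rintegral//.
  by congr fine; apply: eq_integral => x _; rewrite Re_cext.
rewrite cImM /= mul0r addr0 -coset_Rintegral//.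
by congr fine; apply: eq_integral => x _; rewrite Im_cext.
Qed.

Lemma cext_L2 c f : f \in cL2fun nu <-> cmeasurable f /\ cext c f \in cL2fun mu.
Proof.
have E x : cabs (cext c f x) ^+ 2 = cabs (f (proj c x)) ^+ 2 * \1_(Hcoset c) x.
  by rewrite cabs_cext exprMn indicE; case: (_ \in _); rewrite ?expr1n ?mulr1 ?expr0n ?mulr0.
have mf2 : cmeasurable f -> measurable_fun setT (fun x => cabs (f x) ^+ 2).
  by move=> mf; apply: measurable_funX; exact: measurable_cabs.
split=> [/cL2P[mf f2]|[mf /cL2P[_ f2]]].
  split => //; apply/cL2P; split; first exact: cext_measurable.
  under eq_fun do rewrite E.
  exact: (coset_rintegrable hG lcG hmu oH c (mf2 mf)).1 f2.
apply/cL2P; split => //; apply/(coset_rintegrable hG lcG hmu oH c); first exact: mf2.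
by under eq_fun do rewrite -E.
Qed.

Lemma cres_L1 c g : g \in cLfun mu 1 -> cres c g \in cLfun nu 1.
Proof.
move=> g1; apply/(cext_L1 c); split; first by apply: cres_measurable; exact: cLfun1_measurable g1.
rewrite (_ : cext c _ = (fun x => g x * (\1_(Hcoset c) x)%:C)).
  by apply: cLfun1_restrict => //; exact: measurable_coset.
by apply/funext => x; exact: cext_res.
Qed.

Lemma cL2_restrict (g : borel G -> R[i]) (B : set (borel G)) : measurable B -> g \in cL2fun mu ->
  (fun x => g x * (\1_B x)%:C) \in cL2fun mu.
Proof.
move=> mB /cL2P[mg g2]; apply: le_cL2 g2.
  apply: cmeasurableM => //; split => /=; last exact: measurable_cst.
  exact: measurable_indic.
move=> x; rewrite cabsM cabsR ger0_norm ?indic_ge0// exprMn.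
by rewrite ler_piMr ?exprn_ge0 ?cabs_ge0// exprn_ile1 ?indic_ge0 ?indic_le1.
Qed.

Lemma cres_L2 c g : g \in cL2fun mu -> cres c g \in cL2fun nu.
Proof.
move=> g2; apply/(cext_L2 c); split.
  by apply: cres_measurable; have [] := (cL2P _ _).1 g2.
rewrite (_ : cext c _ = (fun x => g x * (\1_(Hcoset c) x)%:C)).
  by apply: cL2_restrict => //; exact: measurable_coset.
by apply/funext => x; exact: cext_res.
Qed.

Lemma cext_ae c f g : {ae nu, forall h, f h = g h} -> {ae mu, forall x, cext c f x = cext c g x}.
Proof.
move=> [N [mN N0 PN]]; exists (proj c @^-1` N `&` Hcoset c); split.
- apply: measurableI; last exact: measurable_coset.
  by rewrite -[X in measurable X]setTI; exact: measurable_proj.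
- by rewrite -(coset_measureE mu oH) (modulusE hG lcG hmu oH)// N0 mule0.
move=> x; rewrite /cext/= => fg; have [cx|ncx] := pselect (Hcoset c x).
  by split => //; apply: PN => E; apply: fg; rewrite /= E.
by exfalso; apply: fg; rewrite indicE memNset// !mulr0.
Qed.

Definition cembed c (u : L2 nu) : L2 mu := toL2 mu (cext c (L2repr u)).

(** The adjoint of [cembed c], up to the factor [modH c]. *)
Definition coset_restr c (w : L2 mu) : L2 nu := toL2 nu (cres c (L2repr w)).

Lemma cext_cL2 c f : f \in cL2fun nu -> cext c f \in cL2fun mu.
Proof. by move=> /(cext_L2 c)[]. Qed.

Lemma cembed_toL2 c f : f \in cL2fun nu -> cembed c (toL2 nu f) = toL2 mu (cext c f).
Proof.
move=> f2; apply: eq_toL2; [by apply: cext_cL2; exact: L2repr_cL2|exact: cext_cL2|].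
by apply: cext_ae; exact: L2repr_toL2.
Qed.

Lemma cembed_linear c : linear (cembed c).
Proof.
move=> a u v; rewrite -[u]toL2K -[v]toL2K -toL2_lin ?L2repr_cL2//.
rewrite !cembed_toL2 ?L2repr_cL2//; last by apply: cL2_lin; exact: L2repr_cL2.
rewrite -toL2_lin; [|by apply: cext_cL2; exact: L2repr_cL2..].
by congr toL2; apply/funext => x; rewrite /cext mulrDl mulrA.
Qed.

Lemma cembed_dotr c u w : L2dot (cembed c u) w = (modH c)%:C * L2dot u (coset_restr c w).
Proof.
have u2 := L2repr_cL2 u; have w2 := L2repr_cL2 w.
have r2 := cres_L2 c w2.
rewrite -[in LHS](toL2K w) /cembed L2dot_toL2//; last exact: cext_cL2.
rewrite /coset_restr -[in RHS](toL2K u) L2dot_toL2// -cext_integral; last exact: cL2_mulJ.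
congr cintegral; apply/funext => x; rewrite /cext /cres.
rewrite indicE; have [|_] := boolP (x \in _); last by rewrite !(mulr0, mul0r).
by rewrite inE => cx; rewrite coset_projK// !mulr1.
Qed.

Lemma cembedK c u : coset_restr c (cembed c u) = u.
Proof.
have u2 := L2repr_cL2 u.
have uu2 := cext_cL2 c u2.
apply: L2dot_ext => v; rewrite L2dotC.
have := cembed_dotr c v (cembed c u).
have v2 := L2repr_cL2 v.
rewrite {1}/cembed {1}/cembed L2dot_toL2//; last exact: cext_cL2.
rewrite (_ : (fun x => _ * _) = cext c (fun h => L2repr v h * (L2repr u h)^*)); last first.
  apply/funext => x; rewrite /cext indicE; case: (_ \in _); last by rewrite !(mulr0, mul0r).
  by rewrite !mulr1.
rewrite cext_integral; last exact: cL2_mulJ.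
have mc : (modH c)%:C != 0 :> R[i] by rewrite gt_eqF// ltcR modulus_gt0.
move=> /(mulfI mc) <-; rewrite -L2dot_toL2// !toL2K.
by rewrite [RHS]L2dotC.
Qed.

Lemma cembed_dot c u v : L2dot (cembed c u) (cembed c v) = (modH c)%:C * L2dot u v.
Proof. by rewrite cembed_dotr cembedK. Qed.

Lemma sqr_cembed_norm c u : L2norm (cembed c u) ^+ 2 = modH c * L2norm u ^+ 2.
Proof. by rewrite !sqr_L2norm cembed_dot cReM/= mul0r subr0. Qed.

Lemma cembed_restr c w :
  cembed c (coset_restr c w) = toL2 mu (fun x => L2repr w x * (\1_(Hcoset c) x)%:C).
Proof.
rewrite /coset_restr cembed_toL2; last by apply: cres_L2; exact: L2repr_cL2.
by congr toL2; apply/funext => x; exact: cext_res.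
Qed.

Lemma cembed_orth c d u v : ~ Hcoset c d -> L2dot (cembed c u) (cembed d v) = 0.
Proof.
move=> ncd; rewrite /cembed L2dot_toL2; [|by apply: cext_cL2; exact: L2repr_cL2..].
rewrite (_ : (fun x => _ * _) = fun=> 0); first exact: cintegral0.
apply/funext => x; rewrite /cext !indicE; have [|_] := boolP (x \in Hcoset c); last by rewrite !(mulr0, mul0r).
have [|_] := boolP (x \in Hcoset d); last by rewrite !(mulr0, cconj0).
rewrite !inE => dx cx; exfalso; apply: ncd; apply: coset_trans cx _; exact: coset_sym.
Qed.

Lemma cembed_ltrans c (h : borel Hs) u :
  ltrans (val (h : Hs) : borel G) (cembed c u) = cembed c (ltrans h u).
Proof.
have u2 := L2repr_cL2 u.
have hnu := coset_measure_haar hG hmu oH 1%g.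
rewrite [in RHS]/ltrans cembed_toL2; last exact: ltrans_cL2.
rewrite [in LHS]/cembed (ltrans_toL2 hmu); last exact: cext_cL2.
congr toL2; apply/funext => x; rewrite /cext.
have E : Hcoset c ((val (h : Hs))^-1 * x)%g = Hcoset c x.
  rewrite /coset/= -mulgA; congr is_true; apply: gpredMl.
  by rewrite gpredV; exact: valP.
rewrite !indicE /in_mem/= /in_set E; case: asboolP => cx; last by rewrite !mulr0.
rewrite !mulr1; congr (L2repr u _); apply: val_inj.
rewrite valM val_subgroupV !val_insubd.
move: (E) (cx); rewrite /coset/= => E1 E2; rewrite ifT; last by rewrite E1.
by rewrite ifT// mulgA.
Qed.

(** * Decomposition of L2 along the cosets *)

(** Pairwise distinctness of the cosets [H c] for [c] in [s]. *)
Definition apart (s : seq (borel G)) := pairwise (fun c d => `[< ~ Hcoset c d >]) s.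

Definition csum (s : seq (borel G)) (w : borel G -> L2 nu) : L2 mu := \sum_(c <- s) cembed c (w c).

Lemma sqr_csum_norm s w : apart s ->
  L2norm (csum s w) ^+ 2 = \sum_(c <- s) modH c * L2norm (w c) ^+ 2.
Proof.
rewrite /csum; elim: s => [|c s IH]; first by rewrite !big_nil L2norm0 expr0n.
rewrite /apart/= => /andP[/allP cs /IH {}IH]; rewrite !big_cons sqr_L2normD IH sqr_cembed_norm.
suff -> : L2dot (cembed c (w c)) (\sum_(d <- s) cembed d (w d)) = 0.
  by rewrite mulr0 addr0.
elim: s cs {IH} => [|d s IH] cs; first by rewrite big_nil L2dot0r.
rewrite big_cons L2dotDr IH; last by move=> x xs; apply: cs; rewrite inE xs orbT.
by rewrite cembed_orth ?addr0//; apply/asboolP; apply: cs; rewrite inE eqxx.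
Qed.

Lemma ex_apart (s : seq (borel G)) : exists2 s', apart s' & forall c, c \in s -> exists2 d, d \in s' & Hcoset d c.
Proof.
elim: s => [|c s [s' as' Hs']]; first by exists [::].
have [[d ds' dc]|nc] := pselect (exists2 d, d \in s' & Hcoset d c).
  exists s' => // x; rewrite inE => /predU1P[->|/Hs'//]; by exists d.
exists (c :: s').
  rewrite /apart/= -/(apart s') as' andbT; apply/allP => d ds'; apply/asboolP => cd; apply: nc.
  by exists d => //; exact: coset_sym.
move=> x; rewrite inE => /predU1P[->|/Hs'[d ds' dx]].
  by exists c; rewrite ?inE ?eqxx//; exact: coset_refl.
by exists d => //; rewrite inE ds' orbT.
Qed.

Definition cunion (s : seq (borel G)) : set (borel G) := [set x | exists2 c, c \in s & Hcoset c x].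

Lemma measurable_cunion s : measurable (cunion s).
Proof.
rewrite (_ : cunion s = \big[setU/set0]_(c <- s) Hcoset c).
  by apply: bigsetU_measurable => c _; exact: measurable_coset.
rewrite -bigcup_seq; apply/seteqP; split=> x [c cs cx]; by exists c.
Qed.

Lemma csum_restr s v : apart s ->
  csum s (coset_restr^~ v) = toL2 mu (fun x => L2repr v x * (\1_(cunion s) x)%:C).
Proof.
have v2 := L2repr_cL2 v.
rewrite /csum; elim: s => [|c s IH] as'.
  rewrite big_nil -[LHS]toL2K; apply: eq_toL2; first exact: L2repr_cL2.
    by apply: cL2_restrict => //; exact: measurable_cunion.
  apply: filterS (L2repr0 mu) => x ->; rewrite indicE memNset ?mulr0//.
  by case=> c; rewrite in_nil.
move: as'; rewrite /apart/= => /andP[/allP cs /IH {}IH]; rewrite big_cons IH cembed_restr.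
rewrite -[X in X + _]scale1r -toL2_lin; [|apply: cL2_restrict v2; exact: measurable_coset|apply: cL2_restrict v2; exact: measurable_cunion].
congr toL2; apply/funext => x; rewrite mul1r -mulrDr -rmorphD; congr (_ * _%:C).
rewrite !indicE; have [|nx] := boolP (x \in Hcoset c).
  rewrite inE => cx; rewrite memNset ?addr0; last first.
    case=> d ds dx; have /asboolP := cs d ds; apply; apply: coset_trans cx _; exact: coset_sym.
  by rewrite mem_set//; exists c; rewrite ?inE ?eqxx.
rewrite add0r; congr (nat_of_bool _)%:R; apply/idP/idP; rewrite !inE => -[d ds dx].
  by exists d; rewrite ?inE ?ds ?orbT.
move: ds nx; rewrite inE => /predU1P[dc|ds]; last by exists d.
by rewrite notin_setE -dc.
Qed.

(** [|v|^2] has little mass outside some compact set, and finitely many cosets, which are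
    open, cover it. *)
Lemma csum_dense v (e : R) : 0 < e -> exists s w, apart s /\ L2norm (v - csum s w) <= e.
Proof.
move=> e0; have v2 := L2repr_cL2 v; have [mv iv] := (cL2P _ _).1 v2.
have [K cK HK] := haar_tail hG hmu iv (fun x => exprn_ge0 2 (cabs_ge0 _)) (exprn_gt0 2 e0).
have [s Hs] := compact_seq_cover cK (fun x => @open_coset G H oH x) (fun x _ => coset_refl H x).
have [s' as' Hs'] := ex_apart s.
exists s', (coset_restr^~ v); split => //.
have mK := borel_compact (hG : hausdorff_space (borel G)) cK.
have mU := measurable_cunion s'.
have r2 := cL2_restrict mU v2.
rewrite L2normBC csum_restr// toL2B// -(@ler_pXn2r _ 2) ?nnegrE ?L2norm_ge0 ?(ltW e0)//.
rewrite sqr_L2norm_toL2; last exact: cL2B.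
apply: le_trans HK; apply: le_Rintegral => //.
- by have [] := (cL2P _ _).1 (cL2B r2 v2).
- apply: (le_rintegrable (h' := fun x => cabs (L2repr v x) ^+ 2)) => //.
    apply: measurable_funM; first exact: rintegrable_measurable iv.
    by apply: measurable_indic; exact: measurableC.
  move=> x; rewrite ger0_norm ?mulr_ge0 ?exprn_ge0 ?cabs_ge0 ?indic_ge0//.
  by rewrite ler_piMr ?indic_le1// exprn_ge0 ?cabs_ge0.
move=> x _; rewrite !indicE in_setC.
have [xK|xK] := boolP (x \in K); last first.
  rewrite /= mulr1 -{2}[L2repr v x]mulr1 -mulrBr cabsM exprMn ler_piMr ?exprn_ge0 ?cabs_ge0//.
  by case: (_ \in _); rewrite ?subrr ?sub0r ?cabsN ?cabs0 -?[1]/(1%:C) ?cabsR ?normr1 ?expr0n ?expr1n.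
rewrite mem_set ?mulr1 ?subrr ?cabs0 ?expr0n ?mulr0//.
move: xK; rewrite inE => /Hs[c cs cx]; have [d ds' dc] := Hs' c cs.
by exists d => //; exact: coset_trans dc cx.
Qed.

End CosetEmbedding.

(** * Transfer of operators from an open subgroup *)

Section Linked.
Variables (R : realType) (G : topologicalGroupType).
Hypothesis hG : hausdorff_space G.
Hypothesis lcG : locally_compact [set: G].
Variable mu : {measure set (borel G) -> \bar R}.
Hypothesis hmu : left_haar mu.
Variable H : groupClosed G.
Hypothesis oH : open [set` H].
Local Notation Hs := (subgroup_type H).
Local Notation nu := (coset_measure mu oH 1%g).
Local Notation modH := (modulus hG lcG hmu oH).
Local Notation J := (cembed (oH := oH) (mu := mu)).
Let hnu : left_haar nu := coset_measure_haar hG hmu oH 1%g.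

(** [T] acts on each coset [H c] as a copy of [S]. On [L1] this is extension of
    functions by zero, and it embeds the reduced algebra of [H] isometrically into
    that of [G]. *)
Definition linked (S : L2 nu -> L2 nu) (T : L2 mu -> L2 mu) :=
  forall c u, T (J c u) = J c (S u).

Let cembed_lin c : linear (J c).
Proof. exact: cembed_linear. Qed.

Lemma linked_csum S T s w : linear T -> linked S T ->
  T (csum s w) = csum s (fun c => S (w c)).
Proof. by move=> Tl ST; rewrite /csum lin_sum//; apply: eq_bigr => c _; exact: ST. Qed.

(** [L2(G)] is the orthogonal sum of copies of [L2(H)], rescaled by [modH c], and [T]
    acts as [S] on each summand. *)
Lemma linked_bound S T (M : R) : bounded_operator T -> 0 <= M -> linked S T ->
  opbound S M -> opbound T M.
Proof.
move=> Tb M0 ST SM v; have [N N0 TN] := bounded_opbound Tb.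
apply/ler_addgt0Pr => /= e e0; have NM0 : 0 < N + M + 1 by rewrite ltr_wpDl ?addr_ge0.
have [s [w [as' sw]]] := csum_dense hG lcG hmu oH v (divr_gt0 e0 NM0).
have Hs : L2norm (T (csum s w)) <= M * L2norm (csum s w).
  rewrite (linked_csum _ _ Tb.1 ST) -(@ler_pXn2r _ 2) ?nnegrE ?mulr_ge0 ?L2norm_ge0//.
  rewrite exprMn [leLHS](sqr_csum_norm hG lcG hmu (fun c => S (w c)) as').
  rewrite [X in _ * X](sqr_csum_norm hG lcG hmu w as') mulr_sumr; apply: ler_sum => c _.
  rewrite (mulrCA (M ^+ 2)) ler_wpM2l ?(ltW (modulus_gt0 hG lcG hmu oH c))// -exprMn.
  by rewrite ler_pXn2r ?nnegrE ?mulr_ge0 ?L2norm_ge0//; exact: SM.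
rewrite -[v in T v](subrK (csum s w)) (linD _ _ Tb.1).
apply: le_trans (L2normD _ _) _.
apply: le_trans (lerD (TN _) Hs) _.
have H2 : L2norm (csum s w) <= L2norm v + L2norm (v - csum s w).
  by rewrite -[csum s w](subKr v) -{1}[csum s w](subKr v); exact: L2normB.
apply: le_trans (lerD (lexx _) (ler_wpM2l M0 H2)) _.
rewrite mulrDr addrCA -mulrDl lerD2l.
apply: le_trans (ler_wpM2l _ sw) _; first exact: addr_ge0.
by rewrite mulrCA ler_piMr ?(ltW e0)// ler_pdivrMr// mul1r lerDl.
Qed.

Lemma linked_boundV S T (M : R) : 0 <= M -> linked S T -> opbound T M -> opbound S M.
Proof.
move=> M0 ST TM u; have := TM (J 1%g u); rewrite ST.
rewrite -(@ler_pXn2r _ 2) ?nnegrE ?mulr_ge0 ?L2norm_ge0// exprMn.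
rewrite [leLHS](sqr_cembed_norm hG lcG hmu 1%g (S u)) [X in _ <= _ * X](sqr_cembed_norm hG lcG hmu 1%g u).
rewrite (mulrCA (M ^+ 2)) ler_pM2l ?modulus_gt0//.
by rewrite -exprMn ler_pXn2r// ?nnegrE ?mulr_ge0 ?L2norm_ge0.
Qed.

Lemma linked_lin a S S' T T' : linked S T -> linked S' T' -> linked (a *: S + S') (a *: T + T').
Proof.
move=> ST ST' c u; rewrite -[LHS]/(a *: T (J c u) + T' (J c u)) ST ST'.
by rewrite -(cembed_lin c).
Qed.

Lemma linkedZ a S T : linked S T -> linked (a *: S) (a *: T).
Proof.
move=> ST c u; rewrite -[LHS]/(a *: T (J c u)) ST -(linZ _ _ (cembed_lin c)).
by [].
Qed.

Lemma linkedB S S' T T' : linked S T -> linked S' T' -> linked (S - S') (T - T').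
Proof.
move=> ST ST' c u; rewrite -[LHS]/(T (J c u) - T' (J c u)) ST ST'.
by rewrite -(linB _ _ (cembed_lin c)).
Qed.

Lemma linked_comp S S' T T' : linked S T -> linked S' T' -> linked (S \o S') (T \o T').
Proof. by move=> ST ST' c u; rewrite /comp ST' ST. Qed.

Lemma linked0 : linked 0 0.
Proof. by move=> c u; rewrite -[LHS]/0 -[X in J c X]/0 (lin0 (cembed_lin c)). Qed.

Lemma linked_opoly p S T : linked S T -> linked (opoly p S) (opoly p T).
Proof.
move=> ST c u; rewrite /opoly (lin_sum _ _ _ (cembed_lin c)); apply: eq_bigr => i _.
rewrite (linZ _ _ (cembed_lin c)); congr (_ *: _).
by elim: (nat_of_ord i) => //= n ->; rewrite ST.
Qed.

Lemma linked_unique S T T' : bounded_operator T -> bounded_operator T' ->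
  linked S T -> linked S T' -> T = T'.
Proof.
move=> Tb Tb' ST ST'; apply/funext => v.
have H0 : opbound (S - S) 0 by move=> u; rewrite -[(_ - _) u]/(S u - S u) subrr L2norm0 mul0r.
have := linked_bound (boundedB Tb Tb') (lexx 0) (linkedB ST ST') H0 v.
rewrite mul0r -[(_ - _) v]/(T v - T' v) => H1.
by apply/eqP; rewrite -subr_eq0; apply/eqP/L2norm_eq0/eqP; rewrite eq_le H1 L2norm_ge0.
Qed.

(** [cembed c] intertwines the translations by [H], so it intertwines their averages. *)
Lemma linked_integrated_form f S T : f \in cLfun nu 1 -> integrated_form f S ->
  integrated_form (cext 1%g f) T -> linked S T.
Proof.
move=> f1 /(integrated_formP hnu)[Sb SE] /(integrated_formP hmu)[Tb TE] c u.
apply: L2dot_ext => w; rewrite TE (cembed_dotr hG lcG hmu) SE.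
have E (F : borel G -> R[i]) :
    (fun y => cext 1%g f y * F y) = cext 1%g (fun h => f h * F (val (h : Hs))).
  apply/funext => y; rewrite /cext indicE; have [|_] := boolP (y \in _); last by rewrite !(mulr0, mul0r).
  rewrite inE => y1; rewrite !mulr1; congr (_ * F _).
  by rewrite -{1}(coset_projK y1) /coset_inj mulg1.
have E2 : (fun h : borel Hs => f h * L2dot (ltrans (val (h : Hs) : borel G) (J c u)) w) =
    (fun h => (modH c)%:C * (f h * L2dot (ltrans h u) (coset_restr oH c w))).
  apply/funext => h; rewrite (cembed_ltrans hG lcG hmu) (cembed_dotr hG lcG hmu).
  by rewrite mulrCA.
have i1 : (fun h => f h * L2dot (ltrans h u) (coset_restr oH c w)) \in cLfun nu 1.
  by apply: cLfun1_coef => //; exact: subgroup_hausdorff.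
rewrite (E (fun y => L2dot (ltrans y (J c u)) w)) E2 (cext_integral hG lcG hmu); last exact: cLfun1Z.
by rewrite modulus1 cintegralZ// mul1r.
Qed.

Lemma L1_operators_linked S : L1_operators nu S -> exists2 T, L1_operators mu T & linked S T.
Proof.
move=> [f f1 fS]; have e1 := ((cext_L1 hG lcG hmu oH 1%g f).1 f1).2.
have [T fT] := ex_integrated_form hG hmu e1.
by exists T; [exists (cext 1%g f)|exact: linked_integrated_form f1 fS fT].
Qed.

Lemma linked_L1 S T : bounded_operator T -> linked S T -> L1_operators nu S -> L1_operators mu T.
Proof.
move=> Tb ST /L1_operators_linked[T' L1T' ST'].
by rewrite (linked_unique Tb (L1_operators_bounded L1T') ST ST').
Qed.

(** If [S] is the limit of [S' n] in L1, then the operators linked to [S' n] form a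
    Cauchy sequence, because linking is isometric. *)
Lemma reduced_algebra_linked S : reduced_algebra nu S ->
  exists2 T, reduced_algebra mu T & linked S T.
Proof.
move=> /reduced_algebraP[Sb HS].
have /choice[S' HS'] : forall n : nat, exists S', L1_operators nu S' /\ opbound (S - S') n.+1%:R^-1.
  by move=> n; have [|S' ? ?] := HS n.+1%:R^-1; [rewrite invr_gt0|exists S'].
have /choice[T' HT'] : forall n, exists T, L1_operators mu T /\ linked (S' n) T.
  by move=> n; have [T ? ?] := L1_operators_linked (HS' n).1; exists T.
have Tb n : bounded_operator (T' n) by exact: L1_operators_bounded (HT' n).1.
have small := @ex_natSinv_le R.
have [e e0|X Xb HX] := operators_complete Tb.
  have [N HN] := small _ (divr_gt0 e0 (ltr0n _ 2)); exists N => m n /HN Hm /HN Hn.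
  apply: (linked_bound (boundedB (Tb m) (Tb n)) (ltW e0) (linkedB (HT' m).2 (HT' n).2)).
  have b := opbound_tri (opboundBC (HS' m).2) (HS' n).2.
  by apply: opboundW b; rewrite [e]splitr; exact: lerD.
exists X.
  apply/reduced_algebraP; split => // e e0; have [N HN] := HX e e0.
  by exists (T' N); [exact: (HT' N).1|apply: opboundBC; exact: HN].
move=> c u; apply/eqP; rewrite -subr_eq0; apply/eqP/L2norm_eq0/eqP.
rewrite eq_le L2norm_ge0 andbT; apply/ler_addgt0Pr => /= e e0; rewrite add0r.
have [M M0 JM] : exists2 M : R, 0 <= M & forall u, L2norm (J c u) <= M * L2norm u.
  exists (Num.sqrt (modH c)); first exact: sqrtr_ge0.
  move=> x; rewrite -(@ler_pXn2r _ 2) ?nnegrE ?mulr_ge0 ?sqrtr_ge0 ?L2norm_ge0//.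
  have m0 := ltW (modulus_gt0 hG lcG hmu oH c).
  rewrite [leLHS](sqr_cembed_norm hG lcG hmu c x) exprMn.
  by rewrite ler_wpM2r ?exprn_ge0 ?L2norm_ge0// sqr_sqrtr.
pose B := M * L2norm u + 1; have B0 : 0 < B by rewrite ltr_wpDl// mulr_ge0 ?L2norm_ge0.
have e2 : 0 < e / 2 / B by rewrite !divr_gt0.
have [N1 H1] := HX _ e2; have [N2 H2] := small _ e2.
pose n := maxn N1 N2.
apply: le_trans (L2norm_tri _ (T' n (J c u)) _) _; rewrite (HT' n).2 [e]splitr; apply: lerD.
  rewrite -(HT' n).2; have := opboundBC (H1 n (leq_maxl _ _)) (J c u).
  rewrite -[(X - T' n) _]/(X (J c u) - T' n (J c u)) => /le_trans; apply.
  apply: le_trans (ler_wpM2l (ltW e2) (JM u)) _.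
  by rewrite mulrAC ler_pdivrMr// ler_wpM2l ?divr_ge0 ?(ltW e0)// lerDl.
rewrite -(linB _ _ (cembed_lin c)); apply: le_trans (JM _) _.
have := opboundBC (HS' n).2 u; rewrite -[(S' n - S) u]/(S' n u - S u) => h.
apply: le_trans (ler_wpM2l M0 (le_trans h (ler_wpM2r (L2norm_ge0 _) (H2 n (leq_maxr _ _))))) _.
by rewrite mulrCA mulrAC ler_pdivrMr// ler_wpM2l ?divr_ge0 ?(ltW e0)// lerDl.
Qed.

End Linked.

(** * Compactly generated open subgroups *)

Section GeneratedSubgroup.
Variables (G : topologicalGroupType) (K : set G).

Definition generated : {pred G} :=
  [pred x | x \in smallest (fun A : set G => group_closed (mem A)) K].

Lemma generatedP x : reflect (smallest (fun A : set G => group_closed (mem A)) K x)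
  (x \in generated).
Proof. by apply: (iffP idP); rewrite inE. Qed.

Lemma generated_group_closed : group_closed generated.
Proof.
split; first by apply/generatedP => A [[A1 _] _]; rewrite -in_setE; exact: A1.
move=> x y /generatedP Hx /generatedP Hy; apply/generatedP => A AK.
have [[_ AB] _] := AK; rewrite -in_setE; apply: AB; rewrite -topredE/= in_setE.
  exact: Hx.
exact: Hy.
Qed.

HB.instance Definition _ := isMulClosed.Build G generated
  (group_closedM generated_group_closed).
HB.instance Definition _ := isMul1Closed.Build G generated generated_group_closed.1.
HB.instance Definition _ := isInvClosed.Build G generated
  (group_closedV generated_group_closed).
End GeneratedSubgroup.

Lemma ex_open_compactly_generated (G : topologicalGroupType) (K : set G) :
  locally_compact [set: G] -> compact K ->
  exists H : groupClosed G, [/\ open [set` H], compactly_generated H & K `<=` [set` H]].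
Proof.
move=> lcG cK; have [C cC C1] := ex_compact_nbhs1 (lcG : locally_compact [set: borel G]).
have cKC : compact (K `|` C) by exact: compactU.
pose H : groupClosed G := generated (K `|` C).
have KH : K `|` C `<=` [set` H] by move=> x KCx; apply/generatedP; exact: sub_gen_smallest.
exists H; split.
- rewrite openE => x Hx; rewrite /interior/= nbhsE.
  exists [set y | C° (x^-1 * y)%g].
    split; first exact: open_mulgl (open_interior C).
    by rewrite /= mulVg.
  move=> y /= /interior_subset Cy; rewrite -[y](mulVKg x).
  by apply: gpredM => //; apply: KH; right.
- by exists (K `|` C) => //; apply/seteqP; split=> x /generatedP.
- by move=> x Kx; apply: KH; left.
Qed.

(** * Ideals *)

Section Ideals.
Variables (R : realType) (G : topologicalGroupType).
Hypothesis hG : hausdorff_space G.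
Hypothesis lcG : locally_compact [set: G].
Variable mu : {measure set (borel G) -> \bar R}.
Hypothesis hmu : left_haar mu.

Lemma reduced_algebra_ideal : closed_ideal mu (reduced_algebra mu).
Proof.
split.
- by [].
- exact: reduced_algebra0.
- exact: reduced_algebra_lin.
- by move=> S S'; exact: reduced_algebra_comp.
- by move=> S S'; exact: reduced_algebra_comp.
- exact: reduced_algebra_closed.
Qed.

Variable I : set (L2 mu -> L2 mu).
Hypothesis idI : closed_ideal mu I.

Lemma ideal_bounded : I `<=` bounded_operator (mu := mu).
Proof. by move=> S /(ideal_sub idI); exact: reduced_algebra_bounded. Qed.

Lemma ideal_limit S : bounded_operator S ->
  (forall e : R, 0 < e -> exists2 S', I S' & opbound (S - S') e) -> I S.
Proof. by move=> Sb HS; apply: (ideal_closed idI); apply/(opclosureP _ ideal_bounded). Qed.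

Lemma idealD S S' : I S -> I S' -> I (S + S').
Proof. by move=> IS IS'; rewrite -[S]scale1r; exact: ideal_linear. Qed.

Lemma idealZ a S : I S -> I (a *: S).
Proof. by move=> IS; rewrite -[_ *: _]addr0; apply: ideal_linear => //; exact: ideal_zero. Qed.

Lemma idealB S S' : I S -> I S' -> I (S - S').
Proof. by move=> IS IS'; rewrite addrC -scaleN1r; exact: ideal_linear. Qed.

Lemma ideal_opoly_left p X S : reduced_algebra mu X -> I S -> I (opoly p X \o S).
Proof.
move=> AX; elim/poly_ind: p S => [|p c IH] S IS.
  rewrite (_ : _ \o _ = 0); first exact: ideal_zero idI.
  by apply/funext => u; rewrite /comp -[0]/(0%:P) opolyC scale0r.
rewrite (_ : _ \o S = c%:C *: S + (opoly p X \o (X \o S))).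
  by apply: (ideal_linear idI) => //; apply: IH; exact: (ideal_left idI).
by apply/funext => u; rewrite /comp opolyD opolyMX opolyC addrC.
Qed.

Lemma ideal_opoly_right p X S : reduced_algebra mu X -> I S -> I (S \o opoly p X).
Proof.
move=> AX IS; have Sl := (ideal_bounded IS).1; elim/poly_ind: p => [|p c IH].
  rewrite (_ : _ \o _ = 0); first exact: ideal_zero idI.
  by apply/funext => u; rewrite /comp (opolyC 0) scale0r (lin0 Sl).
rewrite (_ : S \o _ = c%:C *: S + ((S \o opoly p X) \o X)).
  by apply: (ideal_linear idI) => //; exact: (ideal_right idI).
apply/funext => u; rewrite /comp opolyD opolyMX opolyC addrC (linD _ _ Sl) (linZ _ _ Sl).
by [].
Qed.

(** If [X] is within [eta] of [I0 : I], expanding [(X - I0)^k] shows that [X^k] is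
    within [eta^k] of [I]. *)
Lemma ideal_power X I0 (eta : R) k : reduced_algebra mu X -> I I0 -> 0 <= eta ->
  opbound (X - I0) eta -> exists2 Ik, I Ik & opbound (opoly 'X^(k.+1) X - Ik) (eta ^+ k.+1).
Proof.
move=> AX II0 eta0 XI; have Xb := reduced_algebra_bounded AX; have Xl := Xb.1.
elim: k => [|k [Ik IIk HIk]].
  exists I0 => // u; have := XI u.
  by rewrite expr1 -[(_ - _) u]/(X u - I0 u) -[(opoly _ _ - _) u]/(opoly 'X^1 X u - I0 u) expr1 opolyX.
have I0l := (ideal_bounded II0).1.
exists (X \o Ik + (I0 \o opoly 'X^(k.+1) X) - (I0 \o Ik)).
  have I1 := ideal_left idI (ideal_sub idI II0) IIk.
  have I2 := ideal_left idI AX IIk.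
  have I3 := ideal_opoly_right 'X^(k.+1) AX II0.
  exact: idealB (idealD I2 I3) I1.
have := opbound_comp eta0 XI HIk; rewrite -exprS.
rewrite (_ : (X - I0) \o (opoly 'X^(k.+1) X - Ik) = opoly 'X^(k.+2) X -
  (X \o Ik + (I0 \o opoly 'X^(k.+1) X) - (I0 \o Ik)))//.
apply/funext => u.
rewrite -[LHS]/(X (opoly 'X^(k.+1) X u - Ik u) - I0 (opoly 'X^(k.+1) X u - Ik u)).
rewrite -[RHS]/(opoly 'X^(k.+2) X u - (X (Ik u) + I0 (opoly 'X^(k.+1) X u) - I0 (Ik u))).
rewrite (linB _ _ Xl) (linB _ _ I0l) (exprS 'X k.+1) opolyM// opolyX.
by rewrite -addrA -opprD addrA.
Qed.

End Ideals.

(** * Approximation of an ideal from an open subgroup *)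

Lemma geometric_telescope (R : comNzRingType) (s : {poly R}) n :
  (1 - s) * (\sum_(j < n) s ^+ j) = 1 - s ^+ n.
Proof.
elim: n => [|n IH]; first by rewrite big_ord0 mulr0 expr0 subrr.
by rewrite big_ord_recr mulrDr IH mulrBl mul1r addrA subrK exprS.
Qed.

(** The maximum of [t (1 - t)^m] is at most [1 / (m + 1)], because
    [1 = (t + (1 - t))^(m+1)] dominates [(m + 1) t (1 - t)^m]. *)
Lemma peak_le (R : realFieldType) (t : R) m : 0 <= t <= 1 ->
  m.+1%:R * (t * (1 - t) ^+ m) <= 1.
Proof.
move=> /andP[t0 t1]; have s0 : 0 <= 1 - t by rewrite subr_ge0.
suff H : m.+1%:R * (t * (1 - t) ^+ m) + (1 - t) ^+ m.+1 <= 1.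
  by apply: le_trans H; rewrite lerDl exprn_ge0.
elim: m => [|m IH]; first by rewrite expr0 expr1 mulr1 mul1r addrCA subrr addr0.
have s1 : (1 - t) ^+ m.+1 <= 1 by rewrite exprn_ile1// gerBl.
rewrite [leLHS](_ : _ = (1 - t) * (m.+1%:R * (t * (1 - t) ^+ m) + (1 - t) ^+ m.+1) +
  t * (1 - t) ^+ m.+1); last first.
  have -> : m.+2%:R = 1 + m.+1%:R :> R by rewrite -[m.+2]add1n natrD.
  by rewrite !exprS; move: ((1 - t) ^+ m) (m.+1%:R) => p q; ring.
apply: (@le_trans _ _ ((1 - t) * 1 + t * 1)); last by rewrite !mulr1 subrK.
by apply: lerD; rewrite ler_wpM2l.
Qed.

Section Square.
Context d (T : measurableType d) (R : realType).
Variable mu : {measure set T -> \bar R}.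
Variables b b' : L2 mu -> L2 mu.
Hypotheses (bl : linear b) (bl' : linear b') (bb' : adjoint b b') (b1 : opbound b 1).

Lemma square_dot u v : L2dot ((b' \o b) u) v = L2dot (b u) (b v).
Proof. by rewrite /comp (adjointC bb'). Qed.

Lemma square_positive_contraction : positive_contraction (b' \o b).
Proof.
split.
- by move=> a u v; rewrite /comp bl bl'.
- by move=> u v; rewrite square_dot bb'.
- by move=> u; rewrite square_dot -sqr_L2norm sqr_ge0.
- move=> u; rewrite square_dot -sqr_L2norm ler_pXn2r ?nnegrE ?L2norm_ge0//.
  by have := b1 u; rewrite mul1r.
Qed.

(** [|b (1 - x)^n|^2 = |x (1 - x)^(2n)| <= 1 / (2n + 1)] for [x = b^* b]. *)
Lemma square_decay n (dl : R) : 0 <= dl -> 1 <= n.*2.+1%:R * dl ^+ 2 ->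
  opbound (b \o opoly ((1 - 'X) ^+ n) (b' \o b)) dl.
Proof.
move=> dl0 Hdl u; set x := b' \o b; have xp : positive_contraction x := square_positive_contraction.
have xl := pc_linear xp.
pose p : {poly R} := (1 - 'X) ^+ n.
rewrite -[(b \o _) u]/(b (opoly p x u)); set y := opoly p x u.
rewrite -(@ler_pXn2r _ 2) ?nnegrE ?mulr_ge0 ?L2norm_ge0// sqr_L2norm -square_dot -/x.
have -> : L2dot (x y) y = L2dot (opoly (p * ('X * p)) x u) u.
  by rewrite [in RHS]opolyM// [in RHS]opolyM// opolyX (opoly_adjoint p xp).
apply: le_trans (Re_L2dot_le _ _) _.
have H : opbound (opoly (p * ('X * p)) x) (dl ^+ 2).
  apply: opoly_bound => // t t01; have /andP[t0 t1] := t01.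
  have pE : p.[t] = (1 - t) ^+ n by rewrite /p horner_exp !hornerE.
  rewrite !hornerM hornerX pE mulrCA -exprD addnn.
  rewrite ger0_norm ?mulr_ge0 ?exprn_ge0 ?subr_ge0//.
  have := peak_le n.*2 t01; have N0 : 0 < n.*2.+1%:R :> R by rewrite ltr0n.
  move=> H; rewrite -(ler_pM2l N0); exact: le_trans H Hdl.
apply: le_trans (ler_wpM2r (L2norm_ge0 _) (H u)) _.
by rewrite exprMn -mulrA -expr2.
Qed.

End Square.

Lemma adjoint_opbound d (T : measurableType d) (R : realType) (mu : {measure set T -> \bar R})
  (S S' : L2 mu -> L2 mu) (M : R) : 0 <= M -> adjoint S S' -> opbound S M -> opbound S' M.
Proof.
move=> M0 SS' SM u; apply: L2norm_le_dot; first by rewrite mulr_ge0 ?L2norm_ge0.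
move=> v; rewrite (adjointC SS'); apply: le_trans (Re_L2dot_le _ _) _.
by rewrite mulrAC mulrC; apply: ler_wpM2r; [exact: L2norm_ge0|exact: SM].
Qed.

Lemma geometric_sum_le (R : realFieldType) n (t : R) : 0 <= t <= 1 ->
  `|(\sum_(j < n) (1 - 'X) ^+ j).[t]| <= n%:R.
Proof.
move=> /andP[t0 t1]; rewrite horner_sum; apply: le_trans (ler_norm_sum _ _ _) _.
rewrite -[n in leRHS]card_ord -sum1_card natr_sum; apply: ler_sum => j _.
rewrite horner_exp !hornerE normrX exprn_ile1// ger0_norm ?subr_ge0//.
by rewrite gerBl.
Qed.

Section LocalApproximation.
Variables (R : realType) (G : topologicalGroupType).
Hypothesis hG : hausdorff_space G.
Hypothesis lcG : locally_compact [set: G].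
Variable mu : {measure set (borel G) -> \bar R}.
Hypothesis hmu : left_haar mu.
Variable I : set (L2 mu -> L2 mu).
Hypothesis idI : closed_ideal mu I.

Section Subgroup.
Variable H : groupClosed G.
Hypothesis oH : open [set` H].
Local Notation Hs := (subgroup_type H).
Local Notation nu := (coset_measure mu oH 1%g).
Let hnu : left_haar nu := coset_measure_haar hG hmu oH 1%g.
Let hGs : hausdorff_space Hs := subgroup_hausdorff hG (H := H).
Let lcGs : locally_compact [set: borel Hs] := subgroup_locally_compact hG lcG oH.

(** For [x = b^* b] and [X = B^* B], the latter close to [I], the cut-off
    [z = max (x - 2 eta, 0)] has its counterpart [Z] in [I]: approximately
    [Z = h(X) X^k] with [|h| <= (2 eta)^-k], while [X^k] is within [eta^k] of [I].
    Then [B Z r(X)], where [r(X)] is a truncated geometric series inverting [X],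
    lies in [I] and is close to [B]. *)
Lemma ideal_local_subgroup b B a (eta dl : R) n :
  reduced_algebra nu b -> reduced_algebra mu B -> linked b B -> I a ->
  0 < eta -> 2 * eta <= 1 -> 0 <= dl -> 1 <= n.*2.+1%:R * dl ^+ 2 ->
  opbound (a - B) eta -> opbound B 1 ->
  exists S T, [/\ reduced_algebra nu S, linked S T, I T &
    opbound (a - T) (eta + (dl + 2 * eta * n%:R))].
Proof.
move=> Ab AB lb Ia e0 e1 dl0 Hdl aB B1.
have bb := reduced_algebra_bounded Ab; have Bb := reduced_algebra_bounded AB.
have [b' Ab' adj] := reduced_algebra_adjoint hGs hnu lcGs Ab.
have [B' AB' lb'] := reduced_algebra_linked hG lcG hmu Ab'.
have bb' := reduced_algebra_bounded Ab'; have Bb' := reduced_algebra_bounded AB'.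
have b1 : opbound b 1 := linked_boundV hG lcG hmu ler01 lb B1.
have b1' : opbound b' 1 := adjoint_opbound ler01 adj b1.
have B1' : opbound B' 1 := linked_bound hG lcG hmu Bb' ler01 lb' b1'.
pose x := b' \o b; pose X := B' \o B.
have lx : linked x X := linked_comp lb' lb.
have lp p : linked (opoly p x) (opoly p X) := linked_opoly hG lcG hmu p lx.
have Ax : reduced_algebra nu x := reduced_algebra_comp hGs hnu Ab' Ab.
have AX : reduced_algebra mu X := reduced_algebra_comp hG hmu AB' AB.
have xb := reduced_algebra_bounded Ax; have Xb := reduced_algebra_bounded AX.
have xp : positive_contraction x := square_positive_contraction bb.1 bb'.1 adj b1.
have idA := reduced_algebra_ideal hGs hnu.
pose i0 := B' \o a; have Ii0 : I i0 := ideal_left idI AB' Ia.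
have XI : opbound (X - i0) eta.
  move=> u; rewrite -[(X - i0) u]/(B' (B u) - B' (a u)) -(linB _ _ Bb'.1).
  apply: le_trans (B1' _) _; rewrite mul1r L2normBC; exact: aB.
have c0 : 0 < 2 * eta by rewrite mulr_gt0.
have [z zb [zx Hz]] := cutoff_operator xp (introT andP (conj c0 e1)).
have Az : reduced_algebra nu z.
  apply: (ideal_limit idA zb) => e ep; have [h [_ Hh]] := Hz 1%N e ep.
  exists (opoly (h * 'X^1) x); last exact: Hh.
  have -> : opoly (h * 'X^1) x = opoly h x \o x.
    by apply/funext => u; rewrite expr1; exact: opolyMX.
  exact (ideal_opoly_left idA h Ax Ax).
have [Z AZ lZ] := reduced_algebra_linked hG lcG hmu Az.
have Zb := reduced_algebra_bounded AZ.
have IZ : I Z.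
  apply: (ideal_limit idI Zb) => e ep; have e3 : 0 < e / 3 by rewrite divr_gt0.
  have [k Hk] : exists k : nat, (2^-1 : R) ^+ k.+1 <= e / 3.
    have [k _ Hk] := near_infty_natSinv_expn_lt (PosNum e3).
    exists k; have := Hk k (leqnn k); rewrite div1r -exprVn => /ltW.
    apply: le_trans; rewrite exprS ger_pMl ?exprn_gt0 ?invr_gt0//.
    by rewrite invf_le1// ler1n.
  have [h [h1 h2]] := Hz k.+1 (e / 3) e3.
  have [Ik IIk HIk] := ideal_power idI k AX Ii0 (ltW e0) XI.
  exists (opoly h X \o Ik); first exact (ideal_opoly_left idI h AX IIk).
  have hXb := opoly_bounded h Xb.
  have M0 : 0 <= (2 * eta)^-1 ^+ k.+1 + e / 3.
    by rewrite addr_ge0 ?exprn_ge0 ?invr_ge0 ?(ltW c0)// ltW.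
  have P1 : opbound (opoly h X) ((2 * eta)^-1 ^+ k.+1 + e / 3).
    exact (linked_bound hG lcG hmu hXb M0 (lp h) h1).
  have P2 : opbound (Z - opoly (h * 'X^(k.+1)) X) (e / 3).
    have Db := boundedB Zb (opoly_bounded (h * 'X^(k.+1)) Xb).
    exact (linked_bound hG lcG hmu Db (ltW e3) (linkedB hG lcG hmu lZ (lp _)) h2).
  have P3 := opbound_comp M0 P1 HIk.
  have P4 : opbound (opoly (h * 'X^(k.+1)) X - (opoly h X \o Ik)) (e / 3 + e / 3).
    have H4 : ((2 * eta)^-1 ^+ k.+1 + e / 3) * eta ^+ k.+1 <= e / 3 + e / 3.
      rewrite mulrDl; apply: lerD.
        by rewrite -exprMn invfM -mulrA mulVf ?gt_eqF// mulr1.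
      rewrite ler_piMr ?(ltW e3)// exprn_ile1 ?(ltW e0)//.
      by apply: le_trans e1; rewrite ler_peMl ?(ltW e0)// ler1n.
    move=> u; apply: le_trans (ler_wpM2r (L2norm_ge0 _) H4).
    rewrite -[(_ - _) u]/(opoly (h * 'X^(k.+1)) X u - opoly h X (Ik u)).
    rewrite (opolyM _ _ _ Xb.1) -(linB _ _ hXb.1); exact: P3.
  apply: opboundW (opbound_tri P2 P4); rewrite le_eqVlt; apply/orP; left; apply/eqP.
  by lra.
pose r : {poly R} := \sum_(j < n) (1 - 'X) ^+ j.
have rX : opbound (opoly r X) n%:R.
  have rx : opbound (opoly r x) n%:R.
    by apply: (opoly_bound xp) => t; exact: geometric_sum_le.
  exact (linked_bound hG lcG hmu (opoly_bounded r Xb) (ler0n _ _) (lp r) rx).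
exists ((b \o z) \o opoly r x), ((B \o Z) \o opoly r X); split.
- exact (ideal_opoly_right idA r Ax (reduced_algebra_comp hGs hnu Ab Az)).
- exact: linked_comp (linked_comp lb lZ) (lp r).
- exact (ideal_opoly_right idI r AX (ideal_left idI AB IZ)).
apply: (opbound_tri aB).
have D1 : opbound (B \o opoly ((1 - 'X) ^+ n) X) dl.
  have dec := square_decay bb.1 bb'.1 adj b1 dl0 Hdl.
  have Db := bounded_comp Bb (opoly_bounded ((1 - 'X) ^+ n) Xb).
  exact (linked_bound hG lcG hmu Db dl0 (linked_comp lb (lp _)) dec).
have D2 : opbound (X - Z) (2 * eta).
  exact (linked_bound hG lcG hmu (boundedB Xb Zb) (ltW c0) (linkedB hG lcG hmu lx lZ) (opboundBC zx)).
move=> u; rewrite -[(_ - _) u]/(B u - B (Z (opoly r X u))).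
rewrite -(linB _ _ Bb.1).
have -> : u - Z (opoly r X u) = opoly ((1 - 'X) ^+ n) X u + (X - Z) (opoly r X u).
  rewrite -[(X - Z) _]/(X (opoly r X u) - Z (opoly r X u)) addrA; congr (_ - _).
  have := geometric_telescope (1 - 'X : {poly R}) n; rewrite subKr -/r => E.
  rewrite -{1}(opolyX X (opoly r X u)) -(opolyM 'X r u Xb.1) E.
  by rewrite opolyB opoly1 addrC subrK.
rewrite (linD _ _ Bb.1) mulrDl; apply: le_trans (L2normD _ _) _; apply: lerD; first exact: D1.
apply: le_trans (B1 _) _; rewrite mul1r; apply: le_trans (D2 _) _.
by rewrite -[leRHS]mulrA ler_wpM2l ?(ltW c0)//; exact: rX.
Qed.

(** The trace on [H] of the ideal [I] of the algebra of [G]. *)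
Definition restr_ideal : set (L2 nu -> L2 nu) :=
  [set S | reduced_algebra nu S /\ exists2 T, I T & linked S T].

Lemma restr_ideal_closed : closed_ideal nu restr_ideal.
Proof.
have sub : restr_ideal `<=` bounded_operator (mu := nu).
  by move=> S [AS _]; exact: reduced_algebra_bounded AS.
split.
- by move=> S [].
- split; first exact: reduced_algebra0.
  by exists 0; [exact: ideal_zero idI|exact: linked0].
- move=> a S S' [AS [T IT ST]] [AS' [T' IT' ST']]; split; first exact: reduced_algebra_lin.
  by exists (a *: T + T'); [exact: (ideal_linear idI)|exact: linked_lin].
- move=> S S' AS [AS' [T' IT' ST']]; split; first exact (reduced_algebra_comp hGs hnu AS AS').
  have [T AT ST] := reduced_algebra_linked hG lcG hmu AS.
  by exists (T \o T'); [exact: (ideal_left idI)|exact: linked_comp].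
- move=> S S' [AS [T IT ST]] AS'; split; first exact (reduced_algebra_comp hGs hnu AS AS').
  have [T' AT' ST'] := reduced_algebra_linked hG lcG hmu AS'.
  by exists (T \o T'); [exact: (ideal_right idI)|exact: linked_comp].
move=> S /(opclosureP _ sub)[Sb HS].
have AS : reduced_algebra nu S.
  apply: (ideal_limit (reduced_algebra_ideal hGs hnu) Sb) => e /HS[S' [AS' _] SS'].
  by exists S'.
split => //; have [T AT ST] := reduced_algebra_linked hG lcG hmu AS.
have Tb := reduced_algebra_bounded AT; exists T => //.
apply: (ideal_limit idI Tb) => e e0; have [S' [AS' [T' IT' ST']] SS'] := HS e e0.
exists T' => //; have Tb' := ideal_bounded idI IT'.
exact (linked_bound hG lcG hmu (boundedB Tb Tb') (ltW e0) (linkedB hG lcG hmu ST ST') SS').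
Qed.

End Subgroup.

(** Every element of a closed ideal is approximated by elements of the ideal which
    come from an open compactly generated subgroup. Such an element is close to some
    [lambda(f)] with [f] supported in a compact set, which generates such a
    subgroup together with a compact neighborhood of the identity. *)
Lemma ideal_local a (e : R) : I a -> 0 < e ->
  exists (H : groupClosed G) (oH : open [set` H]), compactly_generated H /\
  exists S T, [/\ reduced_algebra (coset_measure mu oH 1%g) S, linked S T, I T & opbound (a - T) e].
Proof.
move=> Ia e0; have ab := ideal_bounded idI Ia; have [M M0 aM] := bounded_opbound ab.
pose k : R := (2 * (M + 1))^-1; have M1 : 0 < M + 1 by rewrite ltr_wpDl.
have k0 : 0 < k by rewrite invr_gt0 mulr_gt0.
(* The norm of [a1] is at most [1/2], which leaves room for [B] to be a contraction. *)
pose a1 := k%:C *: a.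
have Ia1 : I a1 by exact: idealZ.
have a1b := ideal_bounded idI Ia1.
have a1h : opbound a1 2^-1.
  move=> u; rewrite -[a1 u]/(k%:C *: a u) L2normZ cabsR ger0_norm ?(ltW k0)//.
  apply: le_trans (ler_wpM2l (ltW k0) (aM u)) _.
  rewrite mulrA ler_wpM2r ?L2norm_ge0// /k mulrC invfM mulrA ler_pdivrMr//.
  by rewrite mulrC ler_wpM2l// lerDl.
pose dl := e * k / 3; have dl0 : 0 < dl by rewrite divr_gt0// mulr_gt0.
have [n Hn] : exists n : nat, 1 <= n.*2.+1%:R * dl ^+ 2.
  have d2 : 0 <= (dl ^+ 2)^-1 by rewrite invr_ge0 exprn_ge0// ltW.
  exists (Num.bound (dl ^+ 2)^-1); have := archi_boundP d2.
  set N := Num.bound _ => /ltW HN; rewrite -ler_pdivrMr ?exprn_gt0// div1r.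
  by apply: le_trans HN _; rewrite ler_nat -addnn -addnS leq_addr.
(* The error [eta + (dl + 2 * eta * n)] below is then at most [2 * dl < e * k]. *)
pose eta := Num.min 2^-1 (dl / n.*2.+1%:R).
have N0 : 0 < n.*2.+1%:R :> R by rewrite ltr0n.
have eta0 : 0 < eta by rewrite lt_min invr_gt0 ltr0n divr_gt0.
have eta1 : eta <= 2^-1 by rewrite ge_min lexx.
have eta2 : eta * n.*2.+1%:R <= dl by rewrite -ler_pdivlMr// ge_min lexx orbT.
have h0 : 0 < eta / 2 by rewrite divr_gt0.
have [_ Ha1] := (reduced_algebraP _).1 (ideal_sub idI Ia1).
have [S' [f f1 fS'] aS'] := Ha1 _ h0.
have [mf fi] := (cLfun1_cabs _ _).1 f1.
have [K cK HK] := haar_tail hG hmu fi (fun x => cabs_ge0 _) h0.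
have [H [oH cgH KH]] := ex_open_compactly_generated lcG cK.
exists H, oH; split => //.
pose g := cext (H := H) 1%g (cres (H := H) 1%g f).
have r1 := cres_L1 hG lcG hmu oH 1%g f1.
have g1 : g \in cLfun mu 1 := ((cext_L1 hG lcG hmu oH 1%g _).1 r1).2.
have [b bf] := ex_integrated_form (subgroup_hausdorff hG (H := H) : hausdorff_space (subgroup_type H))
  (coset_measure_haar hG hmu oH 1%g) r1.
have [B Bg] := ex_integrated_form hG hmu g1.
have lbB : linked b B := linked_integrated_form hG lcG hmu r1 bf Bg.
have Ab : reduced_algebra (coset_measure mu oH 1%g) b.
  by apply: sub_L1_reduced; exists (cres (H := H) 1%g f).
have AB : reduced_algebra mu B by apply: sub_L1_reduced; exists g.
have SB : opbound (S' - B) (eta / 2).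
  have D := integrated_form_lin hG hmu (-1) g1 f1 Bg fS'.
  have E : (fun x => -1 * g x + f x) = (fun x => f x - g x).
    by apply/funext => x; rewrite mulN1r addrC.
  rewrite E in D.
  have Db := integrated_form_bound hG hmu (cLfun1B f1 g1) D.
  move=> u; rewrite -[(S' - B) u]/(S' u - B u) addrC -scaleN1r.
  apply: le_trans (Db u) _; rewrite ler_wpM2r ?L2norm_ge0//; apply: le_trans HK.
  apply: le_Rintegral => //.
  - by have [] := (cLfun1_cabs _ _).1 (cLfun1B f1 g1).
  - apply: le_rintegrable fi.
      apply: measurable_funM; first exact: measurable_cabs.
      by apply: measurable_indic; apply: measurableC; exact: borel_compact.
    by move=> x; rewrite ger0_norm ?mulr_ge0 ?cabs_ge0 ?indic_ge0// ler_piMr ?cabs_ge0 ?indic_le1.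
  move=> x _; rewrite /g cext_res [\1_(~` K) x]indicE in_setC.
  have [xK|xK] := boolP (x \in K).
    rewrite indicE mem_set ?mulr1 ?subrr ?cabs0 ?mulr0//.
    by rewrite /coset/= invg1 mulg1; apply: KH; move: xK; rewrite inE.
  rewrite mulr1 indicE; case: (_ \in _); last by rewrite mulr0 subr0.
  by rewrite mulr1 subrr cabs0 cabs_ge0.
have aB : opbound (a1 - B) eta by rewrite [eta]splitr; exact: opbound_tri aS' SB.
have B1 : opbound B 1.
  move=> u; rewrite -[B u](subKr (a1 u)); apply: le_trans (L2normB _ _) _.
  apply: le_trans (lerD (a1h u) (aB u)) _; rewrite -mulrDl ler_wpM2r ?L2norm_ge0//.
  by rewrite [leRHS](splitr 1) mul1r lerD2l.
have e1 : 2 * eta <= 1 by rewrite mulrC -ler_pdivlMr// mul1r.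
have [S [T [AS ST IT aT]]] := ideal_local_subgroup Ab AB lbB Ia1 eta0 e1 (ltW dl0) Hn aB B1.
exists ((k^-1)%:C *: S), ((k^-1)%:C *: T); split.
- have hGs := subgroup_hausdorff hG (H := H) : hausdorff_space (subgroup_type H).
  exact (idealZ (reduced_algebra_ideal hGs (coset_measure_haar hG hmu oH 1%g)) _ AS).
- exact: linkedZ.
- exact: idealZ.
move=> u; rewrite -[(a - _) u]/(a u - (k^-1)%:C *: T u).
have -> : a u - (k^-1)%:C *: T u = (k^-1)%:C *: (a1 - T) u.
  rewrite -[(a1 - T) u]/(k%:C *: a u - T u) scalerBr scalerA -rmorphM/= mulVf ?gt_eqF//.
  by rewrite scale1r.
have ki0 : 0 <= k^-1 by apply: ltW; rewrite invr_gt0.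
rewrite L2normZ cabsR ger0_norm//.
apply: le_trans (ler_wpM2l ki0 (aT u)) _.
rewrite mulrA ler_wpM2r ?L2norm_ge0// mulrC ler_pdivrMr//.
have -> : eta + (dl + 2 * eta * n%:R) = eta * n.*2.+1%:R + dl.
  rewrite -[n.*2.+1]add1n natrD -muln2 natrM; ring.
apply: le_trans (lerD eta2 (lexx _)) _; rewrite /dl -mulrDl ler_pdivrMr//.
by have : 0 < e * k by [exact: mulr_gt0]; move: (e * k) => p; lra.
Qed.

End LocalApproximation.

Arguments restr_ideal [R G mu] I [H] oH _.

Section TraceOnSubgroups.
Variables (R : realType) (G : topologicalGroupType).
Hypothesis hG : hausdorff_space G.
Hypothesis lcG : locally_compact [set: G].
Variable mu : {measure set (borel G) -> \bar R}.
Hypothesis hmu : left_haar mu.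
Variables I J : set (L2 mu -> L2 mu).
Hypotheses (idI : closed_ideal mu I) (idJ : closed_ideal mu J).

(** An operator linked to one in L1 of [H] is in L1 of [G], being unique. *)
Lemma restr_ideal_sub_L1 (H : groupClosed G) (oH : open [set` H]) :
  I `&` L1_operators mu `<=` J ->
  restr_ideal I oH `&` L1_operators (coset_measure mu oH 1%g) `<=` restr_ideal J oH.
Proof.
move=> IJ S [[AS [T IT ST]] L1S]; split => //; exists T => //; apply: IJ; split => //.
exact: (linked_L1 hG lcG hmu (ideal_bounded idI IT) ST L1S).
Qed.

(** Closed ideals are determined by their traces on the open compactly generated
    subgroups. *)
Lemma ideal_sub_of_restr :
  (forall (H : groupClosed G) (oH : open [set` H]), compactly_generated H ->
     restr_ideal I oH `<=` restr_ideal J oH) -> I `<=` J.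
Proof.
move=> IJ a Ia; apply: (ideal_limit idJ (ideal_bounded idI Ia)) => e e0.
have [H [oH [cgH [S [T [AS ST IT aT]]]]]] := ideal_local hG lcG hmu idI Ia e0.
have [|_ [T' JT' ST']] := IJ H oH cgH S; first by split => //; exists T.
exists T => //; rewrite (linked_unique hG lcG hmu (ideal_bounded idI IT) (ideal_bounded idJ JT') ST ST').
by [].
Qed.

End TraceOnSubgroups.

Lemma zero_ideal (R : realType) (G : topologicalGroupType)
  (mu : {measure set (borel G) -> \bar R}) : left_haar mu -> closed_ideal mu [set 0].
Proof.
move=> hmu.
have sub : [set 0] `<=` bounded_operator (mu := mu) by move=> _ ->; exact: bounded0.
split.
- by move=> _ ->; exact: reduced_algebra0.
- by [].
- by move=> a S S' -> ->; rewrite scaler0 addr0.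
- move=> S S' AS ->; apply/funext => u; rewrite -[LHS]/(S 0) lin0//.
  exact: (reduced_algebra_bounded AS).1.
- by move=> S S' -> _; apply/funext => u.
move=> S /(opclosureP _ sub)[Sb HS]; apply/funext => u; apply/L2norm_eq0/eqP.
rewrite eq_le L2norm_ge0 andbT; apply/ler_addgt0Pr => /= e e0; rewrite add0r.
have u1 : 0 < L2norm u + 1 by rewrite ltr_wpDl ?L2norm_ge0.
have [_ -> /(_ u)] := HS _ (divr_gt0 e0 u1); rewrite subr0 => /le_trans; apply.
by rewrite mulrAC ler_pdivrMr// ler_wpM2l ?(ltW e0)// lerDl.
Qed.

Theorem corollary3p4 (R : realType) (G : topologicalGroupType)
    (hausdorffG : hausdorff_space G) (lcG : locally_compact [set: G]) :
  ((forall H : groupClosed G, open [set` H] -> compactly_generated H ->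
      ISP R (subgroup_type H)) -> ISP R G) /\
  ((forall H : groupClosed G, open [set` H] -> compactly_generated H ->
      IIP R (subgroup_type H)) -> IIP R G).
Proof.
split=> subgroups mu hmu.
  move=> I J idI idJ + IJL1; apply; apply/seteqP.
  have restrE (H : groupClosed G) (oH : open [set` H]) : compactly_generated H ->
      restr_ideal I oH = restr_ideal J oH.
    move=> cgH; apply: contrapT => neq.
    apply: (subgroups H oH cgH _ (coset_measure_haar hausdorffG hmu oH 1%g) _ _
      (restr_ideal_closed hausdorffG lcG hmu idI oH)
      (restr_ideal_closed hausdorffG lcG hmu idJ oH) neq).
    apply/seteqP; split=> S HS; split; try exact: HS.2.
      apply: (restr_ideal_sub_L1 hausdorffG lcG hmu idI (J := J) _ HS).
      by rewrite IJL1 => T [].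
    apply: (restr_ideal_sub_L1 hausdorffG lcG hmu idJ (J := I) _ HS).
    by rewrite -IJL1 => T [].
  split.
    by apply: (ideal_sub_of_restr hausdorffG lcG hmu idI idJ) => H oH cgH; rewrite restrE.
  by apply: (ideal_sub_of_restr hausdorffG lcG hmu idJ idI) => H oH cgH; rewrite restrE.
move=> I idI + IL1; apply; apply/seteqP.
split; last by move=> _ ->; exact: ideal_zero idI.
apply: (ideal_sub_of_restr hausdorffG lcG hmu idI (zero_ideal hmu)) => H oH cgH.
have hnu := coset_measure_haar hausdorffG hmu oH 1%g.
have idIH := restr_ideal_closed hausdorffG lcG hmu idI oH.
have restr0 : restr_ideal I oH = [set 0].
  apply: contrapT => neq; apply: (subgroups H oH cgH _ hnu _ idIH neq).
  apply/seteqP; split=> S; last first.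
    by move=> ->; split; [exact: ideal_zero idIH|exact: L1_operators0].
  move=> HS; have IL0 : I `&` L1_operators mu `<=` [set 0] by rewrite IL1.
  have [_ [T T0 ST]] := restr_ideal_sub_L1 hausdorffG lcG hmu idI IL0 HS.
  apply/funext => u; apply/L2norm_eq0/eqP; rewrite eq_le L2norm_ge0 andbT.
  have Tb : opbound T 0 by rewrite T0 => v; rewrite -[(0 : L2 mu -> L2 mu) v]/0 L2norm0 mul0r.
  by have := linked_boundV hausdorffG lcG hmu (lexx 0) ST Tb u; rewrite mul0r.
rewrite restr0 => _ ->; split; first exact: reduced_algebra0.
by exists 0 => //; exact: linked0.
Qed.
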